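(* For all integers $n$ and $t$ such that $n \geq 6$, $0 \leq t \leq n-4$, and $t \equiv \frac{1}{2}n(n-5) \pmod{2}$, there exists a face-simple nonorientable $(n,t)$-quadrangulation whose underlying graph has a vertex adjacent to every other vertex.
   Context: Graphs are finite, and surfaces are connected closed surfaces (compact 2-manifolds without boundary). An embedding of a graph in a surface is cellular if every face (connected component of the complement of the embedded graph) is homeomorphic to an open disk; the length of a face is the length of its boundary walk. A quadrangular embedding is a cellular embedding in which every face has length 4. An $(n,t)$-quadrangulation is a quadrangular embedding, in some surface, of a simple graph (no loops, no parallel edges) on $n$ vertices and $\binom{n}{2}-t$ edges. It is called nonorientable if the surface is nonorientable. An embedding is face-simple if its dual graph is simple, i.e., no two distinct faces share more than one edge, and no edge has two incidences with the same face. *)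

(* Defs.v *)
From HB Require Import structures.
From mathcomp Require Import all_boot all_order all_algebra.
From mathcomp Require Import all_classical all_reals all_analysis.

Set Implicit Arguments.
Unset Strict Implicit.
Unset Printing Implicit Defensive.

Import Order.TTheory GRing.Theory Num.Theory.
Import numFieldNormedType.Exports.

Local Open Scope classical_set_scope.
Local Open Scope ring_scope.

(* Maps between subsets are total functions whose values outside the source   *)
(* set are irrelevant; [{within A, continuous f}] is continuity of the        *)
(* restriction of [f] to [A] for the subspace topology.                       *)
Definition homeomorphism (X Y : topologicalType) (A : set X) (B : set Y)
    (f : X -> Y) : Prop :=
  [/\ {within A, continuous f}, set_bij A B f &
      exists2 g : Y -> X, {within B, continuous g} & {in A, cancel f g}].

Definition homeomorphic (X Y : topologicalType) (A : set X) (B : set Y) : Prop :=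
  exists f : X -> Y, homeomorphism A B f.

Definition open_disk (R : realType) : set (R * R) :=
  [set p | p.1 ^+ 2 + p.2 ^+ 2 < 1].

Definition closed_disk (R : realType) : set (R * R) :=
  [set p | p.1 ^+ 2 + p.2 ^+ 2 <= 1].

(* The point of the unit circle after [x] full turns. *)
Definition circle_point (R : realType) (x : R) : R * R :=
  (cos (2 * pi * x), sin (2 * pi * x)).

Definition locally_planar (R : realType) (S : topologicalType) : Prop :=
  forall x : S, exists (U : set S) (D : set (R * R)),
    [/\ open U, U x, open D & homeomorphic U D].

(* Second countability is not listed: it follows from compactness and local   *)
(* planarity.                                                                 *)
Definition surface (R : realType) (S : topologicalType) : Prop :=
  [/\ hausdorff_space S, compact [set: S], connected [set: S] &
      locally_planar R S].

Definition unit_square (R : realType) : set (R * R) := `[0, 1] `*` `[0, 1].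

(* The equivalence relation on the unit square whose quotient is the Moebius  *)
(* band: the side x = 0 is glued to the side x = 1 with a flip.               *)
Definition mobius_glued (R : realType) (p q : R * R) : Prop :=
  [\/ p = q,
      [/\ p.1 = 0, q.1 = 1 & q.2 = 1 - p.2] |
      [/\ p.1 = 1, q.1 = 0 & q.2 = 1 - p.2]].

(* A surface is nonorientable if it contains a Moebius band.  By compactness  *)
(* of the square, in a Hausdorff space the map [m] below induces a            *)
(* homeomorphism from the Moebius band onto its image.                        *)
Definition nonorientable (R : realType) (S : topologicalType) : Prop :=
  exists m : R * R -> S,
    {within @unit_square R, continuous m} /\
    (forall p q, unit_square p -> unit_square q ->
       (m p = m q <-> mobius_glued p q)).

Definition simple_graph (V : finType) (e : rel V) : Prop :=
  symmetric e /\ irreflexive e.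

Definition edge_set (V : finType) (e : rel V) : {set {set V}} :=
  [set [set p.1; p.2]%SET | p : V * V & e p.1 p.2]%SET.

(* The edge uv is drawn as the arc [edge_arc u v], parametrized by [0, 1]     *)
(* from u to v; [edge_arc v u] is the same arc traversed backwards.  Values   *)
(* at non-adjacent pairs are irrelevant.                                      *)
Record embedding (R : realType) (V : finType) (e : rel V)
    (S : topologicalType) : Type := Embedding {
  vertex_point : V -> S;
  edge_arc : V -> V -> R -> S;
  point_inj : injective vertex_point;
  arc_continuous : forall u v, e u v -> {within `[0, 1], continuous (edge_arc u v)};
  arc_inj : forall u v, e u v -> {in `[0, 1] &, injective (edge_arc u v)};
  arc_source : forall u v, e u v -> edge_arc u v 0 = vertex_point u;
  arc_target : forall u v, e u v -> edge_arc u v 1 = vertex_point v;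
  arc_reverse : forall u v (s : R), e u v -> s \in `[0, 1] ->
    edge_arc v u s = edge_arc u v (1 - s);
  arc_avoids_points : forall u v w (s : R), e u v -> s \in `]0, 1[ ->
    edge_arc u v s <> vertex_point w;
  arcs_disjoint : forall u v x y (s s' : R), e u v -> e x y ->
    [set u; v]%SET != [set x; y]%SET -> s \in `]0, 1[ -> s' \in `]0, 1[ ->
    edge_arc u v s <> edge_arc x y s'
}.

Section Faces.
Variables (R : realType) (V : finType) (e : rel V) (S : topologicalType).
Variable M : embedding R e S.

Definition graph_image : set S :=
  [set x | (exists v, x = vertex_point M v) \/
           (exists u v s, [/\ e u v, s \in `[0, 1] & x = edge_arc M u v s])].

Definition face (F : set S) : Prop :=
  exists2 x, (~` graph_image) x & F = connected_component (~` graph_image) x.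

Definition cellular : Prop :=
  forall F, face F -> homeomorphic F (@open_disk R).

(* A sequence w of length k stands for the closed walk                        *)
(* w_0, w_1, ..., w_(k-1), w_0; [ordS] is the cyclic successor.                *)
Definition walk_vertex (w : seq V) (i : 'I_(size w)) : V := tnth (in_tuple w) i.

Definition closed_walk (w : seq V) : Prop :=
  forall i : 'I_(size w), e (walk_vertex i) (walk_vertex (ordS i)).

Definition walk_edges (w : seq V) : seq {set V} :=
  [seq [set walk_vertex i; walk_vertex (ordS i)]%SET | i : 'I_(size w)].

(* The closed walk w bounds F: some map from the closed disk restricts to a   *)
(* homeomorphism from the open disk onto F, and going once around the circle  *)
(* traverses w, each step taking one k-th of the turn.  Reparametrizing the   *)
(* disk radially makes the speed agree with the given arcs, so that the       *)
(* equality below is no restriction.  Such a w is unique up to rotation and   *)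
(* reversal.                                                                  *)
Definition boundary_walk (F : set S) (w : seq V) : Prop :=
  [/\ (0 < size w)%N, closed_walk w &
      exists phi : R * R -> S,
        [/\ {within @closed_disk R, continuous phi},
            homeomorphism (@open_disk R) F phi &
            forall (i : 'I_(size w)) (s : R), s \in `[0, 1] ->
              phi (circle_point ((i%:R + s) / (size w)%:R)) =
              edge_arc M (walk_vertex i) (walk_vertex (ordS i)) s]].

Definition boundary_walks (bw : set S -> seq V) : Prop :=
  forall F, face F -> boundary_walk F (bw F).

Definition quadrangular (bw : set S -> seq V) : Prop :=
  forall F, face F -> size (bw F) = 4%N.

(* Simplicity of the dual graph: no loops and no parallel edges. *)
Definition face_simple (bw : set S -> seq V) : Prop :=
  (forall F, face F -> uniq (walk_edges (bw F))) /\
  (forall F F', face F -> face F' -> F <> F' ->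
     forall a b, a \in walk_edges (bw F) -> a \in walk_edges (bw F') ->
       b \in walk_edges (bw F) -> b \in walk_edges (bw F') -> a = b).

End Faces.

Definition quadrangulation (R : realType) (n t : nat) (e : rel 'I_n)
    (S : topologicalType) (M : embedding R e S) (bw : set S -> seq 'I_n) :
    Prop :=
  [/\ surface R S,
      simple_graph e /\ #|edge_set e| = ('C(n, 2) - t)%N,
      cellular M,
      boundary_walks M bw &
      quadrangular M bw].

(* Main.v *)
Require Import Defs.
From mathcomp Require Import all_boot all_order all_algebra.
From mathcomp Require Import all_classical all_reals all_analysis.
From mathcomp Require Import ring lra zify.

(* A quadrangular embedding is given by its faces: a relation Q invariant under
   the symmetries of the square such that every vertex link is a cycle.  The
   graphs are produced by a chain of such relations with a fixed vertex v
   adjacent to all others.  If v o c o' and v q x b are faces, x is not adjacent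
   to o, o', and o, o', ..., b, q, ... is the rotation at v, a crosscap move
   replaces both faces so that x becomes adjacent to o and o'.  A complete graph,
   possibly minus an edge, is extended by a new vertex of degree 4 (or 7), whose
   neighbourhood then grows by two with each crosscap move until at most one edge
   is missing again.  The intermediate states have every number of missing edges
   of the right parity up to n - 4.  The order of the neighbours at v allows all
   these moves and depends on n mod 4; the chain starts at n = 9, and the smaller
   n are explicit.
   The surface lies in R^n: the face abcd is the bilinear patch
   (1-x)(1-y) e_a + x(1-y) e_b + xy e_c + (1-x)y e_d.  Distinct faces have
   distinct vertex sets, so the support of a point determines its cell, and the
   patches meet in common edges and vertices only.  Charts at a vertex v come
   from the ratios of the weights to that of v, arranged in a fan of planar
   sectors.  Three faces that avoid v, survive all moves and close up with a
   twist contain a Moebius band. *)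

Set Implicit Arguments.
Unset Strict Implicit.
Unset Printing Implicit Defensive.

(** Every face has four edges and every edge two sides, so the number of edges is even. Since
    n(n-5)/2 = C(n,2) - 2n, this is exactly the congruence on t. Hence K_n can occur only for n = 0,
    1 mod 4, and for n = 2, 3 some edge must be missing. This dictates the period four of the chain:
    from 1 to 2 one edge at the new vertex is left out, from 2 to 3 that pair stays nonadjacent, and
    from 3 to 0 it has to be joined as well. An even number of edges is added at a time, so the
    inserted vertex then has odd degree; this is the origin of the insertion of degree 7. The
    obstacle is that a surgery must neither create two faces with two common edges nor break a link
    into several cycles. Two common edges are adjacent or opposite, which is what [quad_corner] and
    [quad_cross] exclude. Both dangers are local, so the rotation at the hub is the only link whose
    order is carried along the chain. *)

Record quadrangles (V : eqType) (Q : V -> V -> V -> V -> Prop) : Prop :=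
  Quadrangles {
  quad_rot : forall a b c d, Q a b c d -> Q b c d a;
  quad_rev : forall a b c d, Q a b c d -> Q a d c b;
  quad_neq : forall a b c d, Q a b c d -> a != b /\ a != c;
  quad_corner : forall a b c d d', Q a b c d -> Q a b c d' -> d = d';
  quad_cross : forall a b c d, Q a b c d -> Q a b d c -> False
}.

Section Quadrangles.
Variables (V : eqType) (Q : V -> V -> V -> V -> Prop).
Hypothesis QQ : quadrangles Q.

Lemma quad_uniq a b c d : Q a b c d -> uniq [:: a; b; c; d].
Proof.
move=> q; have r := quad_rot QQ q; have r2 := quad_rot QQ r.
have r3 := quad_rot QQ r2.
have [ab ac] := quad_neq QQ q; have [bc bd] := quad_neq QQ r.
have [cd _] := quad_neq QQ r2; have [da _] := quad_neq QQ r3.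
by rewrite /= !inE !negb_or ab ac bc bd cd eq_sym da.
Qed.

(** Four vertices have three cyclic orders up to symmetry, and any two of them share a pair of
    opposite edges. Each of the four bad matchings of the labels is therefore an instance of
    [quad_cross] after rotations and reversals. *)
Lemma quad_align a b c d b' c' d' : Q a b c d -> Q a b' c' d' ->
  {subset [:: b; c; d] <= [:: b'; c'; d']} ->
  [:: b'; c'; d'] = [:: b; c; d] \/ [:: b'; c'; d'] = [:: d; c; b].
Proof.
move=> q q' sub.
have := quad_uniq q; have := quad_uniq q'; rewrite /= !inE !negb_or.
have := sub b; have := sub c; have := sub d; rewrite !inE !eqxx !orbT.
move=> /(_ isT) H1 /(_ isT) H2 /(_ isT) H3.
case/or3P: H1 => /eqP H1; case/or3P: H2 => /eqP H2; case/or3P: H3 => /eqP H3;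
  subst; rewrite ?eqxx /= ?andbF //; try by [left|right].
all: move=> _ _; exfalso; have r := quad_rot QQ; have v := quad_rev QQ.
all: first [exact: (quad_cross QQ q q') | exact: (quad_cross QQ q (v _ _ _ _ q'))
  | exact: (quad_cross QQ (r _ _ _ _ q) (v _ _ _ _ (r _ _ _ _ q')))
  | exact: (quad_cross QQ (r _ _ _ _ q) (r _ _ _ _ (v _ _ _ _ q')))
  | exact: (quad_cross QQ (r _ _ _ _ q') (r _ _ _ _ (v _ _ _ _ q)))
  | exact: (quad_cross QQ (r _ _ _ _ q) (r _ _ _ _ (r _ _ _ _ (v _ _ _ _ q'))))
  | exact: (quad_cross QQ (r _ _ _ _ q) (r _ _ _ _ q'))
  | exact: (quad_cross QQ q' (v _ _ _ _ q))].
Qed.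

End Quadrangles.

(** * Cyclic sequences and links *)

Section CyclicPairs.
Variable T : eqType.
Implicit Types (a b u w x : T) (s m : seq T).

Definition upair a b u w := (u == a) && (w == b) || (u == b) && (w == a).

Fixpoint walk a s u w := if s is b :: s' then upair a b u w || walk b s' u w else false.

(** A cycle is used only through its symmetric relation of consecutive elements, so that rotating or
    reversing the list does not change the relation, and an edit of a cycle is a Boolean identity
    between unions of arcs. *)
Definition cyc s u w := if s is a :: s' then walk a (rcons s' a) u w else false.

Lemma upairC a b : upair a b =2 upair b a.
Proof. by move=> u w; rewrite /upair orbC. Qed.

Lemma upair_sym a b u w : upair a b u w = upair a b w u.
Proof. by rewrite /upair orbC andbC [in X in _ || X]andbC. Qed.

Lemma upairP a b u w : upair a b u w -> (u = a /\ w = b) \/ (u = b /\ w = a).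
Proof. by case/orP => /andP[/eqP-> /eqP->]; [left|right]. Qed.

Lemma upair_out a b u w : (u \notin [:: a; b]) || (w \notin [:: a; b]) -> upair a b u w = false.
Proof.
rewrite -negb_and; apply: contraNF => /upairP[][-> ->]; by rewrite !inE !eqxx ?orbT.
Qed.

Lemma walk_sym a s u w : walk a s u w = walk a s w u.
Proof. by elim: s a => //= b s IH a; rewrite IH upair_sym. Qed.

Lemma cyc_sym s u w : cyc s u w = cyc s w u.
Proof. by case: s => //= a s; exact: walk_sym. Qed.

Lemma walk_cat a s b m u w :
  walk a (s ++ b :: m) u w = walk a (rcons s b) u w || walk b m u w.
Proof. by elim: s a => [|c s IH] a /=; rewrite ?orbF // IH orbA. Qed.

Lemma walk_rev a s b : walk a (rcons s b) =2 walk b (rcons (rev s) a).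
Proof.
move=> u w; elim: s a => [|c s IH] a /=; first by rewrite upairC.
by rewrite IH rev_cons -[in RHS]cats1 cat_rcons walk_cat /= orbF upairC orbC.
Qed.

Lemma walk_mem a s u w : walk a s u w -> (u \in a :: s) && (w \in a :: s).
Proof.
elim: s a => //= b s IH a /orP[/upairP[] [-> ->]|/IH /andP[]].
- by rewrite !inE !eqxx orbT.
- by rewrite !inE !eqxx orbT.
- by rewrite ![_ \in a :: _]in_cons => -> ->; rewrite !orbT.
Qed.

Lemma walk_out a s u w : (u \notin a :: s) || (w \notin a :: s) -> walk a s u w = false.
Proof. by rewrite -negb_and; apply: contraNF; exact: walk_mem. Qed.

Lemma cyc_mem s u w : cyc s u w -> (u \in s) && (w \in s).
Proof.
case: s => //= a s /walk_mem; rewrite !inE !mem_rcons !inE.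
by do 2!case: (_ == a).
Qed.

Lemma cyc_catC s m : cyc (s ++ m) =2 cyc (m ++ s).
Proof.
case: s m => [|a s] [|b m] u w; rewrite ?cats0 //.
by rewrite /= !rcons_cat /= !walk_cat orbC.
Qed.

Lemma cyc_rev s : cyc (rev s) =2 cyc s.
Proof.
move=> u w; case: s => [|a s] //; rewrite rev_cons -cats1 cyc_catC /=.
by rewrite [RHS]walk_rev.
Qed.

Lemma walk_exists a s u : u \in a :: s -> s != [::] -> exists w, walk a s u w.
Proof.
elim: s a => // b s IH a uin _; move: uin; rewrite inE => /orP[/eqP->|uin].
  by exists b; rewrite /= /upair !eqxx.
have [s0|s0] := eqVneq s [::].
  by exists a; move: uin; rewrite s0 inE => /eqP ->; rewrite /= /upair !eqxx orbT.
by have [w uw] := IH b uin s0; exists w; rewrite /= uw orbT.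
Qed.

Lemma mem_cyc s u : u \in s -> exists w, cyc s u w.
Proof.
case: s => // a s uin; apply: walk_exists; last by case: (s).
by move: uin; rewrite !inE mem_rcons inE => /orP[->|->]; rewrite ?orbT.
Qed.

Lemma cyc_consE a s : cyc (a :: s) = walk a (rcons s a).
Proof. by []. Qed.

Lemma walk_rcons_split a s u w : walk a s u w ->
  exists s1 s2, a :: s = s1 ++ u :: w :: s2 \/ a :: s = s1 ++ w :: u :: s2.
Proof.
elim: s a => //= b s IH a /orP[/upairP[] [-> ->]|/IH[s1 [s2 h]]].
- by exists [::], s; left.
- by exists [::], s; right.
- by exists (a :: s1), s2; case: h => ->; [left|right].
Qed.

Lemma cyc_split s u w : cyc s u w -> (1 < size s)%N ->
  exists2 m, perm_eq s (u :: w :: m) & cyc s =2 cyc (u :: w :: m).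
Proof.
suff gen u' w' : (exists s1 s2, s = s1 ++ u' :: w' :: s2) \/ (exists m, s = w' :: rcons m u') ->
    exists2 m, perm_eq s (u' :: w' :: m) & cyc s =2 cyc (u' :: w' :: m).
  have flip x y : (exists2 m, perm_eq s (x :: y :: m) & cyc s =2 cyc (x :: y :: m)) ->
      exists2 m, perm_eq s (y :: x :: m) & cyc s =2 cyc (y :: x :: m).
    case=> m pm e; exists (rev m) => [|a b].
      apply: perm_trans pm _; rewrite -[x :: y :: m]/([:: x] ++ [:: y] ++ m).
      by rewrite perm_catCA /= !perm_cons perm_sym perm_rev.
    rewrite e -cyc_rev -[x :: y :: m]/([:: x; y] ++ m) rev_cat cyc_catC.
    by [].
  case: s gen flip => // a s gen flip /walk_rcons_split[s1 [s2]] h s2n.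
  case/lastP: s2 h => [|s2 z].
    have last2 x y : a :: rcons s a = s1 ++ [:: x; y] ->
        exists2 m, perm_eq (a :: s) (x :: y :: m) & cyc (a :: s) =2 cyc (x :: y :: m).
      rewrite -cat_rcons cats1 -rcons_cons => /rcons_inj[e ey]; apply: gen; right.
      by case: s1 e => [|a' s1] /= [? e]; [move: s2n; rewrite e | exists s1; subst].
    by case=> /last2 //; exact: flip.
  rewrite -!rcons_cons -!rcons_cat.
  case=> /rcons_inj[e _]; first by apply: gen; left; exists s1, s2.
  by apply: flip; apply: gen; left; exists s1, s2.
case=> [[s1 [s2 e]]|[m e]].
  exists (s2 ++ s1) => [|a b]; first by rewrite e perm_catC.
  by rewrite e cyc_catC.
exists m => [|a b]; rewrite e -cats1 -cat_cons; first by rewrite perm_catC.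
by rewrite cyc_catC.
Qed.

(** The direction in which the second edge is met is unknown, hence the alternative. It is the
    source of the undetermined vertex [e] of [insert_step]. *)
Lemma cyc_split2 s u w a b : uniq s -> (1 < size s)%N -> cyc s u w -> cyc s a b ->
  a \notin [:: u; w] -> b \notin [:: u; w] ->
  exists a' b' S R, [/\ [:: a'; b'] = [:: a; b] \/ [:: a'; b'] = [:: b; a],
    perm_eq s (u :: w :: S ++ a' :: b' :: R) & cyc s =2 cyc (u :: w :: S ++ a' :: b' :: R)].
Proof.
move=> us s2 uw ab na nb; have [m pm e] := cyc_split uw s2.
move: ab; rewrite e /= => /orP[/upairP[][? ?]|]; try by subst; rewrite inE eqxx in na.
  by subst; rewrite !inE eqxx orbT in na.
move=> /walk_rcons_split[s1 [s3 h]].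
suff [S [R e']] : exists S R, m = S ++ a :: b :: R \/ m = S ++ b :: a :: R.
  case: e' => e'; [exists a, b, S, R | exists b, a, S, R]; rewrite -e'; split=> //; by [left|right].
case: s1 h => [|z s1].
  by case=> -[? _]; subst; [rewrite !inE eqxx orbT in na | rewrite !inE eqxx orbT in nb].
case/lastP: s3 => [|s3 z'].
  have last2 x y : w :: rcons m u = (z :: s1) ++ [:: x; y] -> y = u.
    by rewrite -cat_rcons cats1 -!rcons_cons => /rcons_inj[].
  by case=> /last2 e'; subst; [move: nb | move: na]; rewrite inE eqxx.
rewrite !cat_cons -!rcons_cons -!rcons_cat.
by case=> -[_ /rcons_inj[-> _]]; exists s1, s3; [left|right].
Qed.

(** [C] stands for the arcs that both cycles keep, [R] for the edges taken out and [A] for those put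
    in. Disjointness of [R] and [C] is what makes removing [R] leave exactly [C]. *)
Lemma cyc_edit s s' (C R A : T -> T -> bool) :
  (forall u w, cyc s u w = R u w || C u w) -> (forall u w, cyc s' u w = A u w || C u w) ->
  (forall u w, R u w -> C u w -> False) ->
  forall u w, (cyc s u w /\ ~~ R u w) \/ A u w <-> cyc s' u w.
Proof.
move=> e e' RC u w; rewrite e e'; have := RC u w.
case: (R u w); case: (C u w); case: (A u w) => /= h; split; try (by []); tauto.
Qed.

End CyclicPairs.

Section Links.
Implicit Types (Q : nat -> nat -> nat -> nat -> Prop) (z u w : nat) (s : seq nat).

(** An edge uw of the link is a face in which u and w are the neighbours of z; the opposite vertex
    is quantified away. Degree at least four is what the planar fan of sectors used for the charts
    requires. *)
Definition link Q z s :=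
  [/\ uniq s, 3 < size s & forall u w, (exists c, Q z u c w) <-> cyc s u w].

Lemma link_equiv Q z s s' : link Q z s -> perm_eq s s' -> cyc s =2 cyc s' -> link Q z s'.
Proof.
case=> us s4 h p e; split; first by rewrite -(perm_uniq p).
  by rewrite -(perm_size p).
by move=> u w; rewrite -e.
Qed.

Lemma link_adj Q z s u : quadrangles Q -> link Q z s -> (exists c d, Q z u c d) <-> u \in s.
Proof.
move=> QQ [us s4 h]; split=> [[c [d q]]|/mem_cyc[w /h[c q]]].
  have /cyc_mem/andP[//] : cyc s u d by apply/h; exists c.
by exists c, w.
Qed.

Lemma link_self Q z s : quadrangles Q -> link Q z s -> z \notin s.
Proof.
move=> QQ l; apply/negP => /(link_adj _ QQ l)[c [d q]].
by have [] := quad_neq QQ q; rewrite eqxx.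
Qed.

End Links.

(** * Surgery on faces *)

Section Dihedral.
Variable T : eqType.
Implicit Types (f : T * T * T * T) (F : seq (T * T * T * T)).

Definition dih f := let: (a, b, c, d) := f in
  [:: (a, b, c, d); (b, c, d, a); (c, d, a, b); (d, a, b, c);
      (a, d, c, b); (d, c, b, a); (c, b, a, d); (b, a, d, c)].

Definition dihs F := flatten [seq dih f | f <- F].

(** A corner [(a, b, d)] is the edge bd of the link of a, so lists of corners record how a surgery
    changes the links. *)
Definition corner_of f := let: (a, b, c, d) := f in (a, b, d).

Definition corners F := [seq corner_of f | f <- dihs F].

Lemma dih_rot a b c d F : (a, b, c, d) \in dihs F -> (b, c, d, a) \in dihs F.
Proof.
case/flatten_mapP=> -[[[x y] z] t] fF h; apply/flatten_mapP; exists (x, y, z, t) => //.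
move: h; rewrite /dih !inE !xpair_eqE.
by do 7?[case/orP]; case/andP=> /andP[/andP[/eqP-> /eqP->] /eqP->] /eqP->;
  rewrite !eqxx ?orbT.
Qed.

Lemma dih_rev a b c d F : (a, b, c, d) \in dihs F -> (a, d, c, b) \in dihs F.
Proof.
case/flatten_mapP=> -[[[x y] z] t] fF h; apply/flatten_mapP; exists (x, y, z, t) => //.
move: h; rewrite /dih !inE !xpair_eqE.
by do 7?[case/orP]; case/andP=> /andP[/andP[/eqP-> /eqP->] /eqP->] /eqP->;
  rewrite !eqxx ?orbT.
Qed.

End Dihedral.

Fixpoint Alls (T : Type) (P : T -> Prop) (s : seq T) : Prop :=
  if s is x :: s' then P x /\ Alls P s' else True.

Lemma AllsP (T : eqType) (P : T -> Prop) (s : seq T) x : Alls P s -> x \in s -> P x.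
Proof.
by elim: s => //= y s IH [Py Ps]; rewrite inE => /orP[/eqP->|/(IH Ps)].
Qed.

Definition quad_of (Q : nat -> nat -> nat -> nat -> Prop) f : Prop :=
  let: (a, b, c, d) := f in Q a b c d.

Lemma dih_quad Q f g : quadrangles Q -> quad_of Q f -> g \in dih f -> quad_of Q g.
Proof.
move=> QQ; case: f => -[[a b] c] d /= q; have r := quad_rot QQ; have v := quad_rev QQ.
have q1 := r _ _ _ _ q; have q2 := r _ _ _ _ q1; have q3 := r _ _ _ _ q2.
have p := v _ _ _ _ q; have p1 := r _ _ _ _ p; have p2 := r _ _ _ _ p1; have p3 := r _ _ _ _ p2.
by rewrite !inE; do 7?[case/orP]; move/eqP->.
Qed.

Definition surgery (Q : nat -> nat -> nat -> nat -> Prop) rem add a b c d : Prop :=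
  (Q a b c d /\ (a, b, c, d) \notin dihs rem) \/ (a, b, c, d) \in dihs add.

(* Faces are written with labels [i] standing for the vertices [nth 0 vs i],  *)
(* which need not be distinct.  The conditions for the surgery to be legal    *)
(* are then a computation on labels, given lists of pairs of labels of        *)
(* distinct vertices ([neq]) and of nonadjacent vertices ([nadj]), of triples *)
(* that are not corners ([nk]) and of quadruples that are not faces ([nx]).   *)
Section Surgery.
Variables (Q : nat -> nat -> nat -> nat -> Prop) (vs : seq nat).
Variables (rem add : seq (nat * nat * nat * nat)) (neq nadj : seq (nat * nat)).
Variables (nk : seq (nat * nat * nat)) (nx : seq (nat * nat * nat * nat)).

Local Notation V i := (nth 0 vs i).
Definition label4 f := let: (a, b, c, d) := f in (V a, V b, V c, V d).
Definition label3 f := let: (a, b, c) := f in (V a, V b, V c).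
Definition label2 f := let: (a, b) := f in (V a, V b).

Definition sym_mem (s : seq (nat * nat)) i j := ((i, j) \in s) || ((j, i) \in s).
Definition distinct_labels := sym_mem neq.
Definition no_edge := sym_mem nadj.
Definition no_corner a b d :=
  [|| no_edge a b, no_edge a d, (a, b, d) \in nk | (a, d, b) \in nk].
(** Either some corner of [f] is known not to occur, or [f] is listed as a nonface, or it is one of
    the removed faces and thus cannot survive. *)
Definition no_face f := let: (a, b, c, d) := f in
  [|| no_corner a b d, no_corner b c a, no_corner c d b, no_corner d a c,
      f \in dihs nx | f \in dihs rem].

(** These are the axioms of [quadrangles] for an added face: nondegeneracy, no crossing with an old
    face that survives, a corner that is either new or freed by a removed face, and compatibility
    with every added face for both [quad_corner] and [quad_cross]. *)
Definition legal_face f := let: (a, b, c, d) := f in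
  [&& distinct_labels a b, distinct_labels a c, no_face (a, b, d, c),
      no_corner a b d || ((a, b, d) \in corners rem) &
      all (fun g => let: (a', b', c', d') := g in
        [|| distinct_labels a a', distinct_labels b b', distinct_labels d d' | c == c'] &&
        [|| distinct_labels a a', distinct_labels b b', distinct_labels c d' |
            distinct_labels d c']) (dihs add)].

(** A corner lost with one face and regained with another leaves the link unchanged, so only the
    differences are kept. *)
Definition net_rem := [seq c <- corners rem | c \notin corners add].
Definition net_add := [seq c <- corners add | c \notin corners rem].

(** Different labels may name the same vertex. The second conjunct ensures that a corner which is
    regained is not at the same time, under other labels, one of the corners lost for good. *)
Definition legal := all legal_face (dihs add) &&
  all (fun c => let: (z, u, w) := c in
    all (fun c' => let: (z', u', w') := c' in
      [|| distinct_labels z z', distinct_labels u u' | distinct_labels w w']) net_rem)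
    [seq c <- corners rem | c \in corners add].

Record surgery_facts : Prop := SurgeryFacts {
  facts_rem : Alls (fun f => quad_of Q (label4 f)) rem;
  facts_neq : Alls (fun p => V p.1 != V p.2) neq;
  facts_nadj : Alls (fun p => forall c d, ~ Q (V p.1) (V p.2) c d) nadj;
  facts_nk : Alls (fun p => forall c, ~ Q (V p.1.1) (V p.1.2) c (V p.2)) nk;
  facts_nx : Alls (fun f => ~ quad_of Q (label4 f)) nx;
  facts_legal : legal
}.

Hypothesis QQ : quadrangles Q.
Hypothesis facts : surgery_facts.

Definition surgered := surgery Q [seq label4 f | f <- rem] [seq label4 f | f <- add].
Local Notation Q' := surgered.

Lemma dihs_label F : dihs [seq label4 f | f <- F] = [seq label4 f | f <- dihs F].
Proof. by elim: F => //= -[[[a b] c] d] F IH; rewrite /dihs /= in IH *; rewrite IH. Qed.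

Lemma distinctP i j : distinct_labels i j -> V i != V j.
Proof.
case/orP => /(AllsP (facts_neq facts)) //=; by rewrite eq_sym.
Qed.

Let quad_swap a b c d : Q a b c d -> Q b a d c.
Proof. by move=> /(quad_rev QQ)/(quad_rot QQ)/(quad_rot QQ)/(quad_rot QQ). Qed.

Lemma no_edgeP a b c d : no_edge a b -> ~ Q (V a) (V b) c d.
Proof.
case/orP => /(AllsP (facts_nadj facts)) /= h; first exact: h.
by move=> /quad_swap; exact: h.
Qed.

Lemma no_cornerP a b c d : no_corner a b d -> ~ Q (V a) (V b) c (V d).
Proof.
case/or4P => [/no_edgeP h|/no_edgeP h|/(AllsP (facts_nk facts)) /= h|/(AllsP (facts_nk facts)) /= h].
- exact: h.
- by move=> /(quad_rev QQ); exact: h.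
- exact: h.
- by move=> /(quad_rev QQ); exact: h.
Qed.

Lemma rem_quad f : f \in dihs rem -> quad_of Q (label4 f).
Proof.
case/flatten_mapP=> g /(AllsP (facts_rem facts)) qg; case: g qg => -[[a b] c] d qg fg.
apply: (dih_quad QQ qg); move: fg; rewrite !inE.
by do 7?[case/orP]; move/eqP->; rewrite eqxx ?orbT.
Qed.

Lemma no_faceP f : no_face f -> quad_of Q (label4 f) -> f \in dihs rem.
Proof.
case: f => -[[a b] c] d /= /or4P[] => [h|h|h|] q.
- by case: (no_cornerP h q).
- by case: (no_cornerP h (quad_rot QQ q)).
- by case: (no_cornerP h (quad_rot QQ (quad_rot QQ q))).
case/or3P: q => // [h|h] q.
  by case: (no_cornerP h (quad_rot QQ (quad_rot QQ (quad_rot QQ q)))).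
case/flatten_mapP: h => g /(AllsP (facts_nx facts)) ng fg; case: ng.
apply: (dih_quad QQ (f := (V a, V b, V c, V d)) q).
case: g fg => -[[x y] z] t; rewrite !inE !xpair_eqE.
by do 7?[case/orP]; case/andP=> /andP[/andP[/eqP-> /eqP->] /eqP->] /eqP->; rewrite !eqxx ?orbT.
Qed.

Let leg := facts_legal facts.

Lemma surgered_add a b c d : (a, b, c, d) \in dihs add -> Q' (V a) (V b) (V c) (V d).
Proof.
move=> h; right; rewrite dihs_label; exact: (map_f label4 h).
Qed.

Lemma surgered_keep_corner z u c w : Q z u c w ->
  (z, u, w) \notin [seq label3 c | c <- corners rem] -> Q' z u c w.
Proof.
move=> q nr; left; split=> //; apply: contra nr.
rewrite dihs_label => /mapP[[[[a b] c'] d] h [-> -> _ ->]].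
by apply/mapP; exists (a, b, d) => //; apply/mapP; exists (a, b, c', d).
Qed.

Lemma surgered_keep i a b c d :
  all (fun f => let: (x, y, z, t) := f in i \in [:: x; y; z; t]) rem ->
  Q a b c d -> V i \notin [:: a; b; c; d] -> Q' a b c d.
Proof.
move=> ir q ni; left; split=> //; apply: contra ni.
rewrite dihs_label => /mapP[[[[x y] z] t] /flatten_mapP[[[[x' y'] z'] t'] /(allP ir) h h'] [-> -> -> ->]].
have : i \in [:: x; y; z; t].
  move: h' h; rewrite !inE !xpair_eqE.
  by do 7?[case/orP]; case/andP=> /andP[/andP[/eqP-> /eqP->] /eqP->] /eqP->;
    do ?[case/orP]; move=> /eqP ->; rewrite ?eqxx ?orbT.
by rewrite !inE => /or4P[] /eqP ->; rewrite eqxx ?orbT.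
Qed.

(** The delicate case compares a surviving face with an added one. A common corner lies in no old
    face or in a removed one; in the latter case [quad_corner] for [Q] identifies the survivor with
    the removed face. Crossings are excluded in the same way by [no_face]. *)
Lemma surgered_quadrangles : quadrangles Q'.
Proof.
case/andP: leg => /allP lf _.
have rot a b c d : Q' a b c d -> Q' b c d a.
  case=> [[q nr]|ad]; [left; split; first exact: (quad_rot QQ)|right; exact: dih_rot].
  by apply: contra nr => /dih_rot/dih_rot/dih_rot.
have rev a b c d : Q' a b c d -> Q' a d c b.
  case=> [[q nr]|ad]; [left; split; first exact: (quad_rev QQ)|right; exact: dih_rev].
  by apply: contra nr => /dih_rev.
have addP a b c d : (a, b, c, d) \in dihs [seq label4 f | f <- add] ->
    exists i j k l, [/\ (i, j, k, l) \in dihs add, a = V i, b = V j, c = V k & d = V l].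
  by rewrite dihs_label => /mapP[[[[i j] k] l] h [-> -> -> ->]]; exists i, j, k, l.
have remP i j k l : (i, j, k, l) \in dihs rem ->
    (V i, V j, V k, V l) \in dihs [seq label4 f | f <- rem].
  by rewrite dihs_label => /(map_f label4).
have corner a b c d c' : Q' a b c d -> Q' a b c' d -> c = c'.
  suff mixed x y z t z' : Q x y z t -> (x, y, z, t) \notin dihs [seq label4 f | f <- rem] ->
      (x, y, z', t) \in dihs [seq label4 f | f <- add] -> z = z'.
    case=> [[q nr]|ad] [[q' nr']|ad'].
    - by apply: (quad_corner QQ (quad_rot QQ (quad_rot QQ (quad_rot QQ q))));
        exact: (quad_rot QQ (quad_rot QQ (quad_rot QQ q'))).
    - exact: mixed q nr ad'.
    - by apply/esym; exact: mixed q' nr' ad.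
    have [i [j [k [l [h ? ? ? ?]]]]] := addP _ _ _ _ ad.
    have [i' [j' [k' [l' [h' e1 e2 ? e4]]]]] := addP _ _ _ _ ad'; subst.
    have /and5P[_ _ _ _ /allP /(_ _ h')] := lf _ h.
    case/andP=> + _; case/or4P=> [/distinctP|/distinctP|/distinctP|/eqP-> //];
      by rewrite ?e1 ?e2 ?e4 eqxx.
  move=> q nr /addP[i [j [k [l [h ? ? ? ?]]]]]; subst.
  have /and5P[_ _ _ + _] := lf _ h; case/orP=> [/no_cornerP /(_ q) //|].
  case/mapP=> -[[[i' j'] k'] l'] h' [? ? ?]; subst i' j' l'.
  have e := quad_corner QQ (quad_rot QQ (quad_rot QQ (quad_rot QQ q)))
    (quad_rot QQ (quad_rot QQ (quad_rot QQ (rem_quad h')))).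
  by move: nr; rewrite e remP.
split=> //.
- move=> a b c d [[/(quad_neq QQ) //]|/addP[i [j [k [l [h -> -> -> _]]]]]].
  by have /and5P[/distinctP-> /distinctP->] := lf _ h.
- by move=> a b c d d' q q'; apply: (corner b c d a d'); exact: rot.
move=> a b c d.
suff mixed x y z t : Q x y t z -> (x, y, t, z) \notin dihs [seq label4 f | f <- rem] ->
    (x, y, z, t) \in dihs [seq label4 f | f <- add] -> False.
  case=> [[q nr]|ad] [[q' nr']|ad'].
  - exact: (quad_cross QQ q q').
  - exact: (mixed _ _ _ _ q nr ad').
  - exact: (mixed _ _ _ _ q' nr' ad).
  have [i [j [k [l [h ? ? ? ?]]]]] := addP _ _ _ _ ad.
  have [i' [j' [k' [l' [h' e1 e2 e3 e4]]]]] := addP _ _ _ _ ad'; subst.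
  have /and5P[_ _ _ _ /allP /(_ _ h')] := lf _ h.
  case/andP=> _; case/or4P=> /distinctP; by rewrite ?e1 ?e2 ?e3 ?e4 eqxx.
move=> q nr /addP[i [j [k [l [h ? ? ? ?]]]]]; subst.
have /and5P[_ _ nf _ _] := lf _ h.
by have := no_faceP nf q => /remP h'; rewrite h' in nr.
Qed.

Lemma surgered_corner z u w : (exists c, Q' z u c w) <->
  ((exists c, Q z u c w) /\ (z, u, w) \notin [seq label3 c | c <- net_rem]) \/
  (z, u, w) \in [seq label3 c | c <- net_add].
Proof.
have addin i j k l : (i, j, k, l) \in dihs add -> (i, j, l) \in corners add.
  by move=> h; apply/mapP; exists (i, j, k, l).
have remin i j k l : (i, j, k, l) \in dihs rem -> (i, j, l) \in corners rem.
  by move=> h; apply/mapP; exists (i, j, k, l).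
split=> [[c]|].
  case=> [[q nr]|].
    left; split; first by exists c.
    apply: contra nr => /mapP[[[i j] l]]; rewrite mem_filter => /andP[_].
    case/mapP=> -[[[i' j'] k] l'] h [? ? ?] [? ? ?]; subst.
    have e := quad_corner QQ (quad_rot QQ (quad_rot QQ (quad_rot QQ q)))
      (quad_rot QQ (quad_rot QQ (quad_rot QQ (rem_quad h)))).
    by rewrite e dihs_label; apply/mapP; exists (i', j', k, l').
  rewrite dihs_label => /mapP[[[[i j] k] l] h [-> -> _ ->]].
  have [ir|inr] := boolP ((i, j, l) \in corners rem); last first.
    by right; apply/mapP; exists (i, j, l) => //; rewrite mem_filter inr (addin _ _ _ _ h).
  left; split.
    case/mapP: (ir) => -[[[i' j'] k'] l'] h' [? ? ?]; subst.
    by exists (V k'); exact: (rem_quad h').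
  apply/negP => /mapP[[[i' j'] l'] nr [e1 e2 e3]].
  case/andP: leg => _ /allP /(_ (i, j, l)); rewrite mem_filter ir (addin _ _ _ _ h).
  by move=> /(_ isT) /allP /(_ _ nr) /or3P[] /distinctP; rewrite ?e1 ?e2 ?e3 eqxx.
case=> [[[c q] nr]|/mapP[[[i j] l]]]; last first.
  rewrite mem_filter => /andP[_ /mapP[[[[i' j'] k] l'] h [? ? ?]]] [-> -> ->]; subst.
  by exists (V k); exact: surgered_add.
have [h|h] := boolP ((z, u, c, w) \in dihs [seq label4 f | f <- rem]); last by exists c; left.
move: h; rewrite dihs_label => /mapP[[[[i j] k] l] h [ez eu _ ew]].
have [/mapP[[[[i' j'] k'] l'] h' [? ? ?]]|na] := boolP ((i, j, l) \in corners add).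
  by subst; exists (V k'); exact: surgered_add.
case/negP: nr; apply/mapP; exists (i, j, l); last by rewrite /= ez eu ew.
by rewrite mem_filter na (remin _ _ _ _ h).
Qed.

Definition at_label i (s : seq (nat * nat * nat)) :=
  [seq (c.1.2, c.2) | c <- s & c.1.1 == i].

Lemma surgered_at i u w :
  all (fun c => (c.1.1 == i) || distinct_labels c.1.1 i) (net_rem ++ net_add) ->
  (exists c, Q' (V i) u c w) <->
  ((exists c, Q (V i) u c w) /\ (u, w) \notin [seq label2 c | c <- at_label i net_rem]) \/
  (u, w) \in [seq label2 c | c <- at_label i net_add].
Proof.
rewrite all_cat => /andP[/allP dr /allP da]; rewrite surgered_corner.
have atP s : {in s, forall c : nat * nat * nat, (c.1.1 == i) || distinct_labels c.1.1 i} ->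
    ((V i, u, w) \in [seq label3 c | c <- s]) = ((u, w) \in [seq label2 c | c <- at_label i s]).
  move=> ds; apply/mapP/mapP => [[[[z u'] w'] h [e -> ->]]|[[u' w'] h [-> ->]]].
    exists (u', w') => //; apply/mapP; exists (z, u', w') => //; rewrite mem_filter h andbT.
    by have /orP[//|/distinctP] := ds _ h; rewrite e eqxx.
  case/mapP: h => -[[z x] y]; rewrite mem_filter => /andP[/eqP /= ? h] [? ?]; subst.
  by exists (i, x, y).
by rewrite !atP.
Qed.

Definition both_orders (r : seq (nat * nat)) := flatten [seq [:: p; (p.2, p.1)] | p <- r].

Definition upairs r u w := has (fun p => upair (V p.1) (V p.2) u w) r.

(** The first conjunct guarantees that a changed corner sits at the vertex labelled [i] only if it
    carries this very label; the other two list the edges of the link that disappear and appear,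
    once per unordered pair. *)
Definition changes_at i r a :=
  [&& all (fun c => (c.1.1 == i) || distinct_labels c.1.1 i) (net_rem ++ net_add),
      perm_eq (at_label i net_rem) (both_orders r) &
      perm_eq (at_label i net_add) (both_orders a)].

Lemma mem_both_orders r u w : ((u, w) \in [seq label2 c | c <- both_orders r]) = upairs r u w.
Proof.
by elim: r => //= -[i j] r IH; rewrite !in_cons IH orbA !xpair_eqE.
Qed.

Lemma surgered_local i r a u w : changes_at i r a ->
  (exists c, Q' (V i) u c w) <->
  ((exists c, Q (V i) u c w) /\ ~~ upairs r u w) \/ upairs a u w.
Proof.
case/and3P=> ok pr pa; rewrite (surgered_at _ _ ok).
by rewrite (perm_mem (perm_map _ pr)) (perm_mem (perm_map _ pa)) !mem_both_orders.
Qed.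

Lemma surgered_elsewhere z u w :
  z \notin [seq V c.1.1 | c <- net_rem ++ net_add] ->
  (exists c, Q' z u c w) <-> (exists c, Q z u c w).
Proof.
move=> nz; rewrite surgered_corner.
have out s : {subset s <= net_rem ++ net_add} -> ((z, u, w) \in [seq label3 c | c <- s]) = false.
  move=> ss; apply: contraNF nz => /mapP[[[i j] k] h [-> _ _]].
  by apply/mapP; exists (i, j, k) => //; exact: ss.
rewrite !out => [|c ?|c ?]; rewrite ?mem_cat; try by apply/orP; tauto.
by split; [case=> // -[] | left].
Qed.

End Surgery.

(** * Editing the link of a vertex *)

Lemma cyclic_edit (K K' : nat -> nat -> Prop) s s' (C R A : nat -> nat -> bool) :
  (forall u w, K u w <-> cyc s u w) ->
  (forall u w, K' u w <-> (K u w /\ ~~ R u w) \/ A u w) ->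
  (forall u w, cyc s u w = R u w || C u w) -> (forall u w, cyc s' u w = A u w || C u w) ->
  (forall u w, R u w -> C u w -> False) ->
  forall u w, K' u w <-> cyc s' u w.
Proof.
move=> h h' e e' RC u w; rewrite h'; have := cyc_edit e e' RC u w.
by have := h u w; tauto.
Qed.

Lemma walk_rcons_notin (u w : nat) m : uniq [:: u, w & m] -> m != [::] ->
  forall a b, upair u w a b -> walk w (rcons m u) a b -> False.
Proof.
case: m => // h m; rewrite /= !inE !negb_or -!andbA => /and5P[uw uh um wh /andP[wm _]] _ a b.
have N : walk h (rcons m u) u w = false.
  by apply: walk_out; rewrite [w \in _]in_cons mem_rcons in_cons !negb_or wh [w == u]eq_sym uw wm orbT.
have M : upair w h u w = false.
  by rewrite /upair (negbTE uw) (negbTE uh).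
by case/upairP=> -[-> ->]; rewrite ?[walk _ _ w u]walk_sym ?[upair w h w u]upair_sym N M.
Qed.

Lemma link_insert Q Q' z s u w p : link Q z s -> cyc s u w -> uniq p ->
  {in p, forall x, x \notin s} ->
  (forall a b, (exists c, Q' z a c b) <->
    ((exists c, Q z a c b) /\ ~~ upair u w a b) \/ walk u (rcons p w) a b) ->
  exists2 s', link Q' z s' & perm_eq s' (p ++ s).
Proof.
case=> us s4 h uw up ps h'; have [m pm e] := cyc_split uw (ltnW (ltnW s4)).
have um : uniq [:: u, w & m] by rewrite -(perm_uniq pm).
have m0 : m != [::] by apply: contraTneq s4 => m0; rewrite (perm_size pm) m0.
have ppm : perm_eq (w :: m ++ u :: p) (p ++ s).
  rewrite perm_sym (perm_catl _ pm) -[[:: u, w & m]]/([:: u] ++ w :: m) catA perm_catC /=.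
  by rewrite perm_cons perm_cat2l -[p ++ [:: u]]/(p ++ [:: u]) perm_catC.
exists (w :: m ++ u :: p) => //; split.
- rewrite (perm_uniq ppm) cat_uniq up us andbT /=; apply/hasPn => x xs.
  by apply/negP => /ps; rewrite xs.
- by rewrite (perm_size ppm) size_cat; apply: leq_trans s4 (leq_addl _ _).
apply: (cyclic_edit (C := walk w (rcons m u)) h h') => [a b|a b|a b].
- by rewrite e.
- by rewrite /= rcons_cat walk_cat orbC.
- exact: walk_rcons_notin.
Qed.

Lemma uniq_two_edges (u w b q : nat) S T : uniq (u :: w :: S ++ b :: q :: T) ->
  [/\ u \notin w :: rcons S b, q \notin w :: rcons S b,
     w \notin q :: rcons T u & b \notin q :: rcons T u] /\
  uniq [:: u; w; b; q].
Proof.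
rewrite /= cat_uniq /= !(inE, mem_cat, mem_rcons) /= !negb_or -!andbA.
repeat case/andP=> ?; move=> _; split; first split.
all: repeat (apply/andP; split) => //; by rewrite eq_sym.
Qed.

Lemma perm_two_edges (u w b q : nat) S T :
  perm_eq (w :: S ++ b :: u :: rev T ++ [:: q]) (u :: w :: S ++ b :: q :: T).
Proof. by apply/permP => P; rewrite /= !count_cat /= !count_cat /= count_rev; lia. Qed.

Lemma cyc_two_edges (u w b q : nat) S T x y :
  cyc (u :: w :: S ++ b :: q :: T) x y =
  (upair u w x y || upair b q x y) || (walk w (rcons S b) x y || walk q (rcons T u) x y).
Proof. by rewrite /= rcons_cat walk_cat /= orbACA -!orbA; congr orb; rewrite orbCA. Qed.

(** When two edges of a cycle are exchanged for two others, the result is a single cycle only if one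
    of the two arcs is traversed backwards. This reversal is the trace of the crosscap in the
    rotation. *)
Lemma cyc_two_edges_rev (u w b q : nat) S T x y :
  cyc (w :: S ++ b :: u :: rev T ++ [:: q]) x y =
  (upair q w x y || upair u b x y) || (walk w (rcons S b) x y || walk q (rcons T u) x y).
Proof.
rewrite cyc_consE -cats1 -catA !cat_cons -catA walk_cat /= walk_cat -walk_rev /= orbF (upairC b u).
by do !case: (upair _ _ _ _) => /=; rewrite ?orbT ?orbF.
Qed.

(** * Families of quadrangles with cyclic links, and the crosscap move *)

Record quads n (Q : nat -> nat -> nat -> nat -> Prop) : Prop := Quads {
  quads_quad : quadrangles Q;
  quads_lt : forall a b c d, Q a b c d -> a < n;
  quads_link : forall z, z < n -> exists s, link Q z s
}.

Definition nadj (Q : nat -> nat -> nat -> nat -> Prop) a b := forall c d, ~ Q a b c d.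
Definition adj (Q : nat -> nat -> nat -> nat -> Prop) a b := exists c d, Q a b c d.

Lemma adj_sym Q a b : quadrangles Q -> adj Q a b -> adj Q b a.
Proof.
move=> QQ [c [d q]]; exists d, c.
exact: (quad_rot QQ (quad_rot QQ (quad_rot QQ (quad_rev QQ q)))).
Qed.

Lemma surgery_lt n Q vs rem add a b c d : quads n Q -> (forall i, nth 0 vs i < n) ->
  surgered Q vs rem add a b c d -> a < n.
Proof.
move=> QQ vn [[/(quads_lt QQ) //]|]; rewrite dihs_label => /mapP[[[[i j] k] l] _ [-> _ _ _]].
exact: vn.
Qed.

Lemma link_same Q Q' z s : link Q z s ->
  (forall u w, (exists c, Q' z u c w) <-> (exists c, Q z u c w)) -> link Q' z s.
Proof. by case=> us s4 h e; split=> // u w; rewrite e. Qed.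

Lemma nadj_sym Q a b : quadrangles Q -> nadj Q a b -> nadj Q b a.
Proof. by move=> QQ ab c d q; case: (adj_sym QQ (ex_intro _ c (ex_intro _ d q))) => c' [d' /ab]. Qed.

Lemma link_nadj Q z s u : quadrangles Q -> link Q z s -> nadj Q z u -> u \notin s.
Proof. by move=> QQ l zu; apply/negP => /(link_adj _ QQ l)[c [d /zu]]. Qed.

(* The crosscap move: the rotation o, o', S, b, q, T at [v] is turned into    *)
(* o', S, b, o, rev T, q while [x] becomes adjacent to [o] and [o'].          *)
Section Move.
Variables (n : nat) (Q : nat -> nat -> nat -> nat -> Prop).
Variables (v x o o' c q b : nat) (S T : seq nat).
Hypothesis QQ : quads n Q.
Hypothesis rotv : link Q v (o :: o' :: S ++ b :: q :: T).
Hypotheses (f : Q v o c o') (g : Q v q x b).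
Hypotheses (xo : nadj Q x o) (xo' : nadj Q x o') (nxo : x != o) (nxo' : x != o').
Hypotheses (c1 : ~ Q q x v o') (c2 : ~ Q b x v o).

Let vs := [:: v; o; o'; c; x; q; b].
Let rem := [:: (0,1,3,2); (0,5,4,6)].
(** Two faces become three and two edges are added, so the Euler characteristic drops by one. *)
Let add := [:: (4,1,3,2); (0,5,4,2); (0,1,4,6)].
(** The vertex [c] may coincide with [q] or [b], so the pairs [(3,5)] and [(3,6)] are absent. *)
Let neq := [:: (0,1); (0,2); (0,3); (0,4); (0,5); (0,6); (1,2); (1,3); (2,3); (1,4); (2,4);
  (4,5); (4,6); (5,6); (1,5); (1,6); (2,5); (2,6); (3,4)].
Let nad := [:: (4,1); (4,2)].
Let nk := [:: (0,5,2); (0,1,6)].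
(** Of the two cyclic orders that cross the new face v q x o', one contains the edge x o' and is
    excluded by nonadjacency; the other is the one listed here. The same holds for v o x b. *)
Let nx := [:: (5,4,0,2); (6,4,0,1)].

Definition moved := surgered Q vs rem add.

Let qq := quads_quad QQ.

Let dist : [/\ o != o', o != b, o != q, o' != b & o' != q].
Proof.
have [us _ _] := rotv; have [_] := uniq_two_edges us; rewrite /= !inE !negb_or -!andbA.
by case/and5P=> -> -> -> -> /andP[->].
Qed.

Let uniqL : uniq (o :: o' :: S ++ b :: q :: T). Proof. by case: rotv. Qed.

Let cycL u w : cyc (o :: o' :: S ++ b :: q :: T) u w =
  [|| upair o o' u w, walk o' (rcons S b) u w, upair b q u w | walk q (rcons T o) u w].
Proof. by rewrite /= rcons_cat walk_cat. Qed.

Let notS : [/\ o \notin o' :: rcons S b, q \notin o' :: rcons S b,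
  o' \notin q :: rcons T o & b \notin q :: rcons T o].
Proof.
by have [] := uniq_two_edges uniqL.
Qed.

Let facts : surgery_facts Q vs rem add neq nad nk nx.
Proof.
have [oo' ob oq o'b o'q] := dist; have [n1 n2 n3 n4] := notS.
have uf := quad_uniq qq f; have ug := quad_uniq qq g.
split=> /=.
- by split; [|split].
- move: uf ug; rewrite /= !inE !negb_or -!andbA.
  repeat case/andP=> ?; move=> _; repeat case/andP=> ?; move=> _.
  have cx : c != x.
    apply/negP => /eqP cx; apply: (@xo v o'); rewrite -cx.
    exact: (quad_rev qq (quad_rot qq (quad_rot qq f))).
  by do !apply: conj => //; rewrite eq_sym.
- by split; [|split].
- split; last split => //; move=> e h.
  + have : cyc (o :: o' :: S ++ b :: q :: T) q o' by case: rotv => _ _ <-; exists e.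
    rewrite cycL [walk o' _ _ _]walk_out ?n2 // [walk q _ _ _]walk_out ?n3 ?orbT //.
    by rewrite !upair_out // !inE !negb_or ?(eq_sym q) ?oq ?o'q ?o'b ?orbT.
  + have : cyc (o :: o' :: S ++ b :: q :: T) o b by case: rotv => _ _ <-; exists e.
    rewrite cycL [walk o' _ _ _]walk_out ?n1 // [walk q _ _ _]walk_out ?n4 ?orbT //.
    by rewrite !upair_out // !inE !negb_or ?ob ?oq ?(eq_sym b) ?ob ?o'b ?orbT.
- by split; [|split].
- by vm_compute.
Qed.

Lemma moved_keep a b' c' d : Q a b' c' d -> v \notin [:: a; b'; c'; d] -> moved a b' c' d.
Proof. by move=> h nv; exact: (@surgered_keep Q vs rem add 0 _ _ _ _ isT h nv). Qed.

Lemma moved_keep_corner u e w : Q v u e w -> ~~ upair o o' u w -> ~~ upair q b u w ->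
  moved v u e w.
Proof.
move=> h n1 n2; apply: surgered_keep_corner => //.
have [vo vc vo'] : [/\ v != o, v != c & v != o'].
  have := quad_uniq qq f; rewrite /= !inE !negb_or -!andbA.
  by case/and4P=> -> -> ->.
have [vq vx vb] : [/\ v != q, v != x & v != b].
  have := quad_uniq qq g; rewrite /= !inE !negb_or -!andbA.
  by case/and4P=> -> -> ->.
move: n1 n2; rewrite !inE !xpair_eqE /upair /=.
rewrite (negbTE vo) (negbTE vc) (negbTE vo') (negbTE vq) (negbTE vx) (negbTE vb) !eqxx /=.
by rewrite !orbF !negb_or => /andP[-> ->] /andP[-> ->].
Qed.

Lemma moved_faces : [/\ moved x o c o', moved v q x o' & moved v o x b].
Proof.
have add_in i j k l : (i, j, k, l) \in dihs add ->
    moved (nth 0 vs i) (nth 0 vs j) (nth 0 vs k) (nth 0 vs l) by exact: surgered_add.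
by split; [exact: (add_in 4 1 3 2) | exact: (add_in 0 5 4 2) | exact: (add_in 0 1 4 6)].
Qed.

Let local i r a u w := @surgered_local Q vs rem add neq nad nk nx qq facts i r a u w.

Lemma moved_rot : link moved v (o' :: S ++ b :: o :: rev T ++ [:: q]).
Proof.
have [us s4 h] := rotv; have [n1 n2 n3 n4] := notS.
have pm : perm_eq (o' :: S ++ b :: o :: rev T ++ [:: q]) (o :: o' :: S ++ b :: q :: T).
  exact: perm_two_edges.
split; [by rewrite (perm_uniq pm) | by rewrite (perm_size pm) |].
apply: (@cyclic_edit _ _ _ _
  (fun u w => walk o' (rcons S b) u w || walk q (rcons T o) u w)
  (fun u w => upair o o' u w || upair b q u w)
  (fun u w => upair q o' u w || upair o b u w) h) => u w.
- by rewrite (@local 0 [:: (1,2); (6,5)] [:: (5,2); (1,6)] u w isT) /= !orbF.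
- exact: cyc_two_edges.
- exact: cyc_two_edges_rev.
- case/orP => /upairP[] [-> ->]; rewrite ?[walk o' _ _ _]walk_out ?n1 ?n2 ?orbT //;
  by rewrite [walk q _ _ _]walk_out ?n3 ?n4 ?orbT.
Qed.

Let neqs : uniq [:: v; o; o'; x].
Proof.
have uf := quad_uniq qq f; have ug := quad_uniq qq g; have [oo' _ _ _ _] := dist.
move: uf ug; rewrite /= !inE !negb_or -!andbA.
repeat case/andP=> ?; move=> _; repeat case/andP=> ?; move=> _.
by repeat (apply/andP; split) => //; rewrite eq_sym.
Qed.

(** The old and the new link are produced together because both the preservation of [quads] and the
    new adjacency are read off from them. At [o], [o'] and [x] an edge of the link is subdivided by
    the new neighbours; only at [v] is an arc reversed. *)
Lemma moved_link z : z < n -> exists s s', [/\ link Q z s, link moved z s' &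
  forall u, (u \in s') = [|| u \in s, upair x o z u | upair x o' z u]].
Proof.
move=> zn; have := neqs; rewrite /= !inE !negb_or -!andbA andbT.
case/and5P=> vo vo' vx oo' /andP[ox o'x].
have [s l] := quads_link QQ zn; have [us _ h] := l.
have [zv|zv] := eqVneq z v.
  exists (o :: o' :: S ++ b :: q :: T), (o' :: S ++ b :: o :: rev T ++ [:: q]).
  rewrite zv; split; [exact: rotv | exact: moved_rot |].
  move=> u; rewrite /upair (negbTE vo) (negbTE vo') (negbTE vx) /= orbF.
  by rewrite (perm_mem (perm_two_edges _ _ _ _ _ _)).
have ins i p p' t : uniq t -> {in t, forall y, nadj Q z y} -> z = nth 0 vs i -> cyc s p p' ->
    (forall u w, (exists e, moved (nth 0 vs i) u e w) <->
      ((exists e, Q (nth 0 vs i) u e w) /\ ~~ upair p p' u w) \/ walk p (rcons t p') u w) ->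
    (forall u, (u \in t) = upair x o z u || upair x o' z u) ->
    exists s s', [/\ link Q z s, link moved z s' &
      forall u, (u \in s') = [|| u \in s, upair x o z u | upair x o' z u]].
  move=> ut tout zi cyp hc et.
  have [y yt||s' ls' ps'] := link_insert (Q' := moved) l cyp ut.
  - exact: (link_nadj qq l (tout _ yt)).
  - by rewrite zi.
  - by exists s, s'; split=> // u; rewrite (perm_mem ps') mem_cat et orbC.
have r := quad_rot qq; have rv := quad_rev qq.
have [zo|zo] := eqVneq z o.
  apply: (ins 1 v c [:: x]) => // [y|||u].
  - by rewrite inE zo => /eqP ->; exact: nadj_sym.
  - by apply/h; rewrite zo; exists o'; exact: rv (r _ _ _ _ f).
  - by move=> u w; rewrite (@local 1 [:: (0,3)] [:: (0,4); (4,3)] u w isT) /= !orbF.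
  - by rewrite inE zo /upair (negbTE ox) (negbTE oo') eqxx /= orbF.
have [zo'|zo'] := eqVneq z o'.
  apply: (ins 2 v c [:: x]) => // [y|||u].
  - by rewrite inE zo' => /eqP ->; exact: nadj_sym.
  - by apply/h; rewrite zo'; exists o; exact: (r _ _ _ _ (r _ _ _ _ (r _ _ _ _ f))).
  - by move=> u w; rewrite (@local 2 [:: (0,3)] [:: (0,4); (4,3)] u w isT) /= !orbF.
  - by rewrite inE zo' /upair (eq_sym o' o) (negbTE o'x) (negbTE oo') eqxx /= ?orbF.
have [zx|zx] := eqVneq z x.
  apply: (ins 4 q b [:: o'; o]) => //= [|y|||u].
  - by rewrite inE eq_sym oo'.
  - by rewrite !inE zx => /orP[]/eqP ->.
  - by apply/h; rewrite zx; exists v; exact: rv (r _ _ _ _ (r _ _ _ _ g)).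
  - by move=> u w; rewrite (@local 4 [:: (5,6)] [:: (5,2); (2,1); (1,6)] u w isT) /= !orbF.
  - rewrite !inE zx /upair eqxx [x == o]eq_sym [x == o']eq_sym (negbTE ox) (negbTE o'x) /=.
    by rewrite !orbF orbC.
exists s, s; split=> //.
  apply: (link_same l) => u w; apply: (surgered_elsewhere qq facts).
  by rewrite /= !inE (negbTE zo) (negbTE zo') (negbTE zx) (negbTE zv).
by move=> u; rewrite /upair (negbTE zo) (negbTE zo') (negbTE zx) /= !orbF.
Qed.

Lemma moved_quads : quads n moved.
Proof.
split; first exact: (surgered_quadrangles qq facts).
- move=> a b' c' d; apply: (surgery_lt QQ) => i.
  have lt := quads_lt QQ; have r := quad_rot qq.
  have vn := lt _ _ _ _ f; have on := lt _ _ _ _ (r _ _ _ _ f).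
  have cn := lt _ _ _ _ (r _ _ _ _ (r _ _ _ _ f)).
  have on' := lt _ _ _ _ (r _ _ _ _ (r _ _ _ _ (r _ _ _ _ f))).
  have qn := lt _ _ _ _ (r _ _ _ _ g); have xn := lt _ _ _ _ (r _ _ _ _ (r _ _ _ _ g)).
  have bn := lt _ _ _ _ (r _ _ _ _ (r _ _ _ _ (r _ _ _ _ g))).
  by do 7?[case: i => [|i] //=]; rewrite nth_nil; apply: leq_ltn_trans vn.
- by move=> z /moved_link[s [s' [_ l _]]]; exists s'.
Qed.

Lemma moved_adj z u : adj moved z u <-> [\/ adj Q z u, upair x o z u | upair x o' z u].
Proof.
have [zn|nz] := ltnP z n; last first.
  split=> [[c' [d /(quads_lt moved_quads)]]|]; first by rewrite ltnNge nz.
  have lt := quads_lt QQ; have r := quad_rot qq.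
  have on := lt _ _ _ _ (r _ _ _ _ f).
  have on' := lt _ _ _ _ (r _ _ _ _ (r _ _ _ _ (r _ _ _ _ f))).
  have xn := lt _ _ _ _ (r _ _ _ _ (r _ _ _ _ g)).
  case=> [[c' [d /(quads_lt QQ)]]|/upairP[[zx _]|[zx _]]|/upairP[[zx _]|[zx _]]];
  by [rewrite ltnNge nz | move: nz; rewrite zx; lia].
have [s [s' [l l' e]]] := moved_link zn.
have A := link_adj u (quads_quad moved_quads) l'; have B := link_adj u qq l.
split=> [/A|[/B us|h|h]]; last 3 first.
- by apply/A; rewrite e us.
- by apply/A; rewrite e h orbT.
- by apply/A; rewrite e h !orbT.
by rewrite e => /or3P[/B h|h|h]; [constructor 1|constructor 2|constructor 3].
Qed.

End Move.

(* A new vertex [x] of degree 4, whose rotation is v, o, q, b.                *)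
Section Insert.
Variables (n : nat) (Q : nat -> nat -> nat -> nat -> Prop).
Variables (v q c b w o : nat) (m S T : seq nat).
Hypothesis QQ : quads n Q.
Hypothesis rotv : link Q v (c :: w :: m).
Hypothesis rotc : link Q c (v :: o :: S ++ b :: q :: T).
Hypotheses (f : Q v q c b) (g : Q c v w o).
Hypotheses (qw : q != w) (qo : q != o) (bw : b != w) (bo : b != o).
Local Notation x := n.

Let vs := [:: v; q; c; b; w; o; x].
Let rem := [:: (0,1,2,3); (2,0,4,5)].
(** With one vertex, four edges and two faces more, the Euler characteristic drops by one. The
    reversal now takes place in the link of [c], whose neighbours stay the same. *)
Let add := [:: (0,1,6,3); (6,0,4,5); (2,1,6,5); (2,0,6,3)].
Let neq := [:: (0,1);(0,2);(0,3);(1,2);(1,3);(2,3);(0,4);(0,5);(2,4);(2,5);(4,5);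
  (1,4);(1,5);(3,4);(3,5);(6,0);(6,1);(6,2);(6,3);(6,4);(6,5)].
Let nad := [:: (6,0);(6,1);(6,2);(6,3);(6,4);(6,5)].
Let nk := [:: (2,1,5);(2,0,3)].
Let nx : seq (nat * nat * nat * nat) := [::].

Definition inserted := surgered Q vs rem add.

Let qq := quads_quad QQ.

Let lts : [/\ v < n, q < n, c < n, b < n & w < n /\ o < n].
Proof.
have lt := quads_lt QQ; have r := quad_rot qq.
split; last split.
- exact: (lt _ _ _ _ f).
- exact: (lt _ _ _ _ (r _ _ _ _ f)).
- exact: (lt _ _ _ _ g).
- exact: (lt _ _ _ _ (r _ _ _ _ (r _ _ _ _ (r _ _ _ _ f)))).
- exact: (lt _ _ _ _ (r _ _ _ _ (r _ _ _ _ g))).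
- exact: (lt _ _ _ _ (r _ _ _ _ (r _ _ _ _ (r _ _ _ _ g)))).
Qed.

Let xout u : nadj Q x u.
Proof. by move=> e d /(quads_lt QQ); rewrite ltnn. Qed.

Let dist : uniq [:: v; q; c; b; w; o].
Proof.
have := quad_uniq qq f; have := quad_uniq qq g; rewrite /= !inE !negb_or -!andbA.
repeat case/andP=> ?; move=> _; repeat case/andP=> ?; move=> _.
by repeat (apply/andP; split) => //; rewrite eq_sym.
Qed.

Let notS : [/\ v \notin o :: rcons S b, q \notin o :: rcons S b,
  o \notin q :: rcons T v & b \notin q :: rcons T v].
Proof.
by have [us _ _] := rotc; have [] := uniq_two_edges us.
Qed.

Let facts : surgery_facts Q vs rem add neq nad nk nx.
Proof.
have [n1 n2 n3 n4] := notS; have [v_n q_n c_n b_n [w_n o_n]] := lts.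
have := dist; rewrite /= !inE !negb_or -!andbA.
case/and5P=> vq vc vb vw /and5P[vo qc qb _ /and5P[_ cb cw co /and4P[_ _ wo _]]].
have nq : q \notin [:: v; o] by rewrite !inE negb_or eq_sym vq.
have no : o \notin [:: b; q] by rewrite !inE negb_or eq_sym bo eq_sym.
have nv : v \notin [:: b; q] by rewrite !inE negb_or vb.
have nb : b \notin [:: v; o] by rewrite !inE negb_or eq_sym vb.
split; last by vm_compute.
- by do !apply: conj.
- by do !apply: conj => //=; rewrite ?gtn_eqF //; rewrite eq_sym.
- by do !apply: conj => //; exact: xout.
- split; last split => //; move=> e h.
  + have : cyc (v :: o :: S ++ b :: q :: T) q o by case: rotc => _ _ <-; exists e.
    rewrite cyc_two_edges [walk o _ _ _]walk_out ?n2 // [walk q _ _ _]walk_out ?n3 ?orbT //.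
    by rewrite !upair_out ?nq ?no ?orbT.
  + have : cyc (v :: o :: S ++ b :: q :: T) v b by case: rotc => _ _ <-; exists e.
    rewrite cyc_two_edges [walk o _ _ _]walk_out ?n1 // [walk q _ _ _]walk_out ?n4 ?orbT //.
    by rewrite !upair_out ?nv ?nb ?orbT.
- by [].
Qed.

Lemma inserted_keep a b' c' d : Q a b' c' d -> v \notin [:: a; b'; c'; d] -> inserted a b' c' d.
Proof. by move=> h nv; exact: (@surgered_keep Q vs rem add 0 _ _ _ _ isT h nv). Qed.

Lemma inserted_faces :
  [/\ inserted v q x b, inserted x v w o, inserted c q x o & inserted c v x b].
Proof.
have add_in i j k l : (i, j, k, l) \in dihs add ->
    inserted (nth 0 vs i) (nth 0 vs j) (nth 0 vs k) (nth 0 vs l) by exact: surgered_add.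
by split; [exact: (add_in 0 1 6 3) | exact: (add_in 6 0 4 5) | exact: (add_in 2 1 6 5) |
  exact: (add_in 2 0 6 3)].
Qed.

Let local i r a u t := @surgered_local Q vs rem add neq nad nk nx qq facts i r a u t.

Lemma inserted_rot : link inserted v (c :: x :: w :: m).
Proof.
have [us s4 h] := rotv; have [v_n q_n c_n b_n [w_n o_n]] := lts.
have xm : x \notin c :: w :: m by apply/(link_nadj qq rotv)/(nadj_sym qq)/xout.
have m0 : m != [::] by apply: contraTneq s4 => ->.
split; last apply: (@cyclic_edit _ _ _ _ (walk w (rcons m c)) (upair c w)
    (fun u t => upair c x u t || upair x w u t) h) => u t.
- by rewrite -[[:: c, x & _]]/([:: c] ++ [:: x] ++ w :: m) uniq_catCA cons_uniq xm us.
- exact: ltnW.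
- by rewrite (@local 0 [:: (2,4)] [:: (2,6);(6,4)] u t isT) /= !orbF.
- by [].
- by rewrite /= -orbA.
- exact: walk_rcons_notin.
Qed.

Let rotc' : link inserted c (o :: S ++ b :: v :: rev T ++ [:: q]).
Proof.
have [us s4 h] := rotc; have [n1 n2 n3 n4] := notS.
have pm := perm_two_edges v o b q S T.
split; [by rewrite (perm_uniq pm) | by rewrite (perm_size pm) |].
apply: (@cyclic_edit _ _ _ _
  (fun u w => walk o (rcons S b) u w || walk q (rcons T v) u w)
  (fun u w => upair v o u w || upair b q u w)
  (fun u w => upair q o u w || upair v b u w) h) => u t.
- by rewrite (@local 2 [:: (0,5); (3,1)] [:: (1,5); (0,3)] u t isT) /= !orbF.
- exact: cyc_two_edges.
- exact: cyc_two_edges_rev.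
- case/orP => /upairP[] [-> ->]; rewrite ?[walk o _ _ _]walk_out ?n1 ?n2 ?orbT //;
  by rewrite [walk q _ _ _]walk_out ?n3 ?n4 ?orbT.
Qed.

Lemma inserted_link z : z < n -> exists s s', [/\ link Q z s, link inserted z s' &
  forall u, (u \in s') = (u \in s) || (u == x) && (z \in [:: v; o; q; b])].
Proof.
have ds := dist; rewrite /= !inE !negb_or -!andbA in ds.
case/and5P: ds => vq vc vb vw /and5P[vo qc _ _ /and5P[_ cb cw co _]].
move=> zn; have [Z Ze] : exists Z, Z = (z \in [:: v; o; q; b]) by eexists.
rewrite -Ze; have [s l] := quads_link QQ zn; have [us _ h] := l.
have xs : x \notin s by apply/(link_nadj qq l)/(nadj_sym qq)/xout.
have ins i p p' : Z -> z = nth 0 vs i -> cyc s p p' ->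
    (forall u w, (exists e, inserted (nth 0 vs i) u e w) <->
      ((exists e, Q (nth 0 vs i) u e w) /\ ~~ upair p p' u w) \/ walk p [:: x; p'] u w) ->
    exists s s', [/\ link Q z s, link inserted z s' &
      forall u, (u \in s') = (u \in s) || (u == x) && Z].
  move=> zin zi cyp hc.
  have [|y||s' ls' ps'] := link_insert (Q' := inserted) (p := [:: x]) l cyp.
  - by [].
  - by rewrite inE => /eqP ->.
  - by rewrite zi.
  - by exists s, s'; split=> // u; rewrite (perm_mem ps') /= inE zin andbT orbC.
have r := quad_rot qq; have rv := quad_rev qq.
have [zv|zv] := eqVneq z v.
  exists (c :: w :: m), (c :: x :: w :: m); rewrite Ze zv; split; [exact: rotv | exact: inserted_rot |].
  have vin : v \in [:: v; o; q; b] by rewrite inE eqxx.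
  move=> u; rewrite vin andbT !in_cons.
  by do 3?case: (u == _) => //=; rewrite ?orbT ?orbF.
have [zc|zc] := eqVneq z c.
  exists (v :: o :: S ++ b :: q :: T), (o :: S ++ b :: v :: rev T ++ [:: q]).
  rewrite Ze zc; split; [exact: rotc | exact: rotc' |].
  have cin : c \notin [:: v; o; q; b].
    by rewrite !inE (eq_sym c v) (eq_sym c q) (negbTE vc) (negbTE qc) (negbTE cb) (negbTE co).
  by move=> u; rewrite (perm_mem (perm_two_edges _ _ _ _ _ _)) (negbTE cin) andbF orbF.
have [zq|zq] := eqVneq z q.
  apply: (ins 1 v c) => //; first by rewrite Ze zq !inE eqxx ?orbT.
  - by apply/h; rewrite zq; exists b; exact: rv (r _ _ _ _ f).
  - by move=> u t; rewrite (@local 1 [:: (0,2)] [:: (0,6);(6,2)] u t isT) /= !orbF.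
have [zb|zb] := eqVneq z b.
  apply: (ins 3 v c) => //; first by rewrite Ze zb !inE eqxx ?orbT.
  - by apply/h; rewrite zb; exists q; exact: (r _ _ _ _ (r _ _ _ _ (r _ _ _ _ f))).
  - by move=> u t; rewrite (@local 3 [:: (0,2)] [:: (0,6);(6,2)] u t isT) /= !orbF.
have [zo|zo] := eqVneq z o.
  apply: (ins 5 c w) => //; first by rewrite Ze zo !inE eqxx ?orbT.
  - by apply/h; rewrite zo; exists v; exact: (r _ _ _ _ (r _ _ _ _ (r _ _ _ _ g))).
  - by move=> u t; rewrite (@local 5 [:: (2,4)] [:: (2,6);(6,4)] u t isT) /= !orbF.
exists s, s; split=> //.
  apply: (link_same l) => u t; apply: (surgered_elsewhere qq facts).
  by rewrite /= !inE (ltn_eqF zn) (negbTE zv) (negbTE zc) (negbTE zq) (negbTE zb) (negbTE zo).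
by move=> u; rewrite Ze !inE (negbTE zv) (negbTE zq) (negbTE zb) (negbTE zo) andbF orbF.
Qed.

Lemma inserted_new : link inserted x [:: v; o; q; b].
Proof.
have := dist; rewrite /= !inE !negb_or -!andbA.
case/and5P=> vq vc vb vw /and5P[vo qc qb _ /and5P[_ cb cw co _]].
split=> //; first by rewrite /= !inE !negb_or vo vq vb qb (eq_sym o q) (eq_sym o b) qo bo.
move=> u t; rewrite (@local 6 [::] [:: (0,5);(5,1);(1,3);(3,0)] u t isT) /= orbF.
by split; [case=> // -[[e /(quads_lt QQ)]]; rewrite ltnn | right].
Qed.

Lemma inserted_quads : quads n.+1 inserted.
Proof.
have [v_n q_n c_n b_n [w_n o_n]] := lts.
split; first exact: (surgered_quadrangles qq facts).
- move=> a b' c' d [[/(quads_lt QQ)/ltnW //]|]; rewrite dihs_label.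
  move=> /mapP[[[[i j] k] l] _ [-> _ _ _]].
  by do 7?[case: i => [|i] //=]; rewrite ?nth_nil // ltnS ltnW.
- move=> z; rewrite ltnS leq_eqVlt => /orP[/eqP->|/inserted_link[s [s' [_ l _]]]].
    by exists [:: v; o; q; b]; exact: inserted_new.
  by exists s'.
Qed.

Lemma inserted_adj z u : adj inserted z u <->
  [\/ adj Q z u, z = x /\ u \in [:: v; o; q; b] | u = x /\ z \in [:: v; o; q; b]].
Proof.
have [v_n q_n c_n b_n [w_n o_n]] := lts; have qq' := quads_quad inserted_quads.
have lt y : y \in [:: v; o; q; b] -> y < x by rewrite !inE => /or4P[] /eqP ->.
have [zn|zn] := ltnP z n.
  have [s [s' [l l' e]]] := inserted_link zn.
  have A := link_adj u qq' l'; have B := link_adj u qq l.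
  split=> [/A|[/B us|[zx _]|[ux h]]]; last 3 first.
  - by apply/A; rewrite e us.
  - by move: zn; rewrite zx ltnn.
  - by apply/A; rewrite e ux eqxx h orbT.
  by rewrite e => /orP[/B ?|/andP[/eqP ux h]]; [constructor 1|constructor 3].
have [zx|zx] := eqVneq z x.
  have A := link_adj u qq' inserted_new; rewrite zx.
  split=> [/A h|[[c' [d /(quads_lt QQ)]]|[_ h]|[_ /lt]]]; rewrite ?ltnn //; last exact/A.
  by constructor 2.
split=> [[c' [d /(quads_lt inserted_quads)]]|]; first by rewrite ltnS leq_eqVlt (negbTE zx) ltnNge zn.
case=> [[c' [d /(quads_lt QQ)]]|[/eqP]|[_ /lt]]; rewrite ?(negbTE zx) // ltnNge zn //.
Qed.

End Insert.

(** * Inserting a vertex of degree 7 together with a missing edge *)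

Lemma walk_last (T : eqType) (a b : T) s u w :
  walk a (rcons s b) u w = walk a s u w || upair (last a s) b u w.
Proof. by elim: s a => [|c s IH] a /=; rewrite ?orbF // IH orbA. Qed.

Lemma cyc_center (T : eqType) (s : seq T) v e o :
  uniq s -> 1 < size s -> cyc s v e -> cyc s v o -> e != o ->
  exists m, [/\ perm_eq s (v :: o :: m), cyc s =2 cyc (v :: o :: m) & last o m = e].
Proof.
move=> us s2 ve vo eo; have [m pm h] := cyc_split vo s2; exists m; split=> //.
have : uniq (v :: o :: m) by rewrite -(perm_uniq pm).
move: ve; rewrite h /= walk_last => /or3P[/upairP[][]|/walk_mem/andP[vm _]|/upairP[][]].
- by move=> _ e'; rewrite e' eqxx in eo.
- by move=> -> _; rewrite inE eqxx.
- by rewrite vm.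
- by move=> vl _ /andP[]; rewrite {1}vl mem_last.
- by move=> _ ->.
Qed.

Lemma cyc_center_only (T : eqType) (s : seq T) v e o t :
  uniq s -> 1 < size s -> cyc s v e -> cyc s v o -> e != o -> cyc s v t -> t = e \/ t = o.
Proof.
move=> us s2 ve vo eo; have [m [pm h le]] := cyc_center us s2 ve vo eo.
have : uniq (v :: o :: m) by rewrite -(perm_uniq pm).
rewrite h /= walk_last le => /andP[vm _] /or3P[/upairP[][] //|/walk_mem/andP[]|/upairP[][] //].
- by right.
- by move=> vo'; rewrite vo' inE eqxx in vm.
- by rewrite (negbTE vm).
- by move=> ev; rewrite -le in ev; rewrite ev mem_last in vm.
- by left.
Qed.

Lemma uniq_three_paths (p a c w u b : nat) S T : uniq (p :: a :: c :: w :: S ++ u :: b :: T) ->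
  [/\ p \notin w :: rcons S u, a \notin w :: rcons S u, c \notin w :: rcons S u &
      b \notin w :: rcons S u] /\
  [/\ a \notin b :: rcons T p, c \notin b :: rcons T p, w \notin b :: rcons T p &
      u \notin b :: rcons T p].
Proof.
rewrite /= cat_uniq /= !(inE, mem_cat, mem_rcons) /= !negb_or -!andbA.
repeat case/andP=> ?; move=> _; split; split.
all: repeat (apply/andP; split) => //; by rewrite eq_sym.
Qed.

Lemma cyc_three_paths (p a c w u b : nat) S T x y :
  cyc (p :: a :: c :: w :: S ++ u :: b :: T) x y =
  [|| upair p a x y, upair a c x y, upair c w x y | upair u b x y] ||
  (walk w (rcons S u) x y || walk b (rcons T p) x y).
Proof.
rewrite /= rcons_cat walk_cat /=.
by do 3?[case: (upair _ _ _ _) => //=]; rewrite orbCA.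
Qed.

Lemma cyc_three_paths_new (p a c w u b z : nat) S T x y :
  cyc (a :: z :: c :: b :: T ++ p :: w :: S ++ [:: u]) x y =
  [|| upair a z x y, upair z c x y, upair c b x y, upair p w x y | upair u a x y] ||
  (walk w (rcons S u) x y || walk b (rcons T p) x y).
Proof.
rewrite cyc_consE -cats1 !cat_cons -catA !cat_cons -catA /= walk_cat /= walk_cat /=.
do 3?[case: (upair _ _ _ _) => //=]; rewrite ?orbF.
by do !case: (upair _ _ _ _) => /=; rewrite ?orbT // ?orbF orbC.
Qed.

Lemma perm_three_paths (p a c w u b z : nat) S T :
  perm_eq (a :: z :: c :: b :: T ++ p :: w :: S ++ [:: u])
    (z :: p :: a :: c :: w :: S ++ u :: b :: T).
Proof. by apply/permP => P; rewrite /= !count_cat /= !count_cat /=; lia. Qed.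

Lemma cyc_centered (T : eqType) (v o : T) m x y :
  cyc (v :: o :: m) x y = (upair v o x y || upair (last o m) v x y) || walk o m x y.
Proof. by rewrite /= walk_last -orbA; congr orb; rewrite orbC. Qed.

(* A new vertex [x] of degree 7, whose rotation is p, v, b, u, a, c, w, and   *)
(* the edge ab.  The rotation p, a, c, w, S, u, b, T at [v] is turned into    *)
(* a, x, c, b, T, p, w, S, u.                                                 *)
Section InsertWithEdge.
Variables (n : nat) (Q : nat -> nat -> nat -> nat -> Prop).
Variables (v p a c w u b e o g : nat) (S T : seq nat).
Hypothesis QQ : quads n Q.
Hypothesis rotv : link Q v (p :: a :: c :: w :: S ++ u :: b :: T).
Hypotheses (f1 : Q v p c a) (f2 : Q v a e c) (f3 : Q v c o w) (f4 : Q v b g u).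
Hypotheses (ab : nadj Q a b) (oT : o \in T).
Local Notation x := n.

Let vs := [:: v; p; a; c; w; u; b; e; o; g; x].
Let rem := [:: (0,1,3,2);(0,2,7,3);(0,3,8,4);(0,6,9,5)].
(** Four faces become eight, with one vertex and eight edges more: seven at [x] and the edge ab. The
    Euler characteristic drops by three. *)
Let add := [:: (0,10,1,3);(3,2,6,0);(2,6,10,0);(2,7,3,10);(3,8,4,10);(6,9,5,10);
  (0,2,10,5);(0,4,10,1)].
(** The opposite vertex [g] may coincide with [p], [c], [w], [e] or [o], and [e] with [w] or [u]; no
    such pair is listed. *)
Let neq := [:: (0,1);(0,2);(0,3);(0,4);(0,5);(0,6);(0,7);(0,8);(0,9);(0,10);
  (1,2);(1,3);(1,4);(1,5);(1,6);(1,7);(1,8);(1,10);(2,3);(2,4);(2,5);(2,6);(2,7);(2,8);(2,9);(2,10);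
  (3,4);(3,5);(3,6);(3,7);(3,8);(3,10);(4,5);(4,6);(4,8);(4,10);(5,6);(5,8);(5,9);(5,10);
  (6,7);(6,8);(6,9);(6,10);(7,8);(7,10);(8,10);(9,10)].
Let nad := [:: (2,6);(10,0);(10,1);(10,2);(10,3);(10,4);(10,5);(10,6);(10,7);(10,8);(10,9)].
Let nk := [:: (0,5,2);(0,1,4);(0,3,6);(0,2,6);(3,0,1);(3,0,2)].
Let nx : seq (nat * nat * nat * nat) := [::].

Definition inserted7 := surgered Q vs rem add.

Let qq := quads_quad QQ.

Let uniqL : uniq (p :: a :: c :: w :: S ++ u :: b :: T). Proof. by case: rotv. Qed.

Let xout t : nadj Q x t.
Proof. by move=> e' d /(quads_lt QQ); rewrite ltnn. Qed.

Let lts : all (fun t => t < x) [:: v; p; a; c; w; u; b; e; o; g].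
Proof.
have lt := quads_lt QQ; have r := quad_rot qq; rewrite /= andbT.
have r1 := r _ _ _ _ f1; have r2 := r _ _ _ _ f2; have r3 := r _ _ _ _ f3.
have r4 := r _ _ _ _ f4.
rewrite (lt _ _ _ _ f1) (lt _ _ _ _ r1) (lt _ _ _ _ r2) (lt _ _ _ _ r3) (lt _ _ _ _ r4).
rewrite (lt _ _ _ _ (r _ _ _ _ r2)) (lt _ _ _ _ (r _ _ _ _ r3)).
rewrite (lt _ _ _ _ (r _ _ _ _ r4)) (lt _ _ _ _ (r _ _ _ _ (r _ _ _ _ r3))).
by rewrite (lt _ _ _ _ (r _ _ _ _ (r _ _ _ _ r4))).
Qed.

Let uniq8 : uniq [:: v; p; a; c; w; u; b; o].
Proof.
have sub : subseq ([:: p; a; c; w] ++ [::] ++ [:: u; b] ++ [:: o])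
    ([:: p; a; c; w] ++ S ++ [:: u; b] ++ T).
  by rewrite !cat_subseq ?sub0seq // sub1seq.
rewrite cons_uniq (subseq_uniq sub uniqL) andbT.
by apply: contra (link_self qq rotv) => /(mem_subseq sub).
Qed.

Let at_e : [/\ v != e, a != e, c != e, p != e & b != e] /\ e != o.
Proof.
have := quad_uniq qq f2; have u8 := uniq8; rewrite /= !inE !negb_or -!andbA.
case/and5P=> _ -> _ -> /and3P[_ ec _]; rewrite (eq_sym c e) ec.
have r := quad_rot qq; have rv := quad_rev qq.
split; first split=> //.
- apply/negP => /eqP pe; have f2' := f2; rewrite -pe in f2'.
  apply: (quad_cross qq (r _ _ _ _ (r _ _ _ _ (r _ _ _ _ f1)))).
  exact: (r _ _ _ _ (r _ _ _ _ (r _ _ _ _ (rv _ _ _ _ f2')))).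
- apply/negP => /eqP be; apply: (@ab c v); rewrite be.
  exact: r f2.
(* If [e] were [o], the faces v a e c and v c o w would share the path e, c, v, which forces a =
   w. *)
apply/negP => /eqP eo; have f3' := f3; rewrite -eo in f3'.
have aw : a = w.
  by apply: (quad_corner qq (a := e) (b := c) (c := v)); [exact: (r _ _ _ _ (r _ _ _ _ f2)) |
    exact: (r _ _ _ _ (r _ _ _ _ (rv _ _ _ _ f3')))].
by move: u8; rewrite aw /= !inE eqxx ?orbT ?andbF.
Qed.

Let at_g : [/\ v != g, b != g, u != g & a != g].
Proof.
have := quad_uniq qq f4; rewrite /= !inE !negb_or -!andbA.
case/and5P=> _ -> _ -> /and3P[_ gu _]; rewrite (eq_sym u g) gu; split=> //.
apply/negP => /eqP ag; apply: (nadj_sym qq ab (c := u) (d := v)); rewrite ag.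
exact: (quad_rot qq f4).
Qed.

Let in_rotv t y : (exists z, Q v t z y) <-> cyc (p :: a :: c :: w :: S ++ u :: b :: T) t y.
Proof. by case: rotv. Qed.

Let facts : surgery_facts Q vs rem add neq nad nk nx.
Proof.
split; [| | | | by [] | by vm_compute].
- by do !apply: conj.
- have u8 := uniq8; have [[e1 e2 e3 e4 e5] e6] := at_e; have [g1 g2 g3 g4] := at_g.
  have := lts; rewrite /= !andbT => /and5P[? ? ? ? /and5P[? ? ? ? /andP[? ?]]].
  move: u8; rewrite /= !inE !negb_or -!andbA.
  repeat case/andP=> ?; move=> _.
  by do !apply: conj => //; rewrite ?ltn_eqF //; rewrite eq_sym.
- by do !apply: conj => //; exact: xout.
- have u8 := uniq8; move: u8; rewrite /= !inE !negb_or -!andbA.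
  repeat case/andP=> ?; move=> _.
  have [[n1 n2 n3 n4] [m1 m2 m3 m4]] := uniq_three_paths uniqL.
  have nc t y : ~~ cyc (p :: a :: c :: w :: S ++ u :: b :: T) t y -> forall z, ~ Q v t z y.
    by move=> h z q; move/negP: h; apply; apply/in_rotv; exists z.
  have ne t y : t != y -> (t == y = false) * (y == t = false).
    by move=> h; rewrite [y == t]eq_sym (negbTE h).
  have [sc lc] : exists s, link Q c s.
    by apply: (quads_link QQ); exact: (quads_lt QQ (quad_rot qq f3)).
  have [us s4 hc] := lc; have s2 : 1 < size sc by apply: leq_trans s4.
  have cve : cyc sc v e.
    by apply/hc; exists a; exact: (quad_rot qq (quad_rot qq (quad_rot qq f2))).
  have cvo : cyc sc v o.
    by apply/hc; exists w; exact: (quad_rot qq (quad_rot qq (quad_rot qq (quad_rev qq f3)))).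
  have [[e1 e2 e3 e4 e5] e6] := at_e.
  (* In the link of [c] the vertex [v] has only the neighbours [e] and [o], so the corners at [c]
     between [v] and [p] or [a] are free for the new faces. *)
  have only t : t != e -> t != o -> forall z, ~ Q c v z t.
    move=> te to z q; have /(cyc_center_only us s2 cve cvo e6) : cyc sc v t by apply/hc; exists z.
    by case=> h; [move: te | move: to]; rewrite h eqxx.
  do !apply: conj => //=; try (apply: only => //).
  all: apply: nc; rewrite cyc_three_paths !negb_or -!andbA.
  all: repeat (apply/andP; split).
  all: try by rewrite walk_out ?n1 ?n2 ?n3 ?n4 ?m1 ?m2 ?m3 ?m4 ?orbT.
  all: rewrite negb_and; apply/orP.
  all: by first [left; by [|rewrite eq_sym] | right; by [|rewrite eq_sym]].
Qed.

Lemma inserted7_keep a' b' c' d : Q a' b' c' d -> v \notin [:: a'; b'; c'; d] ->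
  inserted7 a' b' c' d.
Proof. by move=> h nv; exact: (@surgered_keep Q vs rem add 0 _ _ _ _ isT h nv). Qed.

Lemma inserted7_faces : [/\ inserted7 v x p c, inserted7 v a b x, inserted7 v a x u &
  inserted7 v w x p].
Proof.
have add_in i j k l : (i, j, k, l) \in dihs add ->
    inserted7 (nth 0 vs i) (nth 0 vs j) (nth 0 vs k) (nth 0 vs l) by exact: surgered_add.
by split; [exact: (add_in 0 10 1 3) | exact: (add_in 0 2 6 10) | exact: (add_in 0 2 10 5) |
  exact: (add_in 0 4 10 1)].
Qed.

Let local i r a' t y := @surgered_local Q vs rem add neq nad nk nx qq facts i r a' t y.

Let xs z s : link Q z s -> x \notin s.
Proof. by move=> l; apply/(link_nadj qq l)/(nadj_sym qq)/xout. Qed.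

Lemma inserted7_rot : link inserted7 v (a :: x :: c :: b :: T ++ p :: w :: S ++ [:: u]).
Proof.
have [us s4 h] := rotv; have pm := perm_three_paths p a c w u b x S T.
have [[n1 n2 n3 n4] [m1 m2 m3 m4]] := uniq_three_paths uniqL.
split.
- by rewrite (perm_uniq pm) cons_uniq (xs rotv).
- by rewrite (perm_size pm); exact: ltnW.
apply: (@cyclic_edit _ _ _ _
  (fun t y => walk w (rcons S u) t y || walk b (rcons T p) t y)
  (fun t y => [|| upair p a t y, upair a c t y, upair c w t y | upair u b t y])
  (fun t y => [|| upair a x t y, upair x c t y, upair c b t y, upair p w t y | upair u a t y])
  h) => t y.
- by rewrite (@local 0 [:: (1,2); (2,3); (3,4); (5,6)]
    [:: (2,10); (10,3); (3,6); (1,4); (5,2)] t y isT) /= !orbF.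
- exact: cyc_three_paths.
- exact: cyc_three_paths_new.
- by case/or4P => /upairP[] [-> ->]; rewrite !walk_out ?n1 ?n2 ?n3 ?n4 ?m1 ?m2 ?m3 ?m4 ?orbT.
Qed.

(** In the link of [c] the vertex [v] leaves its place between [e] and [o], which is taken by [x],
    and moves into the edge joining [a] and [p]. *)
Let link_c : exists s s', [/\ link Q c s, link inserted7 c s' & perm_eq s' (x :: s)].
Proof.
have r := quad_rot qq; have rv := quad_rev qq.
have [sc lc] : exists s, link Q c s.
  by apply: (quads_link QQ); exact: (quads_lt QQ (r _ _ _ _ f3)).
have [us s4 hc] := lc; have s2 : 1 < size sc by apply: leq_trans s4.
have [[ve ae ce pe be] eo] := at_e.
have cve : cyc sc v e by apply/hc; exists a; exact: (r _ _ _ _ (r _ _ _ _ (r _ _ _ _ f2))).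
have cvo : cyc sc v o.
  by apply/hc; exists w; exact: (r _ _ _ _ (r _ _ _ _ (r _ _ _ _ (rv _ _ _ _ f3)))).
have cap : cyc sc a p by apply/hc; exists v; exact: (r _ _ _ _ (r _ _ _ _ f1)).
have [m [pm em le]] := cyc_center us s2 cve cvo eo.
have [va vp ao po] : [/\ a != v, p != v, a != o & p != o].
  have u8 := uniq8; move: u8; rewrite /= !inE !negb_or -!andbA.
  repeat case/andP=> ?; move=> _.
  by split=> //; rewrite eq_sym.
have mw : walk o m a p.
  move: cap; rewrite em cyc_centered => /orP[/orP[]|//] /upairP[] [h1 h2].
  - by rewrite h1 eqxx in va.
  - by rewrite h1 eqxx in ao.
  - by rewrite h2 eqxx in vp.
  - by rewrite h1 eqxx in va.
have [a' [b' [M1 [M2 [ab' mE]]]]] : exists a' b' M1 M2,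
    ([:: a'; b'] = [:: a; p] \/ [:: a'; b'] = [:: p; a]) /\ m = M1 ++ a' :: b' :: M2.
  case/walk_rcons_split: mw => s1 [s3]; case: s1 => [|z s1].
    by case=> -[h1 _]; [move: ao | move: po]; rewrite h1 eqxx.
  case=> -[_ ->]; [exists a, p, s1, s3 | exists p, a, s1, s3]; split=> //; by [left|right].
have upE t y : upair a' b' t y = upair a p t y.
  by case: ab' => -[-> ->] //; rewrite upairC.
have upvE t y : upair a' v t y || upair v b' t y = upair a v t y || upair v p t y.
  by case: ab' => -[-> ->] //; rewrite orbC (upairC v a) (upairC p v).
have us' : uniq (v :: o :: M1 ++ a' :: b' :: M2) by rewrite -mE -(perm_uniq pm).
have [[vM oM] [h1 h2]] : (v \notin o :: rcons M1 a' /\ v \notin b' :: M2) /\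
    (b' \notin o :: rcons M1 a' /\ a' \notin b' :: M2).
  move: us'; rewrite /= cat_uniq /= !(inE, mem_cat, mem_rcons) /= !negb_or -!andbA.
  repeat case/andP=> ?; move=> _; split; split;
    repeat (apply/andP; split) => //; by rewrite eq_sym.
have pms : perm_eq (x :: o :: M1 ++ a' :: v :: b' :: M2) (x :: sc).
  clear -pm mE; apply/permP => P; move/permP: pm => /(_ P).
  by rewrite mE /= !count_cat /=; lia.
have lM : last b' M2 = e by rewrite -le mE last_cat.
exists sc, (x :: o :: M1 ++ a' :: v :: b' :: M2); split=> //; split.
- by rewrite (perm_uniq pms) cons_uniq us (xs lc).
- by rewrite (perm_size pms) /= ltnW.
apply: (@cyclic_edit _ _ _ _ (fun t y => walk o (rcons M1 a') t y || walk b' M2 t y)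
  (fun t y => [|| upair a p t y, upair v e t y | upair v o t y])
  (fun t y => [|| upair v p t y, upair a v t y, upair x e t y | upair x o t y]) hc) => t y.
- by rewrite (@local 3 [:: (2,1); (0,7); (0,8)] [:: (0,1); (2,0); (10,7); (10,8)] t y isT) /= !orbF.
- rewrite em cyc_centered le mE walk_cat /= upE (upairC e v).
  by do !case: (upair _ _ _ _) => /=; rewrite ?orbT ?orbF.
- rewrite cyc_centered last_cat /= lM walk_cat /= (upairC e x).
  have := upvE t y; move: (upair a' v t y) (upair v b' t y) (upair a v t y) (upair v p t y).
  do 4!case=> //=; move=> _; by do !case: (upair _ _ _ _) => /=; rewrite ?orbT ?orbF.
- case/or3P; last by case/upairP => -[-> ->]; rewrite !walk_out ?vM ?oM ?orbT.
    rewrite -upE => /upairP[] [-> ->]; by rewrite !walk_out ?h1 ?h2 ?orbT.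
  by case/upairP => -[-> ->]; rewrite !walk_out ?vM ?oM ?orbT.
Qed.

(** In the link of [a] the vertex [v] keeps its position between [c] and [e], but [b] comes between
    [c] and [v], and [x] between [v] and [e]. *)
Let link_a : exists s s', [/\ link Q a s, link inserted7 a s' & perm_eq s' (x :: b :: s)].
Proof.
have r := quad_rot qq; have rv := quad_rev qq.
have [sa la] : exists s, link Q a s.
  by apply: (quads_link QQ); exact: (quads_lt QQ (r _ _ _ _ f2)).
have [us s4 ha] := la; have s2 : 1 < size sa by apply: leq_trans s4.
have [[ve ae ce pe be] eo] := at_e.
have ave : cyc sa v e by apply/ha; exists c; exact: rv (r _ _ _ _ f2).
have avc : cyc sa v c by apply/ha; exists p; exact: (r _ _ _ _ (r _ _ _ _ (r _ _ _ _ f1))).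
have ec : e != c by rewrite eq_sym.
have [m [pm em le]] := cyc_center us s2 ave avc ec.
have bs : b \notin sa by exact: (link_nadj qq la).
have ux : uniq (x :: b :: sa).
  have bx : b < x by apply: (allP lts); rewrite !inE eqxx ?orbT.
  by rewrite /= bs us inE negb_or (xs la) gtn_eqF.
have pxb : perm_eq (x :: v :: b :: c :: m) (x :: b :: sa).
  clear -pm; apply/permP => P; move/permP: pm => /(_ P) /=; lia.
exists sa, (x :: v :: b :: c :: m); split=> //; split.
- by rewrite (perm_uniq pxb).
- by rewrite (perm_size pxb) /= ltnW // ltnW.
have uvc : uniq (v :: c :: m) by rewrite -(perm_uniq pm).
apply: (@cyclic_edit _ _ _ _ (walk c m) (fun t y => upair v c t y || upair v e t y)
  (fun t y => [|| upair b c t y, upair b v t y, upair e x t y | upair x v t y]) ha) => t y.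
- by rewrite (@local 2 [:: (0,3); (0,7)] [:: (6,3); (6,0); (7,10); (10,0)] t y isT) /= !orbF.
- by rewrite em cyc_centered le (upairC e v).
- rewrite /= walk_last le (upairC b v).
  by do !case: (upair _ _ _ _) => /=; rewrite ?orbT ?orbF.
- have vm : v \notin c :: m by case/andP: uvc.
  by case/orP => /upairP[] [-> ->]; rewrite walk_out ?vm ?orbT.
Qed.

Let nbrs := [:: p; v; b; u; a; c; w].

Let nbrs_lt y : y \in nbrs -> y < x.
Proof.
by move=> yn; apply: (allP lts); move: yn; rewrite !inE; do 6?[case/orP]; move=> ->; rewrite ?orbT.
Qed.

Lemma inserted7_link z : z < n -> exists s s', [/\ link Q z s, link inserted7 z s' &
  forall t, (t \in s') = [|| t \in s, upair a b z t | (t == x) && (z \in nbrs)]].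
Proof.
move=> zn; have [Z Ze] : exists Z, Z = (z \in nbrs) by eexists.
rewrite -Ze; have [s l] := quads_link QQ zn; have [us _ h] := l.
have u8 := uniq8; rewrite /= !inE !negb_or -!andbA in u8.
move: u8; repeat case/andP=> ?; move=> _.
have nab t : z != a -> z != b -> upair a b z t = false.
  by move=> za zb; rewrite /upair (negbTE za) (negbTE zb).
have ins i q q' pp : uniq pp -> {in pp, forall y, y \notin s} -> z = nth 0 vs i -> cyc s q q' ->
    (forall t y, (exists e, inserted7 (nth 0 vs i) t e y) <->
      ((exists e, Q (nth 0 vs i) t e y) /\ ~~ upair q q' t y) \/ walk q (rcons pp q') t y) ->
    (forall t, (t \in pp) = upair a b z t || ((t == x) && Z)) ->
    exists s s', [/\ link Q z s, link inserted7 z s' &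
      forall t, (t \in s') = [|| t \in s, upair a b z t | (t == x) && Z]].
  move=> upp ps zi cyp hc et.
  have [|s' ls' ps'] := link_insert (Q' := inserted7) l cyp upp ps.
  - by rewrite zi.
  - by exists s, s'; split=> // t; rewrite (perm_mem ps') mem_cat et orbC.
have ins1 i q q' : z = nth 0 vs i -> z != a -> z != b -> Z -> cyc s q q' ->
    (forall t y, (exists e, inserted7 (nth 0 vs i) t e y) <->
      ((exists e, Q (nth 0 vs i) t e y) /\ ~~ upair q q' t y) \/ walk q [:: x; q'] t y) ->
    exists s s', [/\ link Q z s, link inserted7 z s' &
      forall t, (t \in s') = [|| t \in s, upair a b z t | (t == x) && Z]].
  move=> zi za zb zZ cyp hc; apply: (ins i q q' [:: x]) => //.
    by move=> y; rewrite inE => /eqP ->; exact: xs l.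
  by move=> t; rewrite inE nab // zZ andbT.
have r := quad_rot qq; have rv := quad_rev qq.
have [zv|zv] := eqVneq z v.
  exists (p :: a :: c :: w :: S ++ u :: b :: T), (a :: x :: c :: b :: T ++ p :: w :: S ++ [:: u]).
  have vin : v \in nbrs by rewrite !inE eqxx ?orbT.
  rewrite Ze zv; split; [exact: rotv | exact: inserted7_rot |].
  move=> t; rewrite vin andbT (perm_mem (perm_three_paths p a c w u b x S T)) inE orbC -zv nab ?zv //.
have [zc|zc] := eqVneq z c.
  have [s1 [s2 [l1 l2 ps]]] := link_c; exists s1, s2; rewrite Ze zc; split=> // t.
  have cin : c \in nbrs by rewrite !inE eqxx ?orbT.
  by rewrite cin andbT (perm_mem ps) inE orbC -zc nab ?zc // eq_sym.
have [za|za] := eqVneq z a.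
  have [s1 [s2 [l1 l2 ps]]] := link_a; exists s1, s2; rewrite Ze za; split=> // t.
  have ain : a \in nbrs by rewrite !inE eqxx ?orbT.
  have ab' : (a == b) = false by apply/negbTE.
  rewrite ain andbT (perm_mem ps) !inE /upair eqxx ab' /= orbF.
  by rewrite orbA orbC; congr orb; rewrite orbC.
have [zb|zb] := eqVneq z b.
  have ax : a != x by rewrite ltn_eqF //; apply: (allP lts); rewrite !inE eqxx ?orbT.
  apply: (ins 6 v g [:: a; x]) => //.
  - by rewrite /= inE ax.
  - move=> y; rewrite !inE => /orP[] /eqP ->; last exact: xs l.
    by apply: (link_nadj qq l); rewrite zb; exact: nadj_sym.
  - by apply/h; rewrite zb; exists u; exact: rv (r _ _ _ _ f4).
  - by move=> t y; rewrite (@local 6 [:: (0,9)] [:: (0,2); (2,10); (10,9)] t y isT) /= !orbF.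
  - move=> t; have bin : b \in nbrs by rewrite !inE eqxx ?orbT.
    have ba : (b == a) = false by apply/negbTE; rewrite eq_sym.
    by rewrite Ze zb bin andbT !inE /upair eqxx ba.
have [zp|zp] := eqVneq z p.
  apply: (ins1 1 v c) => //; first by rewrite Ze zp !inE eqxx ?orbT.
  - by apply/h; rewrite zp; exists a; exact: rv (r _ _ _ _ f1).
  - by move=> t y; rewrite (@local 1 [:: (0,3)] [:: (0,10); (10,3)] t y isT) /= !orbF.
have [zw|zw] := eqVneq z w.
  apply: (ins1 4 v o) => //; first by rewrite Ze zw !inE eqxx ?orbT.
  - by apply/h; rewrite zw; exists c; exact: (r _ _ _ _ (r _ _ _ _ (r _ _ _ _ f3))).
  - by move=> t y; rewrite (@local 4 [:: (0,8)] [:: (0,10); (10,8)] t y isT) /= !orbF.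
have [zu|zu] := eqVneq z u.
  apply: (ins1 5 v g) => //; first by rewrite Ze zu !inE eqxx ?orbT.
  - by apply/h; rewrite zu; exists b; exact: (r _ _ _ _ (r _ _ _ _ (r _ _ _ _ f4))).
  - by move=> t y; rewrite (@local 5 [:: (0,9)] [:: (0,10); (10,9)] t y isT) /= !orbF.
exists s, s; split=> //.
  apply: (link_same l) => t y; apply: (surgered_elsewhere qq facts).
  by rewrite /= !inE (ltn_eqF zn) (negbTE zv) (negbTE zc) (negbTE za) (negbTE zb) (negbTE zp)
    (negbTE zw) (negbTE zu).
move=> t; rewrite nab // Ze !inE (negbTE zv) (negbTE zc) (negbTE za) (negbTE zb) (negbTE zp).
by rewrite (negbTE zw) (negbTE zu) andbF !orbF.
Qed.

Lemma inserted7_new : link inserted7 x nbrs.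
Proof.
have u8 := uniq8; rewrite /= !inE !negb_or -!andbA in u8.
move: u8; repeat case/andP=> ?; move=> _.
split=> //.
  by rewrite /= !inE !negb_or -!andbA; repeat (apply/andP; split) => //; rewrite eq_sym.
move=> t y; rewrite (@local 10 [::] [:: (1,0);(0,6);(6,5);(5,2);(2,3);(3,4);(4,1)] t y isT) /= orbF.
by split; [case=> // -[[e' /(quads_lt QQ)]]; rewrite ltnn | right].
Qed.

Lemma inserted7_quads : quads n.+1 inserted7.
Proof.
split; first exact: (surgered_quadrangles qq facts).
- move=> a' b' c' d [[/(quads_lt QQ)/ltnW //]|]; rewrite dihs_label.
  move=> /mapP[[[[i j] k] l] _ [-> _ _ _]].
  have v0 : v < n.+1 by rewrite ltnS ltnW //; apply: (allP lts); rewrite !inE eqxx.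
  have [iv|iv] := ltnP i (size vs); last by rewrite nth_default.
  have : nth 0 vs i \in vs by exact: mem_nth.
  have vsE : vs = rcons [:: v; p; a; c; w; u; b; e; o; g] x by [].
  rewrite {2}vsE mem_rcons inE => /orP[/eqP -> //|/(allP lts)]; exact: ltnW.
- move=> z; rewrite ltnS leq_eqVlt => /orP[/eqP->|/inserted7_link[s [s' [_ l _]]]].
    by exists nbrs; exact: inserted7_new.
  by exists s'.
Qed.

Lemma inserted7_adj z t : adj inserted7 z t <->
  [\/ adj Q z t, upair a b z t, z = x /\ t \in nbrs | t = x /\ z \in nbrs].
Proof.
have qq' := quads_quad inserted7_quads.
have [zn|zn] := ltnP z n.
  have [s [s' [l l' e']]] := inserted7_link zn.
  have A := link_adj t qq' l'; have B := link_adj t qq l.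
  split=> [/A|[/B us|h|[zx _]|[ux h]]]; last 4 first.
  - by apply/A; rewrite e' us.
  - by apply/A; rewrite e' h orbT.
  - by move: zn; rewrite zx ltnn.
  - by apply/A; rewrite e' ux eqxx h !orbT.
  rewrite e' => /or3P[/B ?|?|/andP[/eqP ux h]]; [constructor 1|constructor 2|constructor 4] => //.
have [zx|zx] := eqVneq z x.
  have A := link_adj t qq' inserted7_new; rewrite zx.
  split=> [/A h|[[c' [d /(quads_lt QQ)]]|h|[_ h]|[_ /nbrs_lt]]]; rewrite ?ltnn //; last exact/A.
    by constructor 3.
  have : x \in nbrs by case/upairP: h => -[-> _]; rewrite !inE eqxx ?orbT.
  by move/nbrs_lt; rewrite ltnn.
split=> [[c' [d /(quads_lt inserted7_quads)]]|]; first by rewrite ltnS leq_eqVlt (negbTE zx) ltnNge zn.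
case=> [[c' [d /(quads_lt QQ)]]|h|[zx' _]|[_ /nbrs_lt]].
- by rewrite ltnNge zn.
- have : z \in nbrs by case/upairP: h => -[-> _]; rewrite !inE eqxx ?orbT.
  by move/nbrs_lt; rewrite ltnNge zn.
- by rewrite zx' eqxx in zx.
- by rewrite ltnNge zn.
Qed.

End InsertWithEdge.

(** * Inserting a vertex *)

Notation quad_rel := (nat -> nat -> nat -> nat -> Prop).

(* Three faces in a row, the last one turning around [a0], that close up with *)
(* a twist and avoid [v].                                                     *)
Definition band (Q : quad_rel) v := exists a0 b0 a1 b1 a2 e,
  [/\ Q a0 b0 b1 a1, Q a1 b1 a0 a2, Q a2 a0 b0 e, (e != a1) && (e != b1) &
      v \notin [:: a0; b0; a1; b1; a2; e]].

(** All three surgeries remove only faces through [v]; this is why the band is asked to avoid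
    [v]. *)
Lemma band_keep (Q Q' : quad_rel) v :
  (forall a b c d, Q a b c d -> v \notin [:: a; b; c; d] -> Q' a b c d) -> band Q v -> band Q' v.
Proof.
move=> keep [a0 [b0 [a1 [b1 [a2 [e [q0 q1 q2 ne nv]]]]]]].
exists a0, b0, a1, b1, a2, e; split=> //; apply: keep => //;
  by apply: contra nv; rewrite !inE; do 3?[case/orP]; move=> ->; rewrite ?orbT.
Qed.

Definition misses n (Q : quad_rel) (M : seq (nat * nat)) := forall z u,
  adj Q z u <-> [/\ z < n, u < n, z != u & ~~ sym_mem M z u].

Definition realizable n t := exists (Q : quad_rel) M v,
  [/\ quads n Q, misses n Q M, uniq M /\ all (fun p => p.1 < p.2 < n) M, size M = t &
      (v < n /\ forall u, u < n -> u != v -> adj Q v u) /\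
      exists a0 b0 a1 b1 a2 e, [/\ Q a0 b0 b1 a1, Q a1 b1 a0 a2, Q a2 a0 b0 e &
        (e != a1) && (e != b1)]].

(** A state in the middle of the insertion of [x]: [N] lists the vertices still to be joined to [x],
    and [M] the pairs of older vertices that stay nonadjacent. No pair of [M] contains the hub [v],
    which is adjacent to everything. *)
Record partial v x (M : seq (nat * nat)) (N : seq nat) (Q : quad_rel) : Prop := Partial {
  partial_quads : quads x.+1 Q;
  partial_old : forall z u, z < x -> u < x ->
    (adj Q z u <-> z != u /\ ~~ sym_mem M z u);
  partial_new : forall u, adj Q x u <-> u < x /\ u \notin N;
  partial_N : uniq N /\ all (fun u => u < x) N;
  partial_v : v < x /\ v \notin N;
  partial_M : uniq M /\ all (fun p => [&& p.1 < p.2, p.2 < x, p.1 != v & p.2 != v]) M;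
  partial_band : band Q v
}.

Lemma sym_memC s i j : sym_mem s i j = sym_mem s j i.
Proof. by rewrite /sym_mem orbC. Qed.

Lemma sym_mem_cat s1 s2 i j : sym_mem (s1 ++ s2) i j = sym_mem s1 i j || sym_mem s2 i j.
Proof. by rewrite /sym_mem !mem_cat orbACA. Qed.

Lemma sym_mem_last x N z u :
  sym_mem [seq (y, x) | y <- N] z u = (z == x) && (u \in N) || (u == x) && (z \in N).
Proof.
have h a b : ((a, b) \in [seq (y, x) | y <- N]) = (b == x) && (a \in N).
  apply/mapP/andP => [[y yN [-> ->]]|[/eqP -> aN]]; first by rewrite eqxx.
  by exists a.
by rewrite /sym_mem !h orbC.
Qed.

Lemma M_notin v x M z : all (fun p => [&& p.1 < p.2, p.2 < x, p.1 != v & p.2 != v]) M ->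
  (z == v) || (x <= z) -> forall u, sym_mem M z u = false.
Proof.
move=> /allP h zv u; apply/negP => /orP[] /h /= /and4P[a b c d]; case/orP: zv => zv.
- by rewrite zv in c.
- by move: (leq_ltn_trans zv (ltn_trans a b)); rewrite ltnn.
- by rewrite zv in d.
- by move: (leq_ltn_trans zv b); rewrite ltnn.
Qed.

Lemma adj_lt n Q z u : quads n Q -> adj Q z u -> z < n /\ u < n.
Proof.
move=> QQ zu; split; first by case: zu => c [d /(quads_lt QQ)].
by case: (adj_sym (quads_quad QQ) zu) => c [d /(quads_lt QQ)].
Qed.

Lemma partial_misses v x M N Q : partial v x M N Q ->
  misses x.+1 Q (M ++ [seq (u, x) | u <- N]).
Proof.
move=> P z u; rewrite sym_mem_cat sym_mem_last.
have [_ Mx] := partial_M P; have mx := M_notin Mx.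
have [zn|zn] := ltnP z x.+1; last first.
  by split=> [/(adj_lt (partial_quads P))[]|[]] => [|//]; rewrite ltnNge zn.
have [un|un] := ltnP u x.+1; last first.
  by split=> [/(adj_lt (partial_quads P))[_]|[_]] => [|//]; rewrite ltnNge un.
have [zx|zx] := eqVneq z x.
  rewrite zx mx ?leqnn ?orbT //= (partial_new P).
  have [->|ux] := eqVneq u x; first by split=> [[]|[_ _]]; rewrite ?ltnn // eqxx.
  rewrite orbF ltn_neqAle ux -ltnS un.
  by split=> [[_ ->]|[_ _ _ ->]]; rewrite ?ltnS ?leqnn.
have [ux|ux] := eqVneq u x.
  rewrite ux [sym_mem M z x]sym_memC mx ?leqnn ?orbT //=.
  have -> : adj Q z x <-> adj Q x z by split; exact: adj_sym (quads_quad (partial_quads P)).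
  rewrite (partial_new P) ltn_neqAle zx -ltnS zn.
  by split=> [[_ ->]|[_ _ _ ->]].
have zl : z < x by rewrite ltn_neqAle zx.
have ul : u < x by rewrite ltn_neqAle ux.
rewrite orbF; apply: iff_trans (partial_old P zl ul) _.
by split=> [[-> ->]|[_ _ -> ->]].
Qed.

Lemma partial_wf v x M N Q : partial v x M N Q ->
  uniq (M ++ [seq (u, x) | u <- N]) /\
  all (fun p => p.1 < p.2 < x.+1) (M ++ [seq (u, x) | u <- N]).
Proof.
move=> P; have [uN /allP Nx] := partial_N P; have [uM /allP Mx] := partial_M P; split.
  rewrite cat_uniq uM map_inj_uniq ?uN ?andbT; last by move=> ? ? [].
  apply/hasPn => _ /mapP[u _ ->]; apply/negP => /Mx /and4P[_].
  by rewrite ltnn.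
rewrite all_cat; apply/andP; split; apply/allP.
  by move=> p /Mx /and4P[-> px _ _]; rewrite ltnS ltnW.
by move=> _ /mapP[u /Nx ux ->] /=; rewrite ux ltnS leqnn.
Qed.

Lemma partial_realizable v x M N Q : partial v x M N Q -> realizable x.+1 (size M + size N).
Proof.
move=> P; exists Q, (M ++ [seq (u, x) | u <- N]), v; split.
- exact: partial_quads P.
- exact: partial_misses P.
- exact: partial_wf P.
- by rewrite size_cat size_map.
have [vx vN] := partial_v P; split; last first.
  have [a0 [b0 [a1 [b1 [a2 [e [q0 q1 q2 ne _]]]]]]] := partial_band P.
  by exists a0, b0, a1, b1, a2, e.
split; first exact: ltnW.
move=> u; rewrite ltnS leq_eqVlt => /orP[/eqP -> _|ux uv].
  by apply: (adj_sym (quads_quad (partial_quads P))); apply/(partial_new P).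
apply/(partial_old P) => //; rewrite eq_sym uv; split=> //.
by have [_ h] := partial_M P; rewrite (M_notin h) // eqxx.
Qed.

Lemma partial_perm v x M N N' Q : partial v x M N Q -> perm_eq N N' -> partial v x M N' Q.
Proof.
case=> q a a' [uN Nx] [vx vN] m b p; split=> //.
- by move=> u; rewrite a' (perm_mem p).
- by rewrite -(perm_uniq p) -(perm_all _ p).
- by rewrite -(perm_mem p).
Qed.

Lemma partial_nadj v x M N Q u : partial v x M N Q -> u \in N -> nadj Q x u.
Proof.
move=> P uN c d q; have /(partial_new P)[_] : adj Q x u by exists c, d.
by rewrite uN.
Qed.

(** Besides the new rotation, the move reports its two new faces at [v] and every face at [v] that
    it keeps: the next move is admissible only if certain corners at [v] have the right opposite
    vertex. *)
Lemma partial_move v x M N o o' b q S T Q : partial v x M (o :: o' :: N) Q ->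
  link Q v (o :: o' :: S ++ b :: q :: T) -> Q v q x b -> ~ Q q x v o' -> ~ Q b x v o ->
  exists Q', [/\ partial v x M N Q', link Q' v (o' :: S ++ b :: o :: rev T ++ [:: q]),
    Q' v q x o', Q' v o x b &
    forall u e w, Q v u e w -> ~~ upair o o' u w -> ~~ upair q b u w -> Q' v u e w].
Proof.
move=> P l g c1 c2; have QQ := partial_quads P; have [us _ h] := l.
have [uN Nx] := partial_N P; have [vx vN] := partial_v P.
have [c f] : exists c, Q v o c o' by apply/h; rewrite /= /upair !eqxx.
have oN : o \in o :: o' :: N by rewrite inE eqxx.
have oN' : o' \in o :: o' :: N by rewrite !inE eqxx orbT.
have xo := partial_nadj P oN; have xo' := partial_nadj P oN'.
have ox : o < x by exact: (allP Nx).
have ox' : o' < x by exact: (allP Nx).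
have nxo : x != o by rewrite gtn_eqF.
have nxo' : x != o' by rewrite gtn_eqF.
have [f1 f2 f3] := moved_faces Q v x o o' c q b.
exists (moved Q v x o o' c q b); split=> //; last first.
- by move=> u e w; exact: (moved_keep_corner QQ f g).
- exact: (moved_rot QQ l f g xo xo' nxo nxo' c1 c2).
have madj := moved_adj QQ l f g xo xo' nxo nxo' c1 c2.
split.
- exact: (moved_quads QQ l f g xo xo' nxo nxo' c1 c2).
- move=> z u zx ux; rewrite -(partial_old P zx ux); apply: iff_trans (madj z u) _.
  split=> [[//|/upairP|/upairP]|]; last by constructor 1.
    by case=> -[zx' ux']; [rewrite zx' ltnn in zx | rewrite ux' ltnn in ux].
  by case=> -[zx' ux']; [rewrite zx' ltnn in zx | rewrite ux' ltnn in ux].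
- have [oN2 [oN3 uN2]] : o \notin o' :: N /\ o' \notin N /\ uniq N by case/and3P: uN.
  have oN4 : o \notin N by apply: contra oN2; rewrite inE orbC => ->.
  move=> u; apply: iff_trans (madj x u) _; split.
    case=> [/(partial_new P)[ux]|/upairP[][xo1 uo]|/upairP[][xo1 uo]].
    - by rewrite !inE !negb_or => /and3P[].
    - by rewrite uo.
    - by rewrite xo1 eqxx in nxo.
    - by rewrite uo.
    - by rewrite xo1 eqxx in nxo'.
  case=> ux uN3; have [->|uo] := eqVneq u o; first by constructor 2; rewrite /upair !eqxx.
  have [->|uo'] := eqVneq u o'; first by constructor 3; rewrite /upair !eqxx.
  by constructor 1; apply/(partial_new P); rewrite !inE !negb_or uo uo'.
- by split; [case/and3P: uN | case/and3P: Nx].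
- by split=> //; move: vN; rewrite !inE !negb_or => /and3P[].
- exact: partial_M P.
- by apply: band_keep (partial_band P) => *; exact: moved_keep.
Qed.

(** This is the part of the rotation at the hub that a run of moves leaves behind. If al, be is the
    corner opposite [x], the move on o, o' leaves the finished pair al, o and passes the corner be,
    o' on to the next move. *)
Fixpoint fill al be (L : seq nat) :=
  if L is o :: o' :: L' then al :: o :: fill be o' L' else [:: al; be].

(** The finished pairs are again corners whose face is opposite [x]. Later steps pick one of them as
    the second face of a move or as the end of the next window. *)
Fixpoint paired (Q : quad_rel) v x (s : seq nat) : Prop :=
  if s is a :: b :: s' then Q v a x b /\ paired Q v x s' else True.

Lemma seq2_ind (T : Type) (P : seq T -> Prop) : P [::] -> (forall a, P [:: a]) ->
  (forall a b s, P s -> P (a :: b :: s)) -> forall s, P s.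
Proof.
move=> P0 P1 P2; have H : forall s, P s /\ forall a, P (a :: s).
  by elim=> [|b s [IH1 IH2]]; split=> // a; exact: P2.
by move=> s; case: (H s).
Qed.

Lemma quad_opposite (Q : quad_rel) a b c c' d : quadrangles Q -> Q a b c d -> Q a b c' d -> c = c'.
Proof.
move=> QQ q q'; apply: (quad_corner QQ (a := d) (b := a) (c := b)).
  exact: (quad_rot QQ (quad_rot QQ (quad_rot QQ q))).
exact: (quad_rot QQ (quad_rot QQ (quad_rot QQ q'))).
Qed.

(** The vertices of [L] are joined to [x] two at a time, and each intermediate state realizes one
    number of missing edges. The vertex [r] is the one that follows [L] at the hub. The assumption
    for [r = x] concerns the last move only, where [x] itself would be next to [o']: the face at
    that corner must not be the one that crosses the new face. *)
Lemma fill_lemma v x M R L : ~~ odd (size L) -> forall al be N r Q,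
  partial v x M (L ++ N) Q -> link Q v (al :: be :: L ++ r :: R) -> Q v al x be ->
  (r = x -> exists2 g, Q v (last be L) g x & g \notin al :: be :: L) ->
  (forall j, j.*2 <= size L -> realizable x.+1 (size M + (size L + size N) - j.*2)) /\
  exists Q', [/\ partial v x M N Q', link Q' v (fill al be L ++ r :: R),
    paired Q' v x (fill al be L) &
    forall t g y, Q v t g y -> (t \notin al :: be :: L) || (y \notin al :: be :: L) -> Q' v t g y].
Proof.
elim/seq2_ind: L R => [|//|o o' L IH] R.
  move=> _ al be N r Q P l f _; split; last by exists Q.
  by move=> [|j] // _; rewrite subn0 add0n; exact: partial_realizable P.
rewrite /= negbK => ev al be N r Q P l f hr.
have QQ := partial_quads P; have qq := quads_quad QQ; have [us s4 h] := l.
have [nbo nbo'] : al != o' /\ be != o'.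
  by move: us; rewrite /= !inE !negb_or -!andbA; repeat case/andP=> ?; move=> _.
have l' : link Q v (o :: o' :: (L ++ r :: R) ++ al :: be :: [::]).
  apply: (link_equiv l) => [|t y].
    by rewrite -[al :: be :: _]/([:: al; be] ++ _) perm_catC.
  by rewrite -[al :: be :: _]/([:: al; be] ++ _) cyc_catC.
have s2 : 1 < size [:: al, be, o, o' & L ++ r :: R] by [].
have cyc_o' t : cyc [:: al, be, o, o' & L ++ r :: R] o' t -> t = o \/ t = head r L.
  have c1 : cyc [:: al, be, o, o' & L ++ r :: R] o' o by rewrite /= /upair !eqxx !orbT.
  have c2 : cyc [:: al, be, o, o' & L ++ r :: R] o' (head r L).
    by case: (L) => [|? ?] /=; rewrite /upair !eqxx !orbT.
  apply: (cyc_center_only us s2 c1 c2).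
  by move: us; case: (L) => [|? ?]; rewrite /= !inE !negb_or -!andbA; repeat case/andP=> ?; move=> _.
have cyc_o t : cyc [:: al, be, o, o' & L ++ r :: R] o t -> t = be \/ t = o'.
  have c1 : cyc [:: al, be, o, o' & L ++ r :: R] o be by rewrite /= /upair !eqxx !orbT.
  have c2 : cyc [:: al, be, o, o' & L ++ r :: R] o o' by rewrite /= /upair !eqxx !orbT.
  exact: (cyc_center_only us s2 c1 c2).
have Nx y : y \in o :: o' :: L -> y != x.
  have [_ /allP Nx] := partial_N P; move=> yL; rewrite ltn_eqF //.
  by apply: (Nx y); change (y \in (o :: o' :: L) ++ N); rewrite mem_cat yL.
have xo : x != o by rewrite eq_sym Nx // inE eqxx.
have xo' : x != o' by rewrite eq_sym Nx // !inE eqxx orbT.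
have [xal xbe] : x != al /\ x != be.
  have := quad_uniq qq f; rewrite /= !inE !negb_or -!andbA.
  by repeat case/andP=> ?; move=> _; split=> //; rewrite eq_sym.
have c1 : ~ Q be x v o'.
  move=> q; have q' := quad_rot qq (quad_rot qq q).
  have /cyc_o'[e|e] : cyc [:: al, be, o, o' & L ++ r :: R] o' x by apply/h; exists be.
    by rewrite e eqxx in xo.
  case: L {IH l us s4 h l' cyc_o cyc_o' s2 P ev} hr Nx e => [|z L] /= hr Nx e.
    have [//|g q2 gN] := hr; have := quad_opposite qq q' q2.
    by move=> eg; move: gN; rewrite -eg !inE eqxx orbT.
  by have := Nx z; rewrite !inE eqxx !orbT e eqxx => /(_ isT).
have c2 : ~ Q al x v o.
  move=> q; have q' := quad_rot qq (quad_rot qq q).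
  have /cyc_o[e|e] : cyc [:: al, be, o, o' & L ++ r :: R] o x by apply/h; exists al.
    by rewrite e eqxx in xbe.
  by rewrite e eqxx in xo'.
have [Q1 [P1 l1 f1 f2 k1]] := partial_move P l' (quad_rev qq f) c1 c2.
have l1' : link Q1 v (be :: o' :: L ++ r :: (R ++ [:: al; o])).
  have e : o' :: (L ++ r :: R) ++ al :: o :: rev [::] ++ [:: be] =
      (o' :: L ++ r :: (R ++ [:: al; o])) ++ [:: be].
    by rewrite /= -!catA /= -!catA.
  rewrite e in l1; apply: (link_equiv l1) => [|t y]; first by rewrite perm_catC.
  by rewrite cyc_catC.
have hr1 : r = x -> exists2 g, Q1 v (last o' L) g x & g \notin be :: o' :: L.
  move=> /hr[g q gN]; exists g; last by move: gN; rewrite !inE !negb_or => /and4P[_ -> _].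
  by apply: k1 => //; rewrite upair_out // !inE !negb_or ?xo ?xo' ?xal ?xbe ?orbT.
have [lad [Q' [P' l2 pr' k']]] := IH (R ++ [:: al; o]) ev be o' N r Q1 P1 l1' f1 hr1.
split.
  case=> [|j] jL; last first.
    have e : size M + ((size L).+2 + size N) - j.+1.*2 = size M + (size L + size N) - j.*2 by lia.
    by rewrite e; apply: lad; move: jL; rewrite doubleS.
  by have := partial_realizable P; rewrite /= size_cat subn0.
have alN : al \notin be :: o' :: L.
  move: us; rewrite /= !inE mem_cat !negb_or -!andbA.
  by repeat case/andP=> ?; move=> _; repeat (apply/andP; split).
exists Q'; split=> //.
- apply: (link_equiv l2) => [|t y].
    have -> : fill be o' L ++ r :: R ++ [:: al; o] = (fill be o' L ++ r :: R) ++ [:: al; o].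
      by rewrite -catA.
    by rewrite perm_catC.
  have -> : fill be o' L ++ r :: R ++ [:: al; o] = (fill be o' L ++ r :: R) ++ [:: al; o].
    by rewrite -catA.
  by rewrite cyc_catC.
- split=> //; apply: k'; last by rewrite alN.
  exact: (quad_rev (quads_quad (partial_quads P1)) f2).
move=> t g y q ty; apply: k'; last first.
  case/orP: ty => ty; apply/orP; [left|right]; move: ty; rewrite !inE !negb_or;
    by case/and5P=> _ -> _ -> ->.
apply: k1 => //; rewrite upair_out //; case/orP: ty => ty; apply/orP; [left|right|left|right];
  move: ty; rewrite !inE !negb_or; by case/and5P=> h1 h2 h3 h4 _; rewrite ?h1 ?h2 ?h3 ?h4.
Qed.

(** * From one complete or almost complete graph to the next *)

Lemma link_rot Q z s1 s2 : link Q z (s1 ++ s2) -> link Q z (s2 ++ s1).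
Proof.
move=> l; apply: (link_equiv l) => [|u w]; first by rewrite perm_catC.
exact: cyc_catC.
Qed.

Lemma link_rev Q z s : link Q z s -> link Q z (rev s).
Proof.
move=> l; apply: (link_equiv l) => [|u w]; first by rewrite perm_sym perm_rev.
by rewrite cyc_rev.
Qed.

Record almost v n (M : seq (nat * nat)) (Q : quad_rel) : Prop := Almost {
  almost_quads : quads n Q;
  almost_adj : forall z u, z < n -> u < n -> (adj Q z u <-> z != u /\ ~~ sym_mem M z u);
  almost_v : v < n;
  almost_M : uniq M /\ all (fun p => [&& p.1 < p.2, p.2 < n, p.1 != v & p.2 != v]) M;
  almost_band : band Q v
}.

Lemma partial_almost v x M N Q : partial v x M N Q ->
  almost v x.+1 (M ++ [seq (u, x) | u <- N]) Q.
Proof.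
move=> P; have [uw Mw] := partial_wf P; have [vx vN] := partial_v P.
split; [exact: partial_quads P | | exact: ltnW | | exact: partial_band P].
  move=> z u zx ux; apply: iff_trans (partial_misses P z u) _.
  by split=> [[]|[]].
split=> //; apply/allP => p; rewrite mem_cat => /orP[pM|/mapP[u uN ->]] /=.
  have [_ /allP /(_ _ pM) /and4P[-> px -> ->]] := partial_M P.
  by rewrite ltnS ltnW.
have [_ /allP /(_ _ uN) ->] := partial_N P.
rewrite ltnS leqnn (gtn_eqF vx) /= andbT.
by apply: contra vN => /eqP <-.
Qed.

Lemma almost_hub v n M Q s u : almost v n M Q -> link Q v s -> u < n -> u != v -> u \in s.
Proof.
move=> A l un uv; have QQ := almost_quads A.
apply/(link_adj u (quads_quad QQ) l)/(almost_adj A (almost_v A) un).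
rewrite eq_sym uv; split=> //; have [_ h] := almost_M A.
by rewrite (M_notin h) ?eqxx.
Qed.

Lemma link_lt n Q v s u : quads n Q -> link Q v s -> u \in s -> u < n.
Proof. by move=> QQ l us; have /(adj_lt QQ)[] : adj Q v u by apply/(link_adj u (quads_quad QQ) l). Qed.

Lemma size_rotation v n M Q s : almost v n M Q -> link Q v s -> size s = n.-1.
Proof.
move=> A l; have QQ := almost_quads A; have [us _ _] := l.
have p : perm_eq (v :: s) (iota 0 n).
  apply: uniq_perm; rewrite ?iota_uniq //= ?us ?(link_self (quads_quad QQ) l) // => u.
  rewrite inE mem_iota add0n; have [->|uv] := eqVneq u v; first by rewrite (almost_v A).
  by apply/idP/idP => [|un]; [exact: (link_lt QQ l) | exact: almost_hub A l un uv].
by have := perm_size p; rewrite size_iota => <-.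
Qed.

(** The faces v c op w and v a c b are those that the insertion of degree 4 consumes, so that the
    new vertex is joined to [v], [op], [a] and [b]. It lands between [c] and [w], and the arc from
    [w] to [B] is then filled from the corner a, b backwards. The vertices of [D] and [c] lie on its
    other side and remain to be joined. *)
Lemma insert_step v n M Q op D c w B a b : almost v n M Q ->
  link Q v (op :: D ++ c :: w :: B ++ [:: a; b]) -> Q v c op w -> Q v a c b -> odd (size B) ->
  (forall j, j.*2 <= (size B).+1 ->
    realizable n.+1 (size M + ((size B).+1 + (size D).+1) - j.*2)) /\
  exists Q' e, [/\ e \in [:: a; b], partial v n M (D ++ [:: c]) Q',
    link Q' v (op :: D ++ c :: n :: rev (fill b a (rev (w :: B)))) &
    [/\ paired Q' v n (fill b a (rev (w :: B))), Q' v n op w & Q' v c e n]].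
Proof.
move=> A l f g oB; have QQ := almost_quads A; have qq := quads_quad QQ.
have [us _ h] := l; have vl := link_self qq l.
have r := quad_rot qq; have rv := quad_rev qq.
have [sc lc] := quads_link QQ (quads_lt QQ (r _ _ _ _ f)).
have f' : Q c v w op := r _ _ _ _ (r _ _ _ _ (r _ _ _ _ (rv _ _ _ _ f))).
have [uc s4 hc] := lc.
have cvo : cyc sc v op by apply/hc; exists w.
have cab : cyc sc a b by rewrite cyc_sym; apply/hc; exists v; exact: r (r _ _ _ _ g).
have l0 : link Q v (c :: w :: (B ++ [:: a; b]) ++ op :: D) by exact: (@link_rot Q v (op :: D) (c :: w :: B ++ [:: a; b]) l).
have inr y : y \in op :: D ++ c :: w :: B ++ [:: a; b] -> v != y.
  by move=> yl; apply: contra vl => /eqP ->.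
have pab : perm_eq [:: a, b, w, op & D ++ c :: B] (op :: D ++ c :: w :: B ++ [:: a; b]).
  by clear; apply/permP => P; rewrite /= !count_cat /= !count_cat /=; lia.
have uab : uniq [:: a, b, w, op & D ++ c :: B] by rewrite (perm_uniq pab).
have [aw [ao [bw [bo [av bv]]]]] : a != w /\ a != op /\ b != w /\ b != op /\ a != v /\ b != v.
  move: uab; rewrite /= !inE !negb_or -!andbA; repeat case/andP=> ?; move=> _.
  by do !split=> //; rewrite eq_sym; apply: inr; rewrite -(perm_mem pab) !inE eqxx ?orbT.
have nav : a \notin [:: v; op] by rewrite !inE negb_or av ao.
have nbv : b \notin [:: v; op] by rewrite !inE negb_or bv bo.
(* The link of [c] contains the edges joining [v] to [op] and [a] to [b]. Which of [a] and [b] comes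
   first is not known, so [q'], [b'] are these two in one of the two orders. *)
have [b' [q' [S [T [e1 p1 c1]]]]] := cyc_split2 uc (ltnW (ltnW s4)) cvo cab nav nbv.
have lc' := link_equiv lc p1 c1.
have g' : Q v q' c b' by case: e1 => -[-> ->] //; exact: rv.
have [qw qo bw' bo'] : [/\ q' != w, q' != op, b' != w & b' != op].
  by case: e1 => -[-> ->].
set Q1 := inserted n Q v q' c b' w op.
have Q1q : quads n.+1 Q1 := inserted_quads QQ l0 lc' g' f' qw qo bw' bo'.
have l1 : link Q1 v (c :: n :: w :: (B ++ [:: a; b]) ++ op :: D) :=
  inserted_rot QQ l0 lc' g' f' qw qo bw' bo'.
have adj1 := inserted_adj QQ l0 lc' g' f' qw qo bw' bo'.
have [f1 f2 _ f3] : [/\ Q1 v q' n b', Q1 n v w op, Q1 c q' n op & Q1 c v n b'] :=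
  inserted_faces n Q v q' c b' w op.
have r1 := quad_rot (quads_quad Q1q); have rv1 := quad_rev (quads_quad Q1q).
have lrot y : y \in op :: D ++ c :: w :: B ++ [:: a; b] -> y < n := link_lt QQ l.
have P1 : partial v n M (D ++ c :: w :: B) Q1.
  split.
  - exact: Q1q.
  - move=> z u zn un; apply: iff_trans (adj1 z u) _.
    rewrite -(almost_adj A zn un); split=> [[//|[e _]|[e _]]|]; last by constructor 1.
      by rewrite e ltnn in zn.
    by rewrite e ltnn in un.
  - move=> u; have eab : (u \in [:: v; op; q'; b']) = (u \in [:: v; op; a; b]).
      by case: e1 => -[-> ->]; rewrite !inE //; congr [|| _, _ | _]; rewrite orbC.
    have part : u < n -> (u \in [:: v; op; a; b]) = (u \notin D ++ c :: w :: B).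
      move=> un; have [uv|uv] := eqVneq u v.
        rewrite uv inE eqxx; apply/esym; apply: contra vl => vN.
        by rewrite -(perm_mem pab) !inE; move: vN; rewrite !mem_cat !inE;
          do 3?[case/orP]; move=> ->; rewrite ?orbT.
      have := almost_hub A l un uv; rewrite -(perm_mem pab) => uin.
      have pab' : perm_eq [:: a, b, w, op & D ++ c :: B] ([:: op; a; b] ++ (D ++ c :: w :: B)).
        by clear; apply/permP => P; rewrite /= !count_cat /= ; lia.
      have : uniq ([:: op; a; b] ++ (D ++ c :: w :: B)) by rewrite -(perm_uniq pab').
      rewrite cat_uniq => /and3P[_ /hasPn dj _].
      rewrite in_cons (negbTE uv) /=; move: uin; rewrite (perm_mem pab') mem_cat.
      have [uN|uN] := boolP (u \in D ++ c :: w :: B); first by rewrite (negbTE (dj _ uN)).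
      by rewrite orbF.
    apply: iff_trans (adj1 n u) _; rewrite eab; split.
      case=> [/(adj_lt QQ)[]|[_ ul]|[_ nin]]; rewrite ?ltnn //.
        have un : u < n.
          move: ul; rewrite inE => /orP[/eqP ->|ul]; first exact: almost_v A.
          by apply: lrot; rewrite -(perm_mem pab); move: ul; rewrite !inE;
            do 2?[case/orP]; move=> ->; rewrite ?orbT.
        by split=> //; rewrite -part.
      have : n < n.
        move: nin; have -> : (n \in [:: v; op; q'; b']) = (n \in [:: v; op; a; b]).
          by case: e1 => -[-> ->]; rewrite !inE //; congr [|| _, _ | _]; rewrite orbC.
        rewrite inE => /orP[/eqP e|ul]; first by rewrite {1}e; exact: almost_v A.
        by apply: lrot; rewrite -(perm_mem pab); move: ul; rewrite !inE;
          do 2?[case/orP]; move=> ->; rewrite ?orbT.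
      by rewrite ltnn.
    by case=> un uN; constructor 2; split=> //; rewrite part.
  - have sub : subseq (D ++ c :: w :: B) (op :: D ++ c :: w :: B ++ [:: a; b]).
      have := cat_subseq (sub0seq [:: op]) (cat_subseq (subseq_refl (D ++ c :: w :: B))
        (sub0seq [:: a; b])).
      by rewrite /= cats0 -catA.
    split; first exact: (subseq_uniq sub).
    by apply/allP => y /(mem_subseq sub) /lrot.
  - split; first exact: almost_v A.
    by apply: contra vl; rewrite !(inE, mem_cat); do 4?[case/orP]; move=> ->; rewrite ?orbT.
  - exact: almost_M A.
  - apply: band_keep (almost_band A) => *; exact: inserted_keep.
have pN : perm_eq (D ++ c :: w :: B) (rev (w :: B) ++ (D ++ [:: c])).
  clear; apply/permP => P; rewrite /= !count_cat /= count_rev /=; lia.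
(* Read backwards, the rotation starts with the corner opposite the new vertex, continues with the
   arc to be filled and then meets the new vertex itself; hence [r] is [n] and [hr] is a real
   condition, met because the face at the corner of [w] and [n] has the opposite vertex [op]. *)
have l2 : link Q1 v (b :: a :: rev (w :: B) ++ n :: (c :: rev D ++ [:: op])).
  have := link_rev l1; rewrite !(rev_cons, rev_cat) -!cats1 /= -!catA => l2.
  have := @link_rot Q1 v (rev D ++ [:: op]) ([:: b; a] ++ rev B ++ [:: w] ++ [:: n] ++ [:: c]).
  rewrite -!catA => /(_ l2); by rewrite -?catA.
have fab : Q1 v b n a by case: e1 => -[eb eq]; move: f1; rewrite eb eq // => /rv1.
have fop : Q1 v n op w by exact: rv1 (r1 _ _ _ _ f2).
have hr : n = n -> exists2 y, Q1 v (last a (rev (w :: B))) y n & y \notin b :: a :: rev (w :: B).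
  move=> _; exists op; first by rewrite rev_cons last_rcons; exact: rv1.
  move: uab; rewrite !(inE, mem_rev, mem_cat) /= !(inE, mem_cat) !negb_or -!andbA.
  repeat case/andP=> ?; move=> _.
  by repeat (apply/andP; split) => //; rewrite eq_sym.
have [|lad [Q' [P' l3 pr k]]] := fill_lemma _ (partial_perm P1 pN) l2 fab hr.
  by rewrite size_rev /= oB.
split.
  by move=> j jB; have := lad j; rewrite size_rev size_cat /= addn1; exact.
have nS : n \notin b :: a :: rev (w :: B).
  apply/negP => nin; have : n < n.
    apply: lrot; rewrite -(perm_mem pab); move: nin; rewrite !(inE, mem_rev, mem_cat).
    by do 3?[case/orP]; move=> ->; rewrite ?orbT.
  by rewrite ltnn.
exists Q', b'; split=> //; last split=> //.
- by case: e1 => -[-> _]; rewrite !inE eqxx ?orbT.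
- have := link_rev l3; rewrite rev_cat !rev_cons rev_cat /= revK -!cats1 -!catA /=.
  by [].
- by apply: k => //; rewrite nS.
- by apply: k; [exact: rv1 (r1 _ _ _ _ f3) | rewrite nS orbT].
Qed.

(** The vertices of [D] are not adjacent in the rotation to any corner opposite the new vertex, so
    [fill_lemma] does not apply to them directly. One move on d, d' with the finished pair s1, s2 as
    its second face reverses the arc that contains [D] and puts [D] right behind the corner s1, d.
    The vertices of [C] stay unjoined. *)
Lemma swap_step v n M Q op D d d' C Y s1 s2 tl w : partial v n M (D ++ d :: d' :: C) Q ->
  link Q v (op :: D ++ d :: d' :: C ++ n :: Y ++ s1 :: s2 :: tl) ->
  Q v s2 n s1 -> ~ Q v d' s2 n -> ~~ odd (size D) -> Q v n op w ->
  (forall j, j.*2 <= size D -> realizable n.+1 (size M + (size D + size C) - j.*2)) /\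
  exists Q', [/\ partial v n M C Q',
    link Q' v (op :: rev tl ++ s2 :: d' :: C ++ n :: Y ++ fill s1 d (rev D)),
    paired Q' v n (fill s1 d (rev D)), Q' v n op w & Q' v s2 n d'].
Proof.
move=> P l f c1 oD g; have QQ := partial_quads P; have qq := quads_quad QQ.
have [us s4 h] := l.
have pN : perm_eq (D ++ d :: d' :: C) (d :: d' :: rev D ++ C).
  by clear; apply/permP => A; rewrite /= !count_cat count_rev /=; lia.
have l' : link Q v (d :: d' :: (C ++ n :: Y) ++ s1 :: s2 :: (tl ++ op :: D)).
  have := @link_rot Q v (op :: D) (d :: d' :: C ++ n :: Y ++ s1 :: s2 :: tl) l.
  by rewrite /= -?catA /= -?catA /= -?catA.
have [us' _ h'] := l'.
have uall : uniq ([:: op, d, d', n, s1, s2 & D ++ C ++ Y ++ tl]).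
  rewrite -(@perm_uniq _ (op :: D ++ d :: d' :: C ++ n :: Y ++ s1 :: s2 :: tl)) //.
  by clear; apply/permP => A; rewrite /= !count_cat /= !count_cat /= !count_cat /=; lia.
have c1' : ~ Q s2 n v d' by move=> q; apply: c1; exact: (quad_rot qq (quad_rot qq q)).
have nin y : y \in op :: d :: d' :: s1 :: s2 :: D ++ C ++ Y ++ tl -> n != y.
  have pn : perm_eq ([:: op, d, d', n, s1, s2 & D ++ C ++ Y ++ tl])
      (n :: op :: d :: d' :: s1 :: s2 :: D ++ C ++ Y ++ tl).
    by clear; apply/permP => A; rewrite /= !count_cat; lia.
  move: uall; rewrite (perm_uniq pn) cons_uniq => /andP[ni _] yi.
  by apply: contra ni => /eqP ->.
(* The neighbours of [d] at the hub are [d'] and the last element of [op :: D], neither of which is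
   [n]. *)
have c2 : ~ Q s1 n v d.
  move=> q; have q' := quad_rot qq (quad_rot qq q).
  have cd : cyc (d :: d' :: (C ++ n :: Y) ++ s1 :: s2 :: (tl ++ op :: D)) d d'.
    by rewrite /= /upair !eqxx.
  have cl : cyc (d :: d' :: (C ++ n :: Y) ++ s1 :: s2 :: (tl ++ op :: D)) d (last op D).
    rewrite cyc_centered /= !last_cat /= last_cat /= /upair !eqxx /=.
    by rewrite !orbT.
  have ldd : last op D != d'.
    move: uall; rewrite /= !(inE, mem_cat) !negb_or -!andbA; repeat case/andP=> ?; move=> _.
    have := mem_last op D; rewrite inE => /orP[/eqP -> //|lD].
    by apply: contraTneq lD => ->.
  have : cyc (d :: d' :: (C ++ n :: Y) ++ s1 :: s2 :: (tl ++ op :: D)) d n by apply/h'; exists s1.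
  case/(cyc_center_only us' isT cl cd ldd) => e.
    have := nin (last op D); rewrite -e eqxx => h0; have : false by apply: h0; rewrite e;
      have := mem_last op D; rewrite !inE !mem_cat => /orP[->|->]; rewrite ?orbT.
    by [].
  by have := nin d'; rewrite e !inE eqxx ?orbT => /(_ isT).
have [Q1 [P1 l1 f1 f2 k1]] := partial_move (partial_perm P pN) l' f c1' c2.
have l2 : link Q1 v (s1 :: d :: rev D ++ op :: (rev tl ++ s2 :: d' :: C ++ n :: Y)).
  have e : d' :: (C ++ n :: Y) ++ s1 :: d :: rev (tl ++ op :: D) ++ [:: s2] =
      (d' :: C ++ n :: Y) ++ (s1 :: d :: rev D ++ op :: rev tl ++ [:: s2]).
    by rewrite rev_cat rev_cons -cats1 /= -?catA /= -?catA /= -?catA.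
  rewrite e in l1; have := link_rot l1; rewrite /= -?catA /= -?catA /= -?catA.
  by [].
have hr : op = n -> exists2 y, Q1 v (last d (rev D)) y n & y \notin s1 :: d :: rev D.
  by move=> e; have := nin op; rewrite e inE eqxx => /(_ isT).
have f2' : Q1 v s1 n d by exact: (quad_rev (quads_quad (partial_quads P1)) f2).
have [|lad [Q2 [P2 l3 pr k2]]] := fill_lemma _ P1 l2 f2' hr; first by rewrite size_rev.
split; first by move=> j jD; have := lad j; rewrite size_rev; exact.
have nS : n \notin s1 :: d :: rev D.
  apply/negP => ni; have := nin n; rewrite eqxx => h0; have : false; last by [].
  apply: h0; move: ni; rewrite !(inE, mem_rev, mem_cat).
  by do 2?[case/orP]; move=> ->; rewrite ?orbT.
exists Q2; split=> //.
- have := link_rot l3; rewrite /= -?catA /= -?catA /= -?catA.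
  by [].
- apply: k2; last by rewrite nS.
  by apply: k1 => //; rewrite upair_out // !inE !negb_or !nin // !inE eqxx ?orbT.
apply: k2 => //; apply/orP; left.
move: uall; rewrite !(inE, mem_rev) /= !(inE, mem_cat) !negb_or -!andbA.
repeat case/andP=> ?; move=> _.
by repeat (apply/andP; split) => //; rewrite eq_sym.
Qed.

Lemma fill_shape al be L : exists y s, fill al be L = al :: y :: s.
Proof. by case: L => [|o [|o' L]]; eexists; eexists. Qed.

Lemma fill_last x0 al be L : ~~ odd (size L) -> last x0 (fill al be L) = last be L.
Proof.
elim/seq2_ind: L x0 al be => [|//|o o' L IH] x0 al be //=; rewrite negbK => eL.
by rewrite IH.
Qed.

Lemma size_fill al be L : ~~ odd (size L) -> size (fill al be L) = (size L).+2.
Proof.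
by elim/seq2_ind: L al be => [|//|o o' L IH] al be //=; rewrite negbK => eL; rewrite IH.
Qed.

Lemma paired_last Q v x s : paired Q v x s -> ~~ odd (size s) -> s != [::] ->
  exists s0 a b, s = s0 ++ [:: a; b] /\ Q v a x b.
Proof.
elim/seq2_ind: s => [//|//|a b s IH] /= [q /IH h]; rewrite negbK => /h hs _.
have [->|/hs[s0 [a' [b' [-> q']]]]] := eqVneq s [::]; first by exists [::], a, b.
by exists (a :: b :: s0), a', b'.
Qed.

(* The state of the rotation op, D, c, Z at [v] from which a vertex can be    *)
(* inserted.                                                                  *)
Record window v n M op D c Z Q : Prop := Window {
  window_almost : almost v n M Q;
  window_rot : link Q v (op :: D ++ c :: Z);
  window_first : Q v c op (head 0 Z);
  window_last : exists Z0 a b, Z = Z0 ++ [:: a; b] /\ Q v a c b;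
  window_even : ~~ odd (size Z) && (3 < size Z)
}.

Lemma window_split v n M op D c Z Q : window v n M op D c Z Q ->
  exists w B a b, [/\ Z = w :: B ++ [:: a; b], Q v c op w, Q v a c b & odd (size B)].
Proof.
move=> [_ _ f [Z0 [a [b [ZE g]]]] /andP[]]; rewrite ZE size_cat addn2 /= negbK.
case: Z0 ZE => [|w B] ZE //= oB _; exists w, B, a, b; split=> //.
  by move: f; rewrite ZE.
by move: oB; rewrite negbK.
Qed.

(** The vertex just inserted becomes the centre [c] of the next window: its face with [op] is left
    from the insertion, and the last pair of [fill] provides the face at the other end. As the
    rotation has [n] elements, the two arithmetic conditions say that [Z] is even and has more than
    three elements. *)
Lemma window_grow v n M op D c Y s1 d L w Q : almost v n.+1 M Q ->
  link Q v (op :: D ++ c :: Y ++ fill s1 d L) -> paired Q v c (fill s1 d L) ->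
  Q v c op w -> head 0 (Y ++ [:: s1]) = w -> ~~ odd (size L) ->
  ~~ odd (n + size D) -> size D + 5 < n -> window v n.+1 M op D c (Y ++ fill s1 d L) Q.
Proof.
move=> A l pr f hw eL on nD; have := size_rotation A l.
rewrite /= size_cat /= => sz; split=> //.
- have [y [s fE]] := fill_shape s1 d L; rewrite fE.
  by move: hw; case: (Y) => [|y' Y'] /= ->.
- have eF : ~~ odd (size (fill s1 d L)) by rewrite size_fill //= negbK.
  have nF : fill s1 d L != [::] by have [y [s ->]] := fill_shape s1 d L.
  have [s [a [b [-> q]]]] := paired_last pr eF nF.
  by exists (Y ++ s), a, b; rewrite catA.
- by move: on; lia.
Qed.

(** An even number of vertices remains after the insertion, so all of them get joined and [M] does
    not grow. Here [d'] of [swap_step] is [c], which is next to the new vertex; the swap therefore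
    needs a pair whose vertex [s2] differs from the vertex [e] opposite the hub at that corner. *)
Lemma even_step v n M op D d c Z Q : window v n M op (D ++ [:: d]) c Z Q ->
  ~~ odd (size D) -> ~~ odd n -> 9 < n ->
  (forall j, j.*2 <= n - 4 -> realizable n.+1 (size M + (n - 4) - j.*2)) /\
  exists T Y s1 s2 Q', [/\ window v n.+1 M op (T ++ [:: s2; c]) n (Y ++ fill s1 d (rev D)) Q',
    Q' v s2 n c & size T = 0 \/ size T = 2].
Proof.
move=> W eD en n9; have [w [B [a [b [ZE f g oB]]]]] := window_split W.
have A := window_almost W; have l := window_rot W; rewrite ZE in l.
have szr := size_rotation A l.
have szn : n - 4 = (size B).+1 + (size D).+2.
  by move: szr; rewrite /= !size_cat /= !size_cat /=; lia.
have [lad1 [Q1 [e [eab P1 l1 [pr1 fop fe]]]]] := insert_step A l f g oB.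
set F := fill b a (rev (w :: B)) in l1 pr1.
have eL : ~~ odd (size (rev (w :: B))) by rewrite size_rev /= oB.
have szF : size F = (size B).+3 by rewrite size_fill // size_rev.
have hF : head 0 (rev F) = w.
  have : last 0 F = w by rewrite fill_last // rev_cons last_rcons.
  by case/lastP: (F) => [|F' z]; rewrite ?last_rcons ?rev_rcons.
have qq1 := quads_quad (partial_quads P1).
(* If [e] is not [b], the outermost pair of the filled arc serves and [tl] is empty. If [e] is [b],
   the next pair is used, with [s2 = a], and the outermost one becomes [tl]. *)
have [Y [s1 [s2 [tl [FE q2 ne tlE]]]]] : exists Y s1 s2 tl,
    [/\ rev F = Y ++ s1 :: s2 :: tl, Q1 v s2 n s1, s2 != e & size tl = 0 \/ size tl = 2].
  have [z0 [s FE]] := fill_shape b a (rev (w :: B)).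
  have uF : uniq F.
    have [u1 _ _] := l1; have : subseq (rev F) (op :: (D ++ [:: d]) ++ c :: n :: rev F).
      by have := suffix_subseq (op :: (D ++ [:: d]) ++ [:: c; n]) (rev F); rewrite /= -catA.
    by move/subseq_uniq => /(_ u1); rewrite rev_uniq.
  rewrite -/F in FE; have [eb|eb] := eqVneq e b; last first.
    exists (rev s), z0, b, [::]; rewrite FE !rev_cons -!cats1 -!catA; split=> //.
    - by move: pr1; rewrite FE => -[].
    - by rewrite eq_sym.
    - by left.
  have [y [s' sE]] : exists y s', s = a :: y :: s'.
    have : 1 < size (rev (w :: B)) by rewrite size_rev /= ltnS; case: (B) oB.
    move: FE; rewrite /F; case: (rev _) => [|z1 [|z2 L]] //= [_ <-] _.
    by have [y [s0 ->]] := fill_shape a z2 L; exists y, s0.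
  exists (rev s'), y, a, [:: z0; b]; rewrite FE sE !rev_cons -!cats1 -!catA; split=> //.
  - by move: pr1; rewrite FE sE => -[_ []].
  - by move: uF; rewrite FE sE eb /= !inE !negb_or => /andP[/and3P[_ ba _] _]; rewrite eq_sym.
  - by right.
have P1' : partial v n M (D ++ d :: c :: [::]) Q1 by move: P1; rewrite -catA.
have l1' : link Q1 v (op :: D ++ d :: c :: [::] ++ n :: Y ++ s1 :: s2 :: tl).
  by move: l1; rewrite FE -catA.
have c1 : ~ Q1 v c s2 n.
  by move=> q; move: ne; rewrite (quad_opposite qq1 q fe) eqxx.
have [lad2 [Q2 [P2 l2 pr2 fop2 f2]]] := swap_step P1' l1' q2 c1 eD fop.
have hY : head 0 (Y ++ [:: s1]) = w by rewrite -hF FE; case: (Y).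
have A2 : almost v n.+1 M Q2 by have := partial_almost P2; rewrite cats0.
split.
  (* Small [j] stop during the filling after the insertion, larger ones during the filling after the
     swap; the extra successor in the shift accounts for the swap move itself. *)
  move=> j jn; have [jB|jB] := leqP j.*2 (size B).+1.
    by have := lad1 j jB; rewrite size_cat addn1 szn.
  have := lad2 (j - ((size B).+1)./2.+1); rewrite addn0.
  have -> : size M + size D - (j - (size B).+1./2.+1).*2 = size M + (n - 4) - j.*2.
    by move: oB jB jn szn; lia.
  by apply; move: oB jB jn szn eD; lia.
exists (rev tl), Y, s1, s2, Q2; split=> //; last by rewrite size_rev.
apply: (window_grow A2 _ pr2 fop2 hY).
- by move: l2; rewrite -!catA.
- by rewrite size_rev.
- by rewrite size_cat size_rev /=; case: tlE => ->; rewrite addnC /= ?negbK //; lia.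
- by rewrite size_cat size_rev /=; case: tlE => ->; lia.
Qed.

(** Moves join vertices in pairs and the number of those left is odd, so [c] is kept nonadjacent to
    the new vertex. Leaving out exactly [c] keeps [d'] away from the new vertex in the rotation, so
    the outermost pair always serves for the swap. *)
Lemma odd_step v n M op D d d' c Z Q : window v n M op (D ++ [:: d; d']) c Z Q ->
  ~~ odd (size D) -> odd n -> 8 < n ->
  (forall j, j.*2 <= n - 4 -> realizable n.+1 (size M + (n - 4) - j.*2)) /\
  exists s2 Z' Q', window v n.+1 (M ++ [:: (c, n)]) op [:: s2; d'; c] n Z' Q'.
Proof.
move=> W eD en n9; have [w [B [a [b [ZE f g oB]]]]] := window_split W.
have A := window_almost W; have l := window_rot W; rewrite ZE in l.
have szr := size_rotation A l.
have szn : n - 4 = (size B).+1 + (size D).+3.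
  by move: szr; rewrite /= !size_cat /= !size_cat /=; lia.
have [lad1 [Q1 [e [eab P1 l1 [pr1 fop fe]]]]] := insert_step A l f g oB.
set F := fill b a (rev (w :: B)) in l1 pr1.
have eL : ~~ odd (size (rev (w :: B))) by rewrite size_rev /= oB.
have hF : head 0 (rev F) = w.
  have : last 0 F = w by rewrite fill_last // rev_cons last_rcons.
  by case/lastP: (F) => [|F' z]; rewrite ?last_rcons ?rev_rcons.
have qq1 := quads_quad (partial_quads P1).
have [s1 [s FE]] := fill_shape b a (rev (w :: B)); rewrite -/F in FE.
have rFE : rev F = rev s ++ [:: s1; b] by rewrite FE !rev_cons -!cats1 -catA.
have q2 : Q1 v b n s1 by move: pr1; rewrite FE => -[].
have P1' : partial v n M (D ++ d :: d' :: [:: c]) Q1 by move: P1; rewrite -catA.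
have l1' : link Q1 v (op :: D ++ d :: d' :: [:: c] ++ n :: rev s ++ s1 :: b :: [::]).
  by move: l1; rewrite rFE -catA.
have c1 : ~ Q1 v d' b n.
  move=> q; have [u1 _ h1] := l1'.
  have l2 := @link_rot Q1 v (op :: D) (d :: d' :: [:: c] ++ n :: rev s ++ s1 :: b :: [::]) l1'.
  have [u2 _ h2] := l2.
  have := u2; rewrite /= !inE !negb_or -!andbA; repeat case/andP=> ?; move=> _.
  have : cyc ((d :: d' :: [:: c] ++ n :: rev s ++ s1 :: b :: [::]) ++ op :: D) d' n.
    by apply/h2; exists b.
  case/(@cyc_center_only _ _ d' d c n u2 isT) => //=.
  - by rewrite /upair !eqxx ?orbT.
  - by rewrite /upair !eqxx ?orbT.
  - by move/esym/eqP; apply/negP.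
  - by move/esym/eqP; apply/negP.
have [lad2 [Q2 [P2 l2 pr2 fop2 f2]]] := swap_step P1' l1' q2 c1 eD fop.
have hY : head 0 (rev s ++ [:: s1]) = w by rewrite -hF rFE; case: (rev s).
have A2 : almost v n.+1 (M ++ [:: (c, n)]) Q2 := partial_almost P2.
split.
  move=> j jn; have [jB|jB] := leqP j.*2 (size B).+1.
    have := lad1 j jB; rewrite size_cat /= addn2 szn.
    by [].
  have := lad2 (j - ((size B).+1)./2.+1); rewrite /= addn1.
  have -> : size M + (size D).+1 - (j - (size B).+1./2.+1).*2 = size M + (n - 4) - j.*2.
    by move: oB jB jn szn; lia.
  by apply; move: oB jB jn szn eD; lia.
exists b, (rev s ++ fill s1 d (rev D)), Q2.
apply: (window_grow A2 _ pr2 fop2 hY) => //=.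
- by rewrite size_rev.
- by rewrite addn3 /= !negbK.
Qed.

Lemma hub_split v n M Q s A N u : almost v n M Q -> link Q v s -> perm_eq s (A ++ N) ->
  u < n -> (u \in v :: A) = (u \notin N).
Proof.
move=> al l p un; have [us _ _] := l; have vs := link_self (quads_quad (almost_quads al)) l.
have : uniq (A ++ N) by rewrite -(perm_uniq p).
rewrite cat_uniq => /and3P[_ /hasPn dj _]; rewrite inE.
have [->|uv] := eqVneq u v.
  by apply/esym; apply: contra vs => vN; rewrite (perm_mem p) mem_cat vN orbT.
have := almost_hub al l un uv; rewrite (perm_mem p) mem_cat /=.
by have [/dj /negbTE ->|_] := boolP (u \in N); rewrite ?orbF.
Qed.

(** The window coming from [even_step] contains the missing pair in the places that the insertion of
    degree 7 expects: [a] just before [c], and [b] next to last in the rotation. That insertion adds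
    ab, and two fillings then complete the graph. *)
Lemma insert7_step v n op X p a c W u b s2 Q :
  window v n [:: (b, a)] op (X ++ [:: p; a]) c (W ++ [:: u; b; s2]) Q -> Q v p c a ->
  ~~ odd (size X) -> odd n -> 10 < n ->
  (forall j, j.*2 <= n - 3 -> realizable n.+1 (n - 3 - j.*2)) /\
  exists Z' Q', window v n.+1 [::] b [:: c] n Z' Q'.
Proof.
move=> Wi f1 eX on n10; have A := window_almost Wi; have l := window_rot Wi.
have QQ := almost_quads A; have qq := quads_quad QQ; have r := quad_rot qq.
have szr := size_rotation A l.
have [w0 [B [a0 [b0 [ZE f3 g0 oB]]]]] := window_split Wi.
have lB : link Q v (op :: (X ++ [:: p; a]) ++ c :: w0 :: B ++ [:: a0; b0]) by move: l; rewrite ZE.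
(* The insertion of degree 7 starts with only n - 7 missing edges. The counts n - 3 and n - 5 come
   from the ordinary insertion, with ab still missing. *)
have [lad1 _] := insert_step A lB f3 g0 oB.
have szB : n = (size X + size B).+4.+4.
  by have := size_rotation A lB; rewrite /= !size_cat /= !size_cat /=; have := almost_v A; lia.
have eW := window_even Wi.
case: W {Wi} ZE l szr eW => [|w S] ZE l szr; first by [].
rewrite /= size_cat /= addn3 /= !negbK => /andP[eS _].
have w0E : w0 = w by case: ZE.
rewrite w0E in f3.
have l' : link Q v (p :: a :: c :: w :: S ++ u :: b :: (s2 :: op :: X)).
  have := @link_rot Q v (op :: X) (p :: a :: c :: (w :: S) ++ [:: u; b; s2]).
  rewrite /= -!catA /=; apply; move: l; rewrite /= -!catA.
  by [].
have szS : n = (size X + size S).+4.+4.+1.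
  by move: szr; rewrite /= !size_cat /= !size_cat /=; have := almost_v A; lia.
have [us _ h] := l'.
set T := s2 :: op :: X in l' us h.
have oT : op \in T by rewrite !inE eqxx orbT.
have szT : size T = (size X).+2 by [].
clearbody T.
have lrot y : y \in p :: a :: c :: w :: S ++ u :: b :: T -> y < n := link_lt QQ l'.
have [e f2] : exists e, Q v a e c by apply/h; rewrite /= /upair !eqxx !orbT.
have [g f4] : exists g, Q v b g u.
  by apply/h; rewrite cyc_sym cyc_three_paths /upair !eqxx !orbT.
have ab : nadj Q a b.
  have an : a < n by apply: lrot; rewrite !inE eqxx ?orbT.
  have bn : b < n by apply: lrot; rewrite !(inE, mem_cat) eqxx ?orbT.
  move=> y z q; have /(almost_adj A an bn)[_] : adj Q a b by exists y, z.
  by rewrite /sym_mem !inE eqxx orbT.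
set Q1 := inserted7 n Q v p a c w u b e op g.
have Q1q : quads n.+1 Q1 := inserted7_quads QQ l' f1 f2 f3 f4 ab oT.
have l1 : link Q1 v (a :: n :: c :: b :: T ++ p :: w :: S ++ [:: u]) :=
  inserted7_rot QQ l' f1 f2 f3 f4 ab oT.
have adj1 := inserted7_adj QQ l' f1 f2 f3 f4 ab oT.
have [fp fa _ fw] : [/\ Q1 v n p c, Q1 v a b n, Q1 v a n u & Q1 v w n p] :=
  inserted7_faces n Q v p a c w u b e op g.
have vn := almost_v A.
have Mx : all (fun p => [&& p.1 < p.2, p.2 < n, p.1 != v & p.2 != v]) ([::] : seq (nat * nat)) by [].
have pN : perm_eq (p :: a :: c :: w :: S ++ u :: b :: T) ([:: p; b; u; a; c; w] ++ (S ++ T)).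
  by clear; apply/permP => P; rewrite /= !count_cat /=; lia.
have nbrE y : (y \in [:: p; v; b; u; a; c; w]) = (y \in v :: [:: p; b; u; a; c; w]).
  by rewrite !inE; case: (y == p); case: (y == v).
have P1 : partial v n [::] (S ++ T) Q1.
  split=> //.
  - move=> z y zn yn; apply: iff_trans (adj1 z y) _.
    have B1 := almost_adj A zn yn; have symE : sym_mem [:: (b, a)] z y = upair a b z y.
      by rewrite /sym_mem !inE !xpair_eqE /upair orbC [(y == b) && _]andbC.
    rewrite symE in B1; split=> [[/B1[-> _] //|ab'|[zx _]|[yx _]]|[zy _]].
    - split=> //; have anb : a != b.
        move: us; rewrite /= !(inE, mem_cat) !negb_or -!andbA.
        by repeat case/andP=> ?; move=> _.
      by case/upairP: ab' => -[-> ->]; rewrite // eq_sym.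
    - by rewrite zx ltnn in zn.
    - by rewrite yx ltnn in yn.
    have [ab'|ab'] := boolP (upair a b z y); first by constructor 2.
    by constructor 1; apply/B1.
  - move=> y; apply: iff_trans (adj1 n y) _; split.
      case=> [/(adj_lt QQ)[]|/upairP[][na _]|[_]|[_]]; rewrite ?ltnn //.
      + have : n < n by rewrite {1}na; apply: lrot; rewrite !inE eqxx ?orbT.
        by rewrite ltnn.
      + have : n < n by rewrite {1}na; apply: lrot; rewrite !(inE, mem_cat) eqxx ?orbT.
        by rewrite ltnn.
      + rewrite nbrE => yN; have yn : y < n.
          move: yN; rewrite in_cons => /orP[/eqP -> //|yN].
          by apply: lrot; rewrite (perm_mem pN) mem_cat yN.
        by split=> //; rewrite -(hub_split A l' pN yn).
      rewrite nbrE in_cons => /orP[/eqP nv|yN]; first by move: vn; rewrite -nv ltnn.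
      have : n < n by apply: lrot; rewrite (perm_mem pN) mem_cat yN.
      by rewrite ltnn.
    case=> yn yN; constructor 3; split=> //; rewrite nbrE.
    by rewrite (hub_split A l' pN yn).
  - have := us; rewrite (perm_uniq pN) cat_uniq => /and3P[_ _ ->]; split=> //.
    by apply/allP => y yN; apply: lrot; rewrite (perm_mem pN) mem_cat yN orbT.
  - split=> //; apply: contra (link_self qq l') => vN.
    by rewrite (perm_mem pN) mem_cat vN orbT.
  - by apply: band_keep (almost_band A) => *; exact: inserted7_keep.
have nlt y : y \in p :: a :: c :: w :: S ++ u :: b :: T -> n != y.
  by move/lrot => yn; rewrite gtn_eqF.
have nnotin s : {subset s <= p :: a :: c :: w :: S ++ u :: b :: T} -> n \notin s.
  by move=> ss; apply/negP => /ss /lrot; rewrite ltnn.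
have l1' : link Q1 v (p :: w :: S ++ u :: (a :: n :: c :: b :: T)).
  have := @link_rot Q1 v (a :: n :: c :: b :: T) (p :: w :: S ++ [:: u]) l1.
  by rewrite /= -!catA.
have qq1 := quads_quad Q1q.
have hr1 : u = n -> exists2 y, Q1 v (last w S) y n & y \notin p :: w :: S.
  by move=> un; have := nlt u; rewrite un !(inE, mem_cat) eqxx ?orbT => /(_ isT).
have [lad2 [Q2 [P2 l2 pr2 k2]]] := fill_lemma eS P1 l1' (quad_rev qq1 fw) hr1.
have [y [rest FE]] := fill_shape p w S; rewrite FE in l2 pr2.
have qq2 := quads_quad (partial_quads P2).
(* The arc [S] has been filled from the corner p, w. Its first finished pair p, y, read backwards,
   is the corner from which [T] is filled in reverse. *)
have l2' : link Q2 v (y :: p :: rev T ++ b :: (c :: n :: a :: u :: rev rest)).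
  have := link_rev l2; rewrite rev_cat !rev_cons -!cats1 -!catA => l3.
  have := @link_rot Q2 v (rev T ++ [:: b] ++ [:: c] ++ [:: n] ++ [:: a] ++ [:: u] ++ rev rest)
    ([:: y] ++ [:: p]).
  by rewrite -!catA => /(_ l3).
have hr2 : b = n -> exists2 z, Q2 v (last p (rev T)) z n & z \notin y :: p :: rev T.
  by move=> bn; have := nlt b; rewrite bn !(inE, mem_cat) eqxx ?orbT => /(_ isT).
have eT : ~~ odd (size (rev T)) by rewrite size_rev szT /= negbK.
have pT : perm_eq T (rev T ++ [::]) by rewrite cats0 perm_sym perm_rev.
have fy : Q2 v y n p by case: pr2 => q _; exact: (quad_rev qq2 q).
have [lad3 [Q3 [P3 l3 pr3 k3]]] := fill_lemma eT (partial_perm P2 pT) l2' fy hr2.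
have A3 : almost v n.+1 [::] Q3 := partial_almost P3.
split.
  (* The three ranges of [j] belong to the ordinary insertion, to the filling of [S] and to the
     filling of [T]. *)
  move=> j jn; have [jB|jB] := leqP j 1.
    have := lad1 j; rewrite size_cat /= addn2.
    have -> : 1 + ((size B).+1 + (size X).+3) - j.*2 = n - 3 - j.*2 by lia.
    by apply; move: oB; case: (j) jB => [|[|]] //; case: (size B).
  have [jS|jS] := leqP (j - 2).*2 (size S).
    have := lad2 (j - 2) jS; rewrite szT /= add0n.
    by have -> : size S + (size X).+2 - (j - 2).*2 = n - 3 - j.*2 by lia.
  have := lad3 (j - 2 - (size S)./2); rewrite size_rev szT /= add0n addn0.
  have -> : (size X).+2 - (j - 2 - (size S)./2).*2 = n - 3 - j.*2 by lia.
  by apply; lia.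
exists (a :: u :: rev rest ++ fill y p (rev T)), Q3.
have := @window_grow v n [::] b [:: c] n (a :: u :: rev rest) y p (rev T) a Q3 A3.
apply=> //=.
- have := @link_rot Q3 v (fill y p (rev T)) (b :: c :: n :: a :: u :: rev rest) l3.
  by [].
- apply: k3; last first.
    have np : n != p by apply: nlt; rewrite inE eqxx.
    have nT : n \notin T.
      by apply: nnotin => z zT; rewrite !(inE, mem_cat) zT ?orbT.
    have ny : n != y.
      have := quad_uniq qq2 fy; rewrite /= !inE !negb_or -!andbA; repeat case/andP=> ?; move=> _.
      by rewrite eq_sym.
    by rewrite !inE mem_rev !negb_or ny np nT.
  apply: k2; last first.
    apply/orP; left; apply: nnotin => z; rewrite !(inE, mem_cat).
    by do 2?[case/orP]; move=> ->; rewrite ?orbT.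
  exact: (quad_rev qq1 fa).
- by move: on eT; lia.
- by move: n10; lia.
Qed.

(* The windows of K_n (n = 0, 1 mod 4) or K_n minus an edge (n = 2, 3 mod 4). *)
Definition extendable n : Prop :=
  if n %% 4 == 0 then exists v op d c Z Q, window v n [::] op [:: d] c Z Q
  else if n %% 4 == 1 then exists v op D d d' c Z Q,
    ~~ odd (size D) /\ window v n [::] op (D ++ [:: d; d']) c Z Q
  else if n %% 4 == 2 then exists v op e1 e2 d c Z Q,
    window v n [:: (d, c)] op [:: e1; e2; d] c Z Q
  else exists v op X p a c W u b s2 Q, [/\ ~~ odd (size X), Q v p c a &
    window v n [:: (b, a)] op (X ++ [:: p; a]) c (W ++ [:: u; b; s2]) Q].

Lemma ladder N top m t : (forall j, j.*2 <= m -> realizable N (top - j.*2)) ->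
  t <= top -> odd t = odd top -> top - t <= m -> realizable N t.
Proof.
move=> h tt ot tm; have := h ((top - t)./2).
have -> : ((top - t)./2).*2 = top - t by rewrite -[RHS]odd_double_half oddB // ot addbb.
by rewrite subKn //; apply.
Qed.

Lemma extend n : 8 < n -> extendable n -> extendable n.+1 /\
  forall t, t <= n.+1 - 4 -> t = (n.+1 * (n.+1 - 5)) %/ 2 %[mod 2] -> realizable n.+1 t.
Proof.
move=> n9; rewrite /extendable; have n4 := divn_eq n 4; have := ltn_pmod n (isT : 0 < 4).
set k := n %/ 4 in n4.
(* In each residue class one factor of n(n-5) is even; halving it leaves the product AB, whose
   parity is that of t. *)
have par t A B : n.+1 * (n.+1 - 5) = (A * B) * 2 ->
    t = (n.+1 * (n.+1 - 5)) %/ 2 %[mod 2] -> odd t = odd A && odd B.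
  by move=> ->; rewrite mulnK // !modn2 -oddM; case: (odd t); case: (odd _).
case n4m : (n %% 4) n4 => [|[|[|[|//]]]] n4 _ /=.
- have -> : n.+1 %% 4 = 1 by rewrite n4; lia.
  case=> v [op [d [c [Z [Q W]]]]].
  have [//|||lad [T [Y [s1 [s2 [Q' [W' _ szT]]]]]]] := even_step (D := [::]) W; try lia.
  split.
    exists v, op, T, s2, c, n, (Y ++ fill s1 d (rev [::])), Q'.
    by split; [case: szT => -> | exact: W'].
  move=> t tn /(par t (4 * k + 1) (2 * k - 2)) ot.
  have {}ot : odd t = odd (4 * k + 1) && odd (2 * k - 2) by apply: ot; rewrite n4; nia.
  by apply: (ladder (m := n - 4) lad); rewrite /= ?add0n; lia.
- have -> : n.+1 %% 4 = 2 by rewrite n4; lia.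
  case=> v [op [D [d [d' [c [Z [Q [eD W]]]]]]]].
  have [||lad [s2 [Z' [Q' W']]]] := odd_step W eD; try lia.
  split; first by exists v, op, s2, d', c, n, Z', Q'; exact: W'.
  move=> t tn /(par t (2 * k + 1) (4 * k - 3)) ot.
  have {}ot : odd t = odd (2 * k + 1) && odd (4 * k - 3) by apply: ot; rewrite n4; nia.
  by apply: (ladder (m := n - 4) lad); rewrite /= ?add0n; lia.
- have -> : n.+1 %% 4 = 3 by rewrite n4; lia.
  case=> v [op [e1 [e2 [d [c [Z [Q W]]]]]]].
  have [//|||lad [T [Y [s1 [s2 [Q' [W' f szT]]]]]]] := even_step (D := [:: e1; e2]) W; try lia.
  split.
    exists v, op, T, s2, c, n, (Y ++ [:: s1]), e2, d, e1, Q'.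
    split; [by case: szT => -> | exact: f |].
    have -> : (Y ++ [:: s1]) ++ [:: e2; d; e1] = Y ++ fill s1 d (rev [:: e1; e2]).
      by rewrite -catA.
    exact: W'.
  move=> t tn /(par t (4 * k + 3) (2 * k - 1)) ot.
  have {}ot : odd t = odd (4 * k + 3) && odd (2 * k - 1) by apply: ot; rewrite n4; nia.
  by apply: (ladder (m := n - 4) lad); rewrite /=; lia.
have -> : n.+1 %% 4 = 0 by rewrite n4; lia.
case=> v [op [X [p [a [c [W [u [b [s2 [Q [eX f Wi]]]]]]]]]]].
have [||lad [Z' [Q' W']]] := insert7_step Wi f eX; try lia.
split; first by exists v, b, c, n, Z', Q'.
move=> t tn /(par t (2 * k + 2) (4 * k - 1)) ot.
have {}ot : odd t = odd (2 * k + 2) && odd (4 * k - 1) by apply: ot; rewrite n4; nia.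
by apply: (ladder (m := n - 3) lad); lia.
Qed.

Lemma realizable_from n t : extendable 9 -> 9 < n ->
  t <= n - 4 -> t = (n * (n - 5)) %/ 2 %[mod 2] -> realizable n t.
Proof.
move=> e9; case: n => // n n9; have : extendable n; last by move=> /(extend n9)[_]; exact.
elim: n n9 => // n IH n9; have [n8|n8] := ltnP n 9.
  by have -> : n.+1 = 9 by lia.
by case: (extend n8 (IH n8)).
Qed.

(** * Small cases *)

Definition face_list (F : seq (nat * nat * nat * nat)) : quad_rel :=
  fun a b c d => (a, b, c, d) \in dihs F.

(** The links are supplied in [rots] as certificates, so that no cycle has to be searched for and
    every condition is a bounded check on the eight images of each face. *)
Definition face_list_check n F (M : seq (nat * nat)) (rots : seq (seq nat)) :=
  let D := dihs F in let C := corners F in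
  [&& all (fun f => let: (a, b, c, d) := f in
        [&& a < n, a != b, a != c, (a, b, d, c) \notin D &
          all (fun g => let: (a', b', c', d') := g in
            [&& a == a', b == b' & c == c'] ==> (d == d')) D]) D,
      all (fun z => let s := nth [::] rots z in
        [&& uniq s, 3 < size s, all (fun c => (c.1.1 == z) ==> cyc s c.1.2 c.2) C &
          all (fun u => all (fun w => cyc s u w ==> ((z, u, w) \in C)) s) s]) (iota 0 n) &
      all (fun z => all (fun u => has (fun f => (f.1.1.1 == z) && (f.1.1.2 == u)) D ==
        (z != u) && ~~ sym_mem M z u) (iota 0 n)) (iota 0 n)].

Section FaceList.
Variables (n : nat) (F : seq (nat * nat * nat * nat)) (M : seq (nat * nat)).
Variable rots : seq (seq nat).
Hypothesis ok : face_list_check n F M rots.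
Local Notation Q := (face_list F).

Lemma face_list_quadrangles : quadrangles Q.
Proof.
case/and3P: ok => /allP h _ _; split.
- by move=> a b c d; exact: dih_rot.
- by move=> a b c d; exact: dih_rev.
- by move=> a b c d /h /and5P[].
- move=> a b c d d' /h /and5P[_ _ _ _ /allP h'] /h'.
  by rewrite !eqxx => /eqP.
- by move=> a b c d /h /and5P[_ _ _ + _] q; rewrite [_ \in _]q.
Qed.

Lemma face_list_link z : z < n -> link Q z (nth [::] rots z).
Proof.
case/and3P: ok => _ /allP h _ zn.
have /h /and4P[us s4 /allP h1 /allP h2] : z \in iota 0 n by rewrite mem_iota.
split=> // u w; split=> [[c q]|cu].
  have zc : (z, u, w) \in corners F by apply/mapP; exists (z, u, c, w).
  by have := h1 _ zc; rewrite /= eqxx.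
have /andP[us' ws] := cyc_mem cu.
have := h2 _ us' => /allP /(_ _ ws); rewrite cu => /mapP[[[[a b] c] d] f [-> -> ->]].
by exists c.
Qed.

Lemma face_list_quads : quads n Q.
Proof.
split; first exact: face_list_quadrangles.
  by case/and3P: ok => /allP h _ _ a b c d /h /and5P[].
by move=> z zn; exists (nth [::] rots z); exact: face_list_link.
Qed.

Lemma face_list_misses : misses n Q M.
Proof.
case/and3P: ok => _ _ /allP h z u.
have adjE : adj Q z u <-> has (fun f => (f.1.1.1 == z) && (f.1.1.2 == u)) (dihs F).
  split=> [[c [d q]]|/hasP[[[[a b] c] d] q /andP[/eqP <- /eqP <-]]].
    by apply/hasP; exists (z, u, c, d) => //=; rewrite !eqxx.
  by exists c, d.
have hz : z < n -> u < n -> has (fun f => (f.1.1.1 == z) && (f.1.1.2 == u)) (dihs F) =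
    (z != u) && ~~ sym_mem M z u.
  move=> zn un; have zi : z \in iota 0 n by rewrite mem_iota.
  have ui : u \in iota 0 n by rewrite mem_iota.
  exact/eqP/(allP (h _ zi)).
split=> [zu|[zn un zu zM]]; last by apply/adjE; rewrite hz // zu.
have [zn un] := adj_lt face_list_quads zu.
by move/adjE: zu; rewrite hz // => /andP[].
Qed.

Lemma face_list_realizable v (e : nat * nat * nat * nat * nat * nat) :
  let: (a0, b0, a1, b1, a2, e) := e in
  [&& v < n, uniq M, all (fun p => [&& p.1 < p.2, p.2 < n, p.1 != v & p.2 != v]) M,
      (a0, b0, b1, a1) \in dihs F, (a1, b1, a0, a2) \in dihs F, (a2, a0, b0, e) \in dihs F,
      e != a1 & e != b1] ->
  realizable n (size M).
Proof.
case: e => -[[[[a0 b0] a1] b1] a2] e.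
case/and5P=> vn uM Mx q0 /and4P[q1 q2 e1 e2]; exists Q, M, v; split=> //.
- exact: face_list_quads.
- exact: face_list_misses.
- split=> //; apply: sub_all Mx => p /and4P[-> -> _ _] //.
split; last by exists a0, b0, a1, b1, a2, e; rewrite e1 e2.
split=> // u un uv; apply/face_list_misses; split=> //; first by rewrite eq_sym.
by rewrite (M_notin Mx) ?eqxx.
Qed.

End FaceList.

Lemma realizable_6_1 : realizable 6 1.
Proof.
apply: (@face_list_realizable 6
    [:: (0, 1, 2, 3); (0, 1, 3, 4); (0, 2, 1, 5); (0, 2, 5, 3); (0, 4, 2, 5);
    (1, 3, 2, 4); (1, 4, 3, 5)]
    [:: (4, 5)]
    [:: [:: 1; 4; 5; 2; 3]; [:: 0; 3; 4; 5; 2]; [:: 0; 1; 3; 4; 5]; [:: 0; 5;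
    4; 1; 2]; [:: 0; 3; 1; 2]; [:: 0; 1; 3; 2]]
  _ 0 (4, 0, 3, 1, 2, 5)); by vm_compute.
Qed.

Lemma realizable_7_1 : realizable 7 1.
Proof.
apply: (@face_list_realizable 7
    [:: (0, 1, 2, 3); (0, 1, 4, 2); (0, 2, 1, 5); (0, 3, 1, 6); (0, 4, 2, 5);
    (0, 4, 3, 6); (1, 3, 5, 4); (1, 5, 4, 6); (2, 3, 4, 6); (2, 5, 3, 6)]
    [:: (5, 6)]
    [:: [:: 1; 3; 6; 4; 5; 2]; [:: 0; 2; 5; 6; 3; 4]; [:: 0; 1; 3; 6; 5; 4];
    [:: 0; 1; 5; 6; 4; 2]; [:: 0; 3; 6; 5; 1; 2]; [:: 0; 1; 4; 3; 2]; [:: 0;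
    1; 4; 2; 3]]
  _ 0 (1, 3, 4, 5, 6, 0)); by vm_compute.
Qed.

Lemma realizable_7_3 : realizable 7 3.
Proof.
apply: (@face_list_realizable 7
    [:: (0, 1, 2, 3); (0, 1, 6, 4); (0, 2, 1, 5); (0, 2, 5, 6); (0, 3, 4, 6);
    (0, 4, 2, 5); (1, 3, 2, 4); (1, 3, 5, 6); (1, 4, 3, 5)]
    [:: (2, 6); (3, 6); (4, 5)]
    [:: [:: 1; 4; 5; 2; 6; 3]; [:: 0; 6; 3; 4; 5; 2]; [:: 0; 1; 3; 4; 5]; [::
    0; 4; 5; 1; 2]; [:: 0; 6; 3; 1; 2]; [:: 0; 1; 3; 6; 2]; [:: 0; 4; 1; 5]]
  _ 0 (0, 1, 4, 6, 3, 2)); by vm_compute.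
Qed.

Lemma realizable_8_0 : realizable 8 0.
Proof.
apply: (@face_list_realizable 8
    [:: (0, 1, 4, 5); (0, 1, 7, 2); (0, 2, 3, 7); (0, 3, 6, 4); (0, 3, 7, 6);
    (0, 4, 5, 7); (0, 5, 1, 6); (1, 2, 4, 7); (1, 2, 5, 3); (1, 3, 2, 6); (1,
    4, 3, 5); (2, 4, 3, 6); (2, 5, 6, 7); (4, 6, 5, 7)]
    [::]
    [:: [:: 1; 2; 7; 4; 3; 6; 5]; [:: 0; 7; 2; 3; 6; 5; 4]; [:: 0; 7; 5; 1;
    4; 6; 3]; [:: 0; 7; 2; 1; 5; 4; 6]; [:: 0; 5; 1; 3; 2; 7; 6]; [:: 0; 4;
    7; 6; 2; 3; 1]; [:: 0; 7; 5; 4; 3; 2; 1]; [:: 0; 5; 4; 1; 2; 6; 3]]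
  _ 0 (4, 0, 5, 7, 6, 3)); by vm_compute.
Qed.

Lemma realizable_8_2 : realizable 8 2.
Proof.
apply: (@face_list_realizable 8
    [:: (0, 1, 2, 3); (0, 1, 3, 7); (0, 2, 4, 7); (0, 2, 7, 6); (0, 3, 7, 5);
    (0, 4, 2, 5); (0, 4, 3, 6); (1, 2, 7, 5); (1, 3, 5, 4); (1, 4, 7, 6); (1,
    5, 4, 6); (2, 3, 4, 6); (2, 5, 3, 6)]
    [:: (1, 7); (5, 6)]
    [:: [:: 1; 7; 2; 6; 4; 5; 3]; [:: 0; 3; 4; 6; 5; 2]; [:: 0; 4; 5; 6; 3;
    1; 7]; [:: 0; 7; 1; 5; 6; 4; 2]; [:: 0; 3; 6; 5; 1; 7; 2]; [:: 0; 7; 1;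
    4; 3; 2]; [:: 0; 3; 2; 4; 1; 7]; [:: 0; 3; 5; 2; 6; 4]]
  _ 0 (7, 4, 0, 2, 6, 1)); by vm_compute.
Qed.

Lemma realizable_8_4 : realizable 8 4.
Proof.
apply: (@face_list_realizable 8
    [:: (0, 1, 2, 7); (0, 1, 4, 2); (0, 2, 1, 5); (0, 3, 1, 6); (0, 3, 4, 7);
    (0, 4, 2, 5); (0, 4, 7, 6); (1, 3, 5, 4); (1, 5, 4, 6); (2, 3, 4, 6); (2,
    3, 6, 7); (2, 5, 3, 6)]
    [:: (1, 7); (3, 7); (5, 6); (5, 7)]
    [:: [:: 1; 7; 3; 6; 4; 5; 2]; [:: 0; 2; 5; 6; 3; 4]; [:: 0; 1; 7; 3; 6;
    5; 4]; [:: 0; 4; 2; 6; 5; 1]; [:: 0; 7; 3; 6; 5; 1; 2]; [:: 0; 1; 4; 3;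
    2]; [:: 0; 7; 3; 2; 4; 1]; [:: 0; 4; 6; 2]]
  _ 0 (0, 3, 7, 4, 6, 1)); by vm_compute.
Qed.

Lemma realizable_9_2 : realizable 9 2.
Proof.
apply: (@face_list_realizable 9
    [:: (0, 1, 4, 5); (0, 1, 8, 2); (0, 2, 3, 7); (0, 3, 6, 4); (0, 3, 7, 6);
    (0, 4, 7, 8); (0, 5, 1, 6); (0, 7, 1, 8); (1, 2, 4, 7); (1, 2, 5, 3); (1,
    3, 2, 6); (1, 4, 3, 5); (2, 4, 3, 6); (2, 5, 6, 7); (2, 7, 5, 8); (4, 5,
    8, 6); (5, 6, 8, 7)]
    [:: (3, 8); (4, 8)]
    [:: [:: 1; 5; 6; 3; 4; 8; 7; 2]; [:: 0; 4; 5; 6; 3; 2; 7; 8]; [:: 0; 8;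
    7; 5; 1; 4; 6; 3]; [:: 0; 7; 2; 1; 5; 4; 6]; [:: 0; 7; 2; 3; 1; 5; 6];
    [:: 0; 4; 8; 7; 6; 2; 3; 1]; [:: 0; 7; 5; 8; 4; 3; 2; 1]; [:: 0; 3; 6; 2;
    5; 8; 4; 1]; [:: 0; 7; 6; 5; 2; 1]]
  _ 0 (0, 2, 1, 8, 7, 3)); by vm_compute.
Qed.

Lemma realizable_9_4 : realizable 9 4.
Proof.
apply: (@face_list_realizable 9
    [:: (0, 1, 4, 5); (0, 1, 8, 2); (0, 2, 3, 7); (0, 3, 6, 4); (0, 3, 7, 6);
    (0, 4, 5, 8); (0, 5, 1, 6); (0, 7, 1, 8); (1, 2, 4, 7); (1, 2, 5, 3); (1,
    3, 2, 6); (1, 4, 3, 5); (2, 4, 3, 6); (2, 5, 6, 7); (2, 7, 5, 8); (4, 6,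
    5, 7)]
    [:: (3, 8); (4, 8); (6, 8); (7, 8)]
    [:: [:: 1; 5; 6; 3; 4; 8; 7; 2]; [:: 0; 4; 5; 6; 3; 2; 7; 8]; [:: 0; 3;
    6; 4; 1; 5; 7; 8]; [:: 0; 7; 2; 1; 5; 4; 6]; [:: 0; 5; 1; 3; 2; 7; 6];
    [:: 0; 4; 8; 7; 6; 2; 3; 1]; [:: 0; 7; 5; 4; 3; 2; 1]; [:: 0; 3; 6; 2; 5;
    4; 1]; [:: 0; 5; 2; 1]]
  _ 0 (0, 2, 1, 8, 7, 3)); by vm_compute.
Qed.

Definition faces_K9 :=
  [:: (0, 1, 4, 5); (0, 1, 7, 2); (0, 2, 4, 8); (0, 3, 6, 4); (0, 3, 7, 6);
  (0, 4, 5, 7); (0, 5, 1, 6); (0, 7, 3, 8); (1, 2, 4, 7); (1, 2, 5, 3); (1,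
  3, 2, 8); (1, 4, 3, 5); (1, 6, 5, 8); (2, 3, 8, 7); (2, 5, 8, 6); (2, 6, 7,
  8); (3, 4, 8, 6); (4, 6, 5, 7)].

Definition rots_K9 :=
  [:: [:: 1; 5; 6; 3; 4; 7; 8; 2]; [:: 0; 4; 5; 6; 8; 3; 2; 7]; [:: 1; 5; 6;
  8; 3; 7; 0; 4]; [:: 0; 7; 8; 2; 1; 5; 4; 6]; [:: 0; 6; 7; 2; 8; 3; 1; 5];
  [:: 0; 4; 7; 6; 8; 2; 3; 1]; [:: 0; 7; 2; 8; 3; 4; 5; 1]; [:: 0; 5; 4; 1;
  2; 8; 6; 3]; [:: 0; 4; 6; 5; 1; 2; 7; 3]].

Lemma check_K9 : face_list_check 9 faces_K9 [::] rots_K9.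
Proof. by vm_compute. Qed.

Lemma realizable_9_0 : realizable 9 0.
Proof.
by apply: (@face_list_realizable 9 faces_K9 [::] rots_K9 check_K9 2 (4, 0, 5, 7, 6, 3)).
Qed.

Lemma extendable_9 : extendable 9.
Proof.
(* The rotation of vertex 2 in [rots_K9] is listed from 1 on, so that it reads [op], [d], [d'], [c],
   [Z] with [D] empty. The faces 2 8 1 3 and 2 0 8 4 are the two required by a window. *)
exists 2, 1, [::], 5, 6, 8, [:: 3; 7; 0; 4], (face_list faces_K9).
split=> //; split=> //.
- split=> //.
  + exact: face_list_quads check_K9.
  + move=> z u zn un; have h := face_list_misses check_K9 z u.
    by apply: iff_trans h _; split=> [[]|[]].
  + exists 4, 0, 5, 7, 6, 3; split; by vm_compute.
- exact: (face_list_link check_K9 (z := 2)).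
- by exists [:: 3; 7], 0, 4.
Qed.

Lemma realizable_all n t : 5 < n -> t <= n - 4 ->
  t = (n * (n - 5)) %/ 2 %[mod 2] -> realizable n t.
Proof.
move=> n6 tn tp; have [n9|n9] := ltnP 9 n; first exact: realizable_from extendable_9 n9 tn tp.
case: n n6 n9 tn tp => [|[|[|[|[|[|[|[|[|[|n]]]]]]]]]] // _ _;
  case: t => [|[|[|[|[|[|t]]]]]] // _ _;
  [exact: realizable_6_1 | exact: realizable_7_1 | exact: realizable_7_3
  | exact: realizable_8_0 | exact: realizable_8_2 | exact: realizable_8_4
  | exact: realizable_9_0 | exact: realizable_9_2 | exact: realizable_9_4].
Qed.

(** * The surface of a family of quadrangles *)

Section Topology.
Import Order.TTheory GRing.Theory Num.Theory numFieldNormedType.Exports.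
Local Open Scope classical_set_scope.
Local Open Scope ring_scope.

Section QuadPoint.
Variables (R : realType) (n : nat).
Implicit Types (a b c d : 'I_n) (p : R * R).

Definition vertex_weight a : 'rV[R]_n := delta_mx 0 a.

Definition quad_point a b c d p : 'rV[R]_n :=
  ((1 - p.1) * (1 - p.2)) *: vertex_weight a
  + (p.1 * (1 - p.2)) *: vertex_weight b
  + (p.1 * p.2) *: vertex_weight c
  + ((1 - p.1) * p.2) *: vertex_weight d.

Lemma quad_point_coord a b c d p j : quad_point a b c d p 0 j =
  (1 - p.1) * (1 - p.2) * (j == a)%:R + p.1 * (1 - p.2) * (j == b)%:R
  + p.1 * p.2 * (j == c)%:R + (1 - p.1) * p.2 * (j == d)%:R.
Proof. by rewrite /quad_point !mxE !eqxx. Qed.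

Lemma quad_point_rot a b c d p :
  quad_point b c d a (p.2, 1 - p.1) = quad_point a b c d p.
Proof. by apply/rowP => j; rewrite !quad_point_coord /=; ring. Qed.

Lemma quad_point_rev a b c d p : quad_point a d c b (p.2, p.1) = quad_point a b c d p.
Proof. by apply/rowP => j; rewrite !quad_point_coord /=; ring. Qed.

Definition sq p := [/\ 0 <= p.1, p.1 <= 1, 0 <= p.2 & p.2 <= 1].

Lemma sq_rot p : sq p -> sq (p.2, 1 - p.1).
Proof. by case=> *; split => //=; lra. Qed.

Lemma sq_rev p : sq p -> sq (p.2, p.1).
Proof. by case. Qed.

Lemma quad_point_out a b c d p j : j \notin [:: a; b; c; d] ->
  quad_point a b c d p 0 j = 0.
Proof.
rewrite !inE !negb_or quad_point_coord => /and4P[]; do 4 move/negbTE->.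
by rewrite !mulr0 !addr0.
Qed.

Section Distinct.
Variables (a b c d : 'I_n).
Hypothesis abcd : uniq [:: a; b; c; d].

Let neq : [/\ a != b, a != c & a != d] /\ [/\ b != c, b != d & c != d].
Proof.
by move: abcd; rewrite /= !inE !negb_or => /and4P[/and3P[-> -> ->] /andP[-> ->] ->].
Qed.

Lemma quad_point_a p : quad_point a b c d p 0 a = (1 - p.1) * (1 - p.2).
Proof.
case: neq => -[/negbTE ab /negbTE ac /negbTE ad] _.
by rewrite quad_point_coord eqxx ab ac ad !mulr0 !addr0 mulr1.
Qed.

Lemma quad_point_b p : quad_point a b c d p 0 b = p.1 * (1 - p.2).
Proof.
case: neq => -[/negbTE ab _ _] [/negbTE bc /negbTE bd _].
by rewrite quad_point_coord eqxx eq_sym ab bc bd !mulr0 !addr0 add0r mulr1.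
Qed.

Lemma quad_point_c p : quad_point a b c d p 0 c = p.1 * p.2.
Proof.
case: neq => -[_ /negbTE ac _] [/negbTE bc _ /negbTE cd].
rewrite quad_point_coord eqxx (eq_sym c a) (eq_sym c b) ac bc cd.
by rewrite !mulr0 !addr0 !add0r mulr1.
Qed.

Lemma quad_point_d p : quad_point a b c d p 0 d = (1 - p.1) * p.2.
Proof.
case: neq => -[_ _ /negbTE ad] [_ /negbTE bd /negbTE cd].
rewrite quad_point_coord eqxx (eq_sym d a) (eq_sym d b) (eq_sym d c) ad bd cd.
by rewrite !mulr0 !add0r mulr1.
Qed.

End Distinct.

Lemma quad_point_ge0 a b c d p j : sq p -> 0 <= quad_point a b c d p 0 j.
Proof.
case=> *; rewrite quad_point_coord.
by rewrite !addr_ge0 // !mulr_ge0 ?subr_ge0 ?ler0n.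
Qed.

End QuadPoint.

Section Surface.
Variables (R : realType) (n : nat).
Variables (Q : 'I_n -> 'I_n -> 'I_n -> 'I_n -> Prop).
Hypothesis QQ : quadrangles Q.
Implicit Types (a b c d v : 'I_n) (p : R * R) (w : 'rV[R]_n).

Definition surface_set : set 'rV[R]_n :=
  [set w | exists a b c d p, [/\ Q a b c d, sq p & w = quad_point a b c d p]].

Lemma surface_rebase v w : surface_set w -> w 0 v != 0 ->
  exists b c d p, [/\ Q v b c d, sq p & w = quad_point v b c d p].
Proof.
move=> [a [b [c [d [p [q sp ->]]]]]] wv.
have : v \in [:: a; b; c; d] by apply: contraNT wv => /quad_point_out ->.
rewrite !inE => /or4P[] /eqP ->.
- by exists b, c, d, p.
- exists c, d, a, (p.2, 1 - p.1); split; first exact: (quad_rot QQ).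
    exact: sq_rot.
  by rewrite quad_point_rot.
- exists d, a, b, (1 - p.1, 1 - p.2); split.
  + exact: (quad_rot QQ (quad_rot QQ q)).
  + exact: (sq_rot (sq_rot sp)).
  + by rewrite -(quad_point_rot c d a b (_, _)) /= -(quad_point_rot d a b c (_, _))
       /= -(quad_point_rot a b c d (_, _)) /=;
       apply/rowP => j; rewrite !quad_point_coord /=; ring.
- exists a, b, c, (1 - p.2, p.1); split.
  + exact: (quad_rot QQ (quad_rot QQ (quad_rot QQ q))).
  + by case: sp => *; split => //=; lra.
  + by apply/rowP => j; rewrite !quad_point_coord /=; ring.
Qed.

(* Two quadrangles with the same vertices coincide, so that the support of a  *)
(* point determines its quadrangle.                                           *)
Lemma surface_face a b c d w : Q a b c d -> surface_set w ->
  {in [:: a; b; c; d], forall u, w 0 u != 0} ->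
  exists2 p, sq p & w = quad_point a b c d p.
Proof.
move=> q Aw supp.
have [|b' [c' [d' [p [q' sp ew]]]]] := surface_rebase (v := a) Aw.
  by apply: supp; rewrite inE eqxx.
have sub : {subset [:: b; c; d] <= [:: b'; c'; d']}.
  move=> u uin; have := quad_uniq QQ q; rewrite cons_uniq => /andP[aN _].
  have := supp u; rewrite inE uin orbT => /(_ isT).
  rewrite ew; apply: contraNT => uN; rewrite quad_point_out // inE negb_or uN andbT.
  by apply: contra aN => /eqP <-.
case: (quad_align QQ q q' sub) => -[? ? ?]; subst; first by exists p.
by exists (p.2, p.1); [exact: sq_rev | rewrite quad_point_rev].
Qed.

End Surface.

Lemma mx_continuous (T U : topologicalType) m n (f : T -> 'M[U]_(m, n)) :
  (forall i j, continuous (fun t => f t i j)) -> continuous f.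
Proof.
move=> cf t A [P Pt sPA].
have FP : \forall s \near t, forall i, forall j, P i j (f s i j).
  apply: filter_forall => i; apply: filter_forall => j.
  exact: (cf i j t (P i j) (Pt i j)).
by apply: filterS FP => s Ps; exact: sPA.
Qed.

Section Reals.
Variable R : realType.

Lemma continuous_pair (T U V : topologicalType) (f : T -> U) (g : T -> V) :
  continuous f -> continuous g -> continuous (fun t => (f t, g t)).
Proof. by move=> cf cg t; apply: cvg_pair; [exact: cf | exact: cg]. Qed.

Lemma continuous_add (T : topologicalType) (f g : T -> R) :
  continuous f -> continuous g -> continuous (fun t => f t + g t).
Proof. by move=> cf cg t; apply: cvgD; [exact: cf | exact: cg]. Qed.

Lemma continuous_opp (T : topologicalType) (f : T -> R) :
  continuous f -> continuous (fun t => - f t).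
Proof. by move=> cf t; apply: cvgN; exact: cf. Qed.

Lemma continuous_mul (T : topologicalType) (f g : T -> R) :
  continuous f -> continuous g -> continuous (fun t => f t * g t).
Proof. by move=> cf cg t; apply: cvgM; [exact: cf | exact: cg]. Qed.

Lemma continuous_sum (T : topologicalType) (I : Type) (r : seq I) (f : I -> T -> R) :
  (forall i, continuous (f i)) -> continuous (fun t => \sum_(i <- r) f i t).
Proof.
move=> cf; elim: r => [|i r IH].
  by rewrite (_ : (fun t => _) = fun=> 0);
    [move=> t; exact: cvg_cst | apply/funext => t; rewrite big_nil].
rewrite (_ : (fun t => _) = fun t => f i t + \sum_(j <- r) f j t).
  exact: continuous_add.
by apply/funext => t; rewrite big_cons.
Qed.

Lemma quad_point_continuous n (a b c d : 'I_n) :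
  continuous (@quad_point R n a b c d).
Proof.
apply: mx_continuous => i j p; rewrite (ord1 i).
rewrite (_ : (fun t => _) = (fun q : R * R => (1 - q.1) * (1 - q.2) * (j == a)%:R
  + q.1 * (1 - q.2) * (j == b)%:R + q.1 * q.2 * (j == c)%:R
  + (1 - q.1) * q.2 * (j == d)%:R)); last by apply/funext => q; exact: quad_point_coord.
have c1 : {for p, continuous (fun q : R * R => q.1)} by exact: cvg_fst.
have c2 : {for p, continuous (fun q : R * R => q.2)} by exact: cvg_snd.
have d1 : {for p, continuous (fun q : R * R => 1 - q.1)} by apply: cvgB; [exact: cvg_cst|].
have d2 : {for p, continuous (fun q : R * R => 1 - q.2)} by apply: cvgB; [exact: cvg_cst|].
by apply: cvgD; [apply: cvgD; [apply: cvgD|]|]; apply: cvgM => //;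
  try exact: cvg_cst; apply: cvgM.
Qed.

Lemma starshaped_connected (T : topologicalType) (K : set (R * R)) p0 (f : R * R -> T) :
  K p0 -> (forall p t, K p -> 0 <= t <= 1 ->
    K (p0.1 + t * (p.1 - p0.1), p0.2 + t * (p.2 - p0.2))) ->
  {within K, continuous f} -> connected (f @` K).
Proof.
move=> K0 Kstar; apply: connected_continuous_connected.
pose g (p : R * R) (t : R) := (p0.1 + t * (p.1 - p0.1), p0.2 + t * (p.2 - p0.2)).
rewrite (_ : K = \bigcup_(p in K) (g p @` `[0, 1]%classic)); last first.
  apply/seteqP; split=> [p Kp|p [q Kq [t /=]]].
    exists p => //; exists 1; first by rewrite /= in_itv /= ler01 lexx.
    by rewrite /g !mul1r !subrKC; case: (p).
  by rewrite in_itv /= => tt <-; exact: Kstar.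
apply: bigcup_connected => [|p _].
  exists p0 => p _; exists 0; first by rewrite /= in_itv /= ler01 lexx.
  by rewrite /g !mul0r !addr0; case: (p0).
apply: connected_continuous_connected; first exact: segment_connected.
apply: continuous_subspaceT; apply: continuous_pair => t;
  by apply: cvgD; [exact: cvg_cst | apply: cvgM; [exact: cvg_id | exact: cvg_cst]].
Qed.

End Reals.

Section Space.
Variables (R : realType) (n : nat) (Q : 'I_n -> 'I_n -> 'I_n -> 'I_n -> Prop).
Hypothesis QQ : quadrangles Q.

Definition surface_space : topologicalType := set_type (@surface_set R n Q).

Variable s0 : surface_space.
Implicit Types (s : surface_space) (a b c d u v : 'I_n) (w : 'rV[R]_n).

Definition weights s : 'rV[R]_n := set_val s.

Lemma weights_surface s : surface_set Q (weights s).
Proof. exact: set_valP. Qed.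

Lemma weights_inj : injective weights.
Proof. exact: val_inj. Qed.

Lemma weights_continuous : continuous weights.
Proof. exact: initial_continuous. Qed.

Lemma weight_continuous u : continuous (fun s => weights s 0 u).
Proof.
move=> s; apply: (@cvg_comp _ _ _ weights (fun w => w 0 u)).
  exact: weights_continuous.
exact: coord_continuous.
Qed.

(** The point [s0] is the default value outside the surface. It lets maps into the subspace be
    defined on all of their ambient space. *)
Definition to_surface w : surface_space := insubd s0 w.

Lemma to_surfaceK w : surface_set Q w -> weights (to_surface w) = w.
Proof. by move=> Aw; exact: insubdK (mem_set Aw). Qed.

Lemma to_surface_continuous (T : topologicalType) (B : set T) (f : T -> 'rV[R]_n) :
  {within B, continuous f} -> (forall t, B t -> surface_set Q (f t)) ->
  {within B, continuous (to_surface \o f)}.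
Proof.
move=> cf Bf; apply: (@continuous_comp_initial _ _ _ set_val).
apply: (@subspace_eq_continuous _ _ _ f) => // t /set_mem Bt.
by rewrite /= [LHS](esym (to_surfaceK (Bf _ Bt))).
Qed.

(** The weights are continuous real functions that separate points. *)
Lemma surface_hausdorff : hausdorff_space surface_space.
Proof.
move=> s t st; apply: weights_inj; apply/rowP => u; apply: Rhausdorff => A B As Bt.
have [r [Ar Br]] := st _ _ (weight_continuous As) (weight_continuous Bt).
by exists (weights r 0 u).
Qed.

Definition face_point a b c d p := to_surface (quad_point a b c d p).

Lemma face_point_continuous a b c d (B : set (R * R)) : Q a b c d ->
  (forall p, B p -> sq p) -> {within B, continuous (face_point a b c d)}.
Proof.
move=> q Bsq; apply: to_surface_continuous.
  exact/continuous_subspaceT/quad_point_continuous.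
by move=> p Bp; exists a, b, c, d, p; split => //; exact: Bsq.
Qed.

Lemma weights_face_point a b c d p : Q a b c d -> sq p ->
  weights (face_point a b c d p) = quad_point a b c d p.
Proof. by move=> q sp; apply: to_surfaceK; exists a, b, c, d, p. Qed.

Lemma surface_spaceP s : exists a b c d p,
  [/\ Q a b c d, sq p & s = face_point a b c d p].
Proof.
have [a [b [c [d [p [q sp e]]]]]] := weights_surface s.
exists a, b, c, d, p; split => //; apply: weights_inj.
by rewrite weights_face_point.
Qed.

Definition sq_set : set (R * R) := `[0, 1]%classic `*` `[0, 1]%classic.

Lemma sq_setP p : sq_set p <-> sq p.
Proof.
rewrite /sq_set /= !in_itv /=; split; first by case=> /andP[] ? ? /andP[].
by case=> -> -> -> ->.
Qed.

Lemma surface_compact : compact [set: surface_space].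
Proof.
pose K (i : 'I_n * 'I_n * 'I_n * 'I_n) : set surface_space :=
  let: (a, b, c, d) := i in face_point a b c d @` sq_set.
pose P (i : 'I_n * 'I_n * 'I_n * 'I_n) := let: (a, b, c, d) := i in `[< Q a b c d >].
rewrite (_ : setT = \big[setU/set0]_(i <- index_enum _ | P i) K i).
  apply: bigsetU_compact => -[[[a b] c] d] /asboolP q; apply: continuous_compact.
    by apply: face_point_continuous => // p /sq_setP.
  by apply: compact_setX; exact: segment_compact.
rewrite -bigcup_seq_cond; apply/esym/seteqP; split=> // s _.
have [a [b [c [d [p [q sp ->]]]]]] := surface_spaceP s.
exists (a, b, c, d) => /=; last by exists p => //; exact/sq_setP.
by rewrite mem_index_enum /=; exact/asboolP.
Qed.

Definition quad_adj a b := `[< exists c d, Q a b c d >].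

Lemma quad_adj_sym : symmetric quad_adj.
Proof.
suff imp a b : quad_adj a b -> quad_adj b a by move=> a b; apply/idP/idP; exact: imp.
move=> /asboolP[c [d q]]; apply/asboolP; exists d, c.
exact: (quad_rot QQ (quad_rot QQ (quad_rot QQ (quad_rev QQ q)))).
Qed.

Lemma quad_adj_irr : irreflexive quad_adj.
Proof.
move=> a; apply/negP => /asboolP[c [d q]].
by have [] := quad_neq QQ q; rewrite eqxx.
Qed.

Hypothesis covered : forall a, exists b, quad_adj a b.
Variable hub : 'I_n.
Hypothesis hubP : forall a, a != hub -> quad_adj hub a.

(** The formula mentions no face, so the arc is the same from both sides; on every face at ab it is
    the side y = 0 of the patch. *)
Definition edge_point a b (t : R) : surface_space :=
  to_surface ((1 - t) *: vertex_weight R a + t *: vertex_weight R b).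

Lemma edge_pointE a b c d t : Q a b c d -> edge_point a b t = face_point a b c d (t, 0).
Proof.
move=> q; congr to_surface; apply/rowP => j; rewrite quad_point_coord !mxE /=.
by ring.
Qed.

Lemma weights_edge_point a b t : quad_adj a b -> 0 <= t <= 1 ->
  weights (edge_point a b t) = (1 - t) *: vertex_weight R a + t *: vertex_weight R b.
Proof.
move=> /asboolP[c [d q]] /andP[t0 t1]; rewrite (edge_pointE _ q).
have st : sq (t, 0) by split => //=; rewrite ?lexx ?ler01.
rewrite weights_face_point //.
by apply/rowP => j; rewrite quad_point_coord !mxE !eqxx /=; ring.
Qed.

Definition vertex_pt a : surface_space := to_surface (vertex_weight R a).

Lemma vertex_ptE a b : vertex_pt a = edge_point a b 0.
Proof. by rewrite /edge_point subr0 scale1r scale0r addr0. Qed.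

Lemma vertex_ptE1 a b : vertex_pt b = edge_point a b 1.
Proof. by rewrite /edge_point subrr scale0r scale1r add0r. Qed.

Lemma weights_vertex_pt a : weights (vertex_pt a) = vertex_weight R a.
Proof.
have [b ab] := covered a.
by rewrite (vertex_ptE a b) weights_edge_point ?lexx ?ler01 // subr0 scale1r scale0r addr0.
Qed.

Lemma vertex_weightE a b : vertex_weight R a 0 b = (b == a)%:R.
Proof. by rewrite mxE eqxx. Qed.

Lemma edge_weight a b t u : quad_adj a b -> 0 <= t <= 1 ->
  weights (edge_point a b t) 0 u = (1 - t) * (u == a)%:R + t * (u == b)%:R.
Proof. by move=> ab tt; rewrite weights_edge_point // !mxE eqxx. Qed.

Lemma edge_point_sym a b t : edge_point b a t = edge_point a b (1 - t).
Proof. by congr to_surface; rewrite subKr addrC. Qed.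

Lemma edge_point_continuous a b : quad_adj a b ->
  {within `[0, 1]%classic, continuous (edge_point a b)}.
Proof.
move=> /asboolP[c [d q]]; rewrite (_ : edge_point a b = to_surface \o (@quad_point R n a b c d \o (fun t => (t, 0)))).
  apply: to_surface_continuous.
    apply: continuous_subspaceT => t; apply: continuous_comp.
      by apply: continuous_pair => ?; [exact: cvg_id | exact: cvg_cst].
    exact: quad_point_continuous.
  move=> t /=; rewrite in_itv /= => /andP[t0 t1]; exists a, b, c, d, (t, 0).
  by split => //; split => //=; rewrite ?lexx ?ler01.
by apply/funext => t; exact: edge_pointE.
Qed.

Lemma quad_adj_neq a b : quad_adj a b -> a != b.
Proof. by apply: contraTneq => ->; rewrite quad_adj_irr. Qed.

Lemma vertex_pt_inj : injective vertex_pt.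
Proof.
move=> a b e; have := weights_vertex_pt a; rewrite e weights_vertex_pt => /rowP /(_ a).
by rewrite !vertex_weightE eqxx; case: eqP => // _ /eqP; rewrite eq_sym oner_eq0.
Qed.

Lemma edge_point_inj u v : quad_adj u v -> {in `[0, 1] &, injective (edge_point u v)}.
Proof.
move=> uv t t'; rewrite !in_itv /= => tt tt' e.
have := edge_weight v uv tt; rewrite e edge_weight // eqxx eq_sym.
by rewrite (negbTE (quad_adj_neq uv)) !mulr0 !add0r !mulr1.
Qed.

Lemma edge_point_vertex u v x (t : R) : quad_adj u v -> t \in `]0, 1[ ->
  edge_point u v t <> vertex_pt x.
Proof.
move=> uv; rewrite in_itv /= => /andP[t0 t1] e.
have tt : 0 <= t <= 1 by rewrite !ltW.
have := edge_weight u uv tt; have := edge_weight v uv tt; rewrite e weights_vertex_pt.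
rewrite !vertex_weightE !eqxx (eq_sym v u) (negbTE (quad_adj_neq uv)).
by case: (v == x); case: (u == x); rewrite /=; lra.
Qed.

Lemma edge_point_disjoint u v x y (t t' : R) : quad_adj u v -> quad_adj x y ->
  [set u; v]%SET != [set x; y]%SET -> t \in `]0, 1[ -> t' \in `]0, 1[ ->
  edge_point u v t <> edge_point x y t'.
Proof.
move=> uv xy uvxy; rewrite !in_itv /= => /andP[t0 t1] /andP[t0' t1'] e.
have tt : 0 <= t <= 1 by rewrite !ltW.
have tt' : 0 <= t' <= 1 by rewrite !ltW.
have uxy : (u == x) || (u == y).
  have := edge_weight u uv tt; rewrite e edge_weight // eqxx.
  rewrite (negbTE (quad_adj_neq uv)).
  by case: (u == x) => //; case: (u == y) => //=; lra.
have vxy : (v == x) || (v == y).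
  have := edge_weight v uv tt; rewrite e edge_weight // eqxx (eq_sym v u).
  rewrite (negbTE (quad_adj_neq uv)).
  by case: (v == x) => //; case: (v == y) => //=; lra.
move: uvxy (quad_adj_neq uv); case/orP: uxy => /eqP ->; case/orP: vxy => /eqP ->;
  by rewrite ?eqxx // finset.setUC eqxx.
Qed.

Definition model : embedding R quad_adj surface_space :=
  @Embedding R _ quad_adj surface_space vertex_pt edge_point
    vertex_pt_inj edge_point_continuous edge_point_inj
    (fun u v _ => esym (vertex_ptE u v)) (fun u v _ => esym (vertex_ptE1 u v))
    (fun u v t _ _ => edge_point_sym u v t)
    edge_point_vertex edge_point_disjoint.

Lemma surface_connected : connected [set: surface_space].
Proof.
pose C := connected_component [set: surface_space] (vertex_pt hub).
have Cmax B x y : connected B -> B x -> B y -> C x -> C y.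
  move=> cB Bx By Cx; apply: (connected_component_trans Cx).
  exact: (connected_component_max Bx _ cB By).
have Ch : C (vertex_pt hub) by exact: connected_component_refl.
have Cv a : C (vertex_pt a).
  have [->//|/hubP ah] := eqVneq a hub.
  apply: (Cmax (edge_point hub a @` `[0, 1]%classic)) Ch.
  - by apply: connected_continuous_connected; [exact: segment_connected | exact: edge_point_continuous].
  - by exists 0; [rewrite /= bound_itvE ler01 | rewrite -vertex_ptE].
  - by exists 1; [rewrite /= bound_itvE ler01 | rewrite -vertex_ptE1].
rewrite (_ : setT = C); first exact: component_connected.
apply/esym/seteqP; split=> // s _.
have [a [b [c [d [p [q sp ->]]]]]] := surface_spaceP s.
apply: (Cmax (face_point a b c d @` sq_set)) (Cv a).
- apply: (@starshaped_connected _ _ _ (0, 0)).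
  + by apply/sq_setP; split => //=; rewrite ?lexx ?ler01.
  + move=> r t /sq_setP[? ? ? ?] /andP[? ?]; apply/sq_setP.
    by split; rewrite /= !subr0 !add0r ?mulr_ge0 // mulr_ile1.
  + by apply: face_point_continuous => // r /sq_setP.
- exists (0, 0); first by apply/sq_setP; split => //=; rewrite ?lexx ?ler01.
  by rewrite (vertex_ptE a b) (edge_pointE _ q).
- by exists p => //; exact/sq_setP.
Qed.

End Space.

(** * Disks and faces *)

Lemma homeomorphism_cancel (X Y : topologicalType) (A : set X) (B : set Y)
    (f : X -> Y) (g : Y -> X) :
  {within A, continuous f} -> {within B, continuous g} ->
  (forall x, A x -> B (f x) /\ g (f x) = x) ->
  (forall y, B y -> A (g y) /\ f (g y) = y) -> homeomorphism A B f.
Proof.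
move=> cf cg AB BA; split => //.
- split.
  + by move=> x /AB[].
  + move=> x y /set_mem /AB[_ ex] /set_mem /AB[_ ey] e.
    by rewrite -ex e ey.
  + by move=> y /BA[Ag e]; exists (g y).
- by exists g => // x /set_mem /AB[].
Qed.

Lemma within_continuous_comp2 (X Y Z : topologicalType) (A : set X) (B : set Y)
    (f : X -> Y) (g : Y -> Z) :
  {within A, continuous f} -> {within B, continuous g} ->
  (forall x, A x -> B (f x)) -> {within A, continuous (g \o f)}.
Proof.
move=> /subspace_continuousP cf /subspace_continuousP cg AB.
apply/subspace_continuousP => x Ax.
have Bfx := AB _ Ax; apply: cvg_trans (cg _ Bfx).
move=> U; rewrite /= /nbhs /= => gU; have := cf _ Ax _ gU.
rewrite /nbhs /= /within /=; apply: filterS => y; rewrite /= => h Ay; exact: (h Ay (AB _ Ay)).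
Qed.

Section Disk.
Variable R : realType.
Implicit Types (p P : R * R) (u w t : R).

Let pi2_gt0 : 0 < pi / 2 :> R.
Proof. by rewrite divr_gt0 ?pi_gt0. Qed.

Lemma asin_continuous : {within `[-1, 1]%classic, continuous (@asin R)}.
Proof.
have p0 := pi2_gt0.
have e1 : sin (pi / 2) = 1 :> R by rewrite sin_pihalf.
have e2 : sin (- (pi / 2)) = - 1 :> R by rewrite sinN e1.
have := @segment_can_continuous R (- (pi / 2)) (pi / 2) sin asin.
rewrite e1 e2 (min_idPl _) ?(max_idPr _) ?lerN1x ?ler01 //; try lra.
apply; first by lra.
- by apply: continuous_subspaceT => x; exact: continuous_sin.
- exact: sinK.
Qed.

(** For u + w at least pi/2 the sine of w is at least cos u, which is nonnegative. The Boolean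
    treats the strict and the weak inequality at once, for the open and the closed disk. *)
Lemma sin2_ge1 (b : bool) (u w : R) :
  - (pi / 2) <= u <= pi / 2 -> - (pi / 2) <= w <= pi / 2 ->
  pi / 2 < u + w ?<= if b -> 1 < sin u ^+ 2 + sin w ^+ 2 ?<= if b.
Proof.
have p0 := pi2_gt0; move=> /andP[u1 u2] /andP[w1 w2] uw.
have cu0 : 0 <= cos u by apply: cos_ge0_pihalf; rewrite u1 u2.
have : sin (pi / 2 - u) < sin w ?<= if b.
  have w_in : w \in `[- (pi / 2), pi / 2] by rewrite in_itv /= w1.
  have u_in : pi / 2 - u \in `[- (pi / 2), pi / 2].
    by move: uw; rewrite in_itv /=; case: (b) => /= ?; apply/andP; split; lra.
  move: uw; case: (b) => /= uw; last by rewrite ltr_sin //; lra.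
  by rewrite leNgt ltr_sin // -leNgt; lra.
rewrite sinB sin_pihalf cos_pihalf mul1r mul0r subr0.
have := @cos2Dsin2 R u; case: (b) => /= ? ?; nra.
Qed.

Lemma sin2_lt1 (u w : R) : `|u| + `|w| < pi / 2 -> sin u ^+ 2 + sin w ^+ 2 < 1.
Proof.
have p0 := pi2_gt0; move=> uw.
have sq_norm t : sin t ^+ 2 = sin `|t| ^+ 2 :> R.
  by case: (ger0P t) => // _; rewrite sinN sqrrN.
rewrite sq_norm (sq_norm w).
have := normr_ge0 u; have := normr_ge0 w; move: `|u| `|w| uw => {}u {}w uw w0 u0.
have sw0 : 0 <= sin w by apply: sin_ge0_pi; apply/andP; split; lra.
have : sin w < sin (pi / 2 - u).
  by rewrite ltr_sin ?in_itv /=; [lra | apply/andP; split; lra..].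
rewrite sinB sin_pihalf cos_pihalf mul1r mul0r subr0 => lt_sin.
have := @cos2Dsin2 R u; nra.
Qed.

(** This affine map sends (1,0), (0,1), (-1,0), (0,-1) to (0,0), (1,0), (1,1), (0,1), so that
    quarter turns of the circle correspond to the sides of the patch in the order of its
    vertices. *)
Definition diamond_sq p : R * R := ((1 - p.1 + p.2) / 2, (1 - p.1 - p.2) / 2).

(* The substitution by arcsines carries the disk onto the diamond             *)
(* |x| + |y| <= 1 because sin^2 u + sin^2 w <= 1 amounts to                   *)
(* |u| + |w| <= pi / 2; on the circle it is linear in the angle.              *)
Definition disk_sq P : R * R :=
  diamond_sq (asin P.1 / (pi / 2), asin P.2 / (pi / 2)).

Definition sq_disk p : R * R :=
  (sin (pi / 2 * (1 - p.1 - p.2)), sin (pi / 2 * (p.1 - p.2))).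

Definition osq p := [/\ 0 < p.1, p.1 < 1, 0 < p.2 & p.2 < 1].

Lemma osq_sq p : osq p -> sq p.
Proof. by case=> *; split; apply: ltW. Qed.

Lemma closed_disk_itv P : closed_disk P -> (-1 <= P.1 <= 1) /\ (-1 <= P.2 <= 1).
Proof.
rewrite /closed_disk /= => PP.
have := sqr_ge0 P.1; have := sqr_ge0 P.2 => h1 h2.
by split; apply/andP; split; nra.
Qed.

Lemma disk_sqK P : closed_disk P -> sq_disk (disk_sq P) = P.
Proof.
have p0 := pi2_gt0; move=> /closed_disk_itv[i1 i2].
rewrite /sq_disk /disk_sq /diamond_sq /= [RHS]surjective_pairing.
rewrite -[X in _ = (X, _)]asinK ?in_itv //= -[X in _ = (_, X)]asinK ?in_itv //=.
by congr (sin _, sin _); field; lra.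
Qed.

Lemma sq_diskK p : sq p -> disk_sq (sq_disk p) = p.
Proof.
have p0 := pi2_gt0; case=> *; rewrite /disk_sq /sq_disk /=.
rewrite !sinK ?in_itv /=; try (apply/andP; split; nra).
rewrite /diamond_sq /= [RHS]surjective_pairing.
by congr pair; field; lra.
Qed.

Lemma asin_disk_le (x y : R) : x ^+ 2 + y ^+ 2 <= 1 -> asin x + asin y <= pi / 2.
Proof.
move=> h; have [i1 i2] := @closed_disk_itv (x, y) h.
rewrite leNgt; apply/negP => lt_asin.
have := @sin2_ge1 false (asin x) (asin y).
rewrite /= !asinK ?in_itv //= !asin_geNpi2 ?asin_lepi2 //= => /(_ isT isT lt_asin).
by rewrite ltNge h.
Qed.

Lemma asin_disk_lt (x y : R) : x ^+ 2 + y ^+ 2 < 1 -> asin x + asin y < pi / 2.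
Proof.
move=> h; have [i1 i2] := @closed_disk_itv (x, y) (ltW h).
rewrite ltNge; apply/negP => le_asin.
have := @sin2_ge1 true (asin x) (asin y).
rewrite /= !asinK ?in_itv //= !asin_geNpi2 ?asin_lepi2 //= => /(_ isT isT le_asin).
by rewrite leNgt h.
Qed.

Lemma asinN (x : R) : -1 <= x <= 1 -> asin (- x) = - asin x.
Proof.
move=> xx; have xx' : -1 <= - x <= 1 by rewrite lerN2 andbC lerNl.
have := asin_geNpi2 xx; have := asin_lepi2 xx; have := asin_geNpi2 xx'.
have := asin_lepi2 xx' => *.
apply: sin_inj; rewrite ?in_itv /= ?sinN ?asinK ?in_itv //;
  by apply/andP; split; lra.
Qed.

Lemma disk_sq_sq P : closed_disk P -> sq (disk_sq P).
Proof.
have p0 := pi2_gt0; move=> PP; have [i1 i2] := closed_disk_itv PP.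
have := @asin_disk_le P.1 P.2; have := @asin_disk_le (- P.1) P.2.
have := @asin_disk_le P.1 (- P.2); have := @asin_disk_le (- P.1) (- P.2).
rewrite !sqrrN !asinN // => /(_ PP) h1 /(_ PP) h2 /(_ PP) h3 /(_ PP) h4.
have sc t : t <= pi / 2 -> t / (pi / 2) <= 1 by rewrite ler_pdivrMr // mul1r.
move: (sc _ h1) (sc _ h2) (sc _ h3) (sc _ h4); rewrite /disk_sq /diamond_sq /sq /=.
by rewrite !mulrDl !mulNr => *; split; lra.
Qed.

Lemma disk_sq_osq P : open_disk P -> osq (disk_sq P).
Proof.
have p0 := pi2_gt0; move=> PP; have [i1 i2] := closed_disk_itv (ltW PP).
have := @asin_disk_lt P.1 P.2; have := @asin_disk_lt (- P.1) P.2.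
have := @asin_disk_lt P.1 (- P.2); have := @asin_disk_lt (- P.1) (- P.2).
rewrite !sqrrN !asinN // => /(_ PP) h1 /(_ PP) h2 /(_ PP) h3 /(_ PP) h4.
have sc t : t < pi / 2 -> t / (pi / 2) < 1 by rewrite ltr_pdivrMr // mul1r.
move: (sc _ h1) (sc _ h2) (sc _ h3) (sc _ h4); rewrite /disk_sq /diamond_sq /osq /=.
by rewrite !mulrDl !mulNr => *; split; lra.
Qed.

Lemma sq_disk_disk p : osq p -> open_disk (sq_disk p).
Proof.
have p0 := pi2_gt0; case=> *; apply: sin2_lt1; rewrite !(normrM (pi / 2)) (gtr0_norm p0) -mulrDr.
rewrite -[ltRHS]mulr1 ltr_pM2l //.
by case: (ger0P (1 - p.1 - p.2)); case: (ger0P (p.1 - p.2)); lra.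
Qed.

Lemma diamond_sq_continuous : continuous diamond_sq.
Proof.
have c1 : continuous (@fst R R) by move=> ?; exact: cvg_fst.
have c2 : continuous (@snd R R) by move=> ?; exact: cvg_snd.
apply: continuous_pair => p; apply: cvgMl.
  by apply: cvgD; [apply: cvgB; [exact: cvg_cst | exact: c1] | exact: c2].
by apply: cvgB; [apply: cvgB; [exact: cvg_cst | exact: c1] | exact: c2].
Qed.

Lemma disk_sq_continuous : {within @closed_disk R, continuous disk_sq}.
Proof.
have ca (f : R * R -> R) : continuous f -> (forall P, closed_disk P -> -1 <= f P <= 1) ->
    {within @closed_disk R, continuous (asin \o f)}.
  move=> cf fI; apply: within_continuous_comp2 asin_continuous _.
    exact: continuous_subspaceT.
  by move=> P /fI /= ?; rewrite in_itv.
have c1 : {within @closed_disk R, continuous (asin \o fst)}.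
  by apply: ca => [?|P /closed_disk_itv[]//]; exact: cvg_fst.
have c2 : {within @closed_disk R, continuous (asin \o snd)}.
  by apply: ca => [?|P /closed_disk_itv[]//]; exact: cvg_snd.
rewrite (_ : disk_sq = diamond_sq \o (fun P => (asin P.1 / (pi / 2), asin P.2 / (pi / 2)))) //.
apply: (within_continuous_comp2 _
  (continuous_subspaceT (A := setT) diamond_sq_continuous)) => //.
by apply: continuous_pair => P; apply: cvgMl; [exact: c1 | exact: c2].
Qed.

Lemma sq_disk_continuous : continuous sq_disk.
Proof.
have c1 : continuous (@fst R R) by move=> ?; exact: cvg_fst.
have c2 : continuous (@snd R R) by move=> ?; exact: cvg_snd.
apply: continuous_pair => p; apply: continuous_comp; try exact: continuous_sin.
  apply: cvgMr; apply: cvgB; [apply: cvgB; [exact: cvg_cst | exact: c1] | exact: c2].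
by apply: cvgMr; apply: cvgB; [exact: c1 | exact: c2].
Qed.

(** On each quarter of the circle both arcsines are linear in the angle, so the boundary runs along
    the sides at constant speed, as [boundary_walk] demands. The four cases are the quarter
    turns. *)
Lemma circle_sq (i : nat) (s : R) : (i < 4)%N -> 0 <= s <= 1 ->
  disk_sq (circle_point ((i%:R + s) / 4%:R)) =
  nth (0, 0) [:: (s, 0); (1, s); (1 - s, 1); (0, 1 - s)] i.
Proof.
have p0 := pi2_gt0; move=> i4 /andP[s0 s1].
have as1 : asin (sin (pi / 2 * s)) = pi / 2 * s :> R.
  by rewrite sinK // in_itv /=; apply/andP; split; nra.
have ac1 : asin (cos (pi / 2 * s)) = pi / 2 * (1 - s) :> R.
  rewrite (_ : pi / 2 * s = pi / 2 - pi / 2 * (1 - s)); last by ring.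
  rewrite cosB cos_pihalf sin_pihalf mul0r add0r mul1r.
  by rewrite sinK // in_itv /=; apply/andP; split; nra.
have sI (x : R) : -1 <= sin x <= 1 by rewrite sin_geN1 sin_le1.
have cI (x : R) : -1 <= cos x <= 1 by rewrite cos_geN1 cos_le1.
have pi_neq : pi != 0 :> R by rewrite gt_eqF ?pi_gt0.
rewrite /disk_sq /circle_point /diamond_sq /=.
have -> : 2 * pi * ((i%:R + s) / 4%:R) = pi / 2 * s + pi / 2 *+ i :> R.
  by rewrite -mulr_natr; field.
have k t : pi / 2 * t / (pi / 2) = t :> R.
  by rewrite mulrAC divff ?mul1r // gt_eqF.
case: i i4 => [|[|[|[|//]]]] _ /=; rewrite ?mulr0n ?addr0 ?mulr1n.
- by rewrite as1 ac1 !k; congr pair; lra.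
- rewrite cosD sinD cos_pihalf sin_pihalf !mulr0 !mulr1 !add0r ?addr0 ?sub0r.
  by rewrite asinN // as1 ac1 mulNr !k; congr pair; lra.
- rewrite (_ : pi / 2 *+ 2 = pi); last by rewrite -mulr_natr; lra.
  rewrite cosDpi sinDpi !asinN // as1 ac1 !mulNr !k.
  by congr pair; lra.
- rewrite (_ : pi / 2 * s + _ = pi / 2 * s + pi / 2 + pi); last by rewrite -mulr_natr; lra.
  rewrite cosDpi sinDpi cosD sinD cos_pihalf sin_pihalf.
  rewrite !mulr0 !mulr1 ?add0r ?addr0 ?sub0r ?opprK asinN // as1 ac1 mulNr !k.
  by congr pair; lra.
Qed.

End Disk.

Section Faces.
Variables (R : realType) (n : nat) (Q : 'I_n -> 'I_n -> 'I_n -> 'I_n -> Prop).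
Hypothesis QQ : quadrangles Q.
Variable s0 : surface_space R Q.
Implicit Types (s : surface_space R Q) (a b c d u v : 'I_n) (p : R * R).
Local Notation face_point := (face_point s0).

Lemma face_point_rot a b c d p : face_point b c d a (p.2, 1 - p.1) = face_point a b c d p.
Proof. by rewrite /face_point quad_point_rot. Qed.

(** As the support of a point determines its cell, positivity of four weights describes the open
    patch, and in this form openness is immediate. *)
Definition face_set a b c d : set (surface_space R Q) :=
  [set s | forall u, u \in [:: a; b; c; d] -> 0 < weights s 0 u].

Lemma face_set_open a b c d : open (face_set a b c d).
Proof.
have o u : open [set s : surface_space R Q | 0 < weights s 0 u].
  apply: (@open_comp _ _ (fun s => weights s 0 u) [set x | 0 < x]).
    by move=> s _; exact: weight_continuous.
  exact: open_gt.
rewrite (_ : face_set a b c d = [set s | 0 < weights s 0 a] `&` [set s | 0 < weights s 0 b]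
  `&` [set s | 0 < weights s 0 c] `&` [set s | 0 < weights s 0 d]).
  by do 3?apply: openI.
apply/seteqP; split=> s.
  by move=> h; split; [split; [split|]|]; apply: h; rewrite !inE eqxx ?orbT.
by move=> [[[? ?] ?] ?] u; rewrite !inE => /or4P[]/eqP ->.
Qed.

Lemma face_set_point a b c d p : Q a b c d -> osq p ->
  face_set a b c d (face_point a b c d p).
Proof.
move=> q op u; have abcd := quad_uniq QQ q; case: (op) => ? ? ? ? /=.
rewrite (weights_face_point s0 q (osq_sq op)) !inE.
by case/or4P => /eqP ->; rewrite ?(quad_point_a abcd) ?(quad_point_b abcd)
  ?(quad_point_c abcd) ?(quad_point_d abcd) mulr_gt0 ?subr_gt0.
Qed.

Lemma face_setP a b c d s : Q a b c d -> face_set a b c d s ->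
  exists2 p, osq p & s = face_point a b c d p.
Proof.
move=> q Fs; have abcd := quad_uniq QQ q.
have [|p sp e] := surface_face QQ q (weights_surface s).
  by move=> u /Fs /gt_eqF ->.
exists p; last by apply: (@weights_inj R n Q); rewrite (weights_face_point s0 q sp).
have := Fs a; have := Fs b; have := Fs c; have := Fs d.
rewrite !inE !eqxx !orbT e (quad_point_a abcd) (quad_point_b abcd) (quad_point_c abcd).
rewrite (quad_point_d abcd) => /(_ isT) h1 /(_ isT) h2 /(_ isT) h3 /(_ isT) h4.
by case: sp => *; split; nra.
Qed.

Lemma face_set_mem a b c d s u : Q a b c d -> face_set a b c d s ->
  (u \in [:: a; b; c; d]) = (0 < weights s 0 u).
Proof.
move=> q Fs; apply/idP/idP => [/Fs//|].
have [p op ->] := face_setP q Fs; rewrite (weights_face_point s0 q (osq_sq op)).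
by apply: contraTT => /quad_point_out ->; rewrite ltxx.
Qed.

Lemma face_set_eq a b c d a' b' c' d' s : Q a b c d -> Q a' b' c' d' ->
  face_set a b c d s -> face_set a' b' c' d' s -> face_set a b c d = face_set a' b' c' d'.
Proof.
move=> q q' Fs Fs'; have e u : (u \in [:: a; b; c; d]) = (u \in [:: a'; b'; c'; d']).
  by rewrite (face_set_mem u q Fs) (face_set_mem u q' Fs').
by apply/seteqP; split=> t h u ?; apply: h; rewrite ?e // -e.
Qed.

Hypothesis covered : forall a, exists b, quad_adj Q a b.
Local Notation model := (model QQ s0 covered).

Lemma graph_image_edge a b c d (t : R) : Q a b c d -> 0 <= t <= 1 ->
  graph_image model (face_point a b c d (t, 0)).
Proof.
move=> q tt; right; exists a, b, t; split => //; last by rewrite -(edge_pointE s0 t q).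
by apply/asboolP; exists c, d.
Qed.

(** Points of the graph have at most two positive weights, interior points of a patch have four; a
    point of a patch with a coordinate 0 or 1 lies on one of its sides. *)
Lemma graph_imageC s : ~ graph_image model s <->
  exists a b c d, Q a b c d /\ face_set a b c d s.
Proof.
split=> [Ns|[a [b [c [d [q Fs]]]]]].
  have [a [b [c [d [p [q sp e]]]]]] := surface_spaceP s0 s.
  exists a, b, c, d; split => //; rewrite e; apply: face_set_point => //.
  case: (sp) => p1 p2 p3 p4; apply: contrapT => Np; apply: Ns; rewrite e {e}.
  have q2 := quad_rot QQ q; have q3 := quad_rot QQ q2; have q4 := quad_rot QQ q3.
  have [p20|p20] := eqVneq p.2 0.
    by rewrite [p]surjective_pairing p20; apply: graph_image_edge; rewrite ?p1.
  have [p11|p11] := eqVneq p.1 1.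
    by rewrite -face_point_rot p11 subrr; apply: graph_image_edge; rewrite ?p3.
  have [p21|p21] := eqVneq p.2 1.
    rewrite -face_point_rot -face_point_rot /= p21 subrr.
    by apply: graph_image_edge => //; apply/andP; split; lra.
  have [p10|p10] := eqVneq p.1 0.
    rewrite -face_point_rot -face_point_rot -face_point_rot /= p10 subr0 subrr.
    by apply: graph_image_edge => //; apply/andP; split; lra.
  exfalso; apply: Np; split; rewrite lt_neqAle ?p1 ?p2 ?p3 ?p4 andbT //.
  - by rewrite eq_sym.
  - by rewrite eq_sym.
have := quad_uniq QQ q; rewrite /= !inE !negb_or => /and4P[/and3P[ab ac ad] /andP[bc bd] cd _].
have Fa : 0 < weights s 0 a by rewrite -(face_set_mem a q Fs) !inE eqxx.
have Fb : 0 < weights s 0 b by rewrite -(face_set_mem b q Fs) !inE eqxx orbT.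
have Fc : 0 < weights s 0 c by rewrite -(face_set_mem c q Fs) !inE eqxx !orbT.
case=> [[v e]|[u [v [t [uv]]]]].
  move: Fa Fb; rewrite e (weights_vertex_pt s0 covered) !vertex_weightE !ltr0n !lt0b => /eqP <-.
  by rewrite eq_sym (negbTE ab).
rewrite in_itv /= => tt e; have pos x : 0 < weights s 0 x -> x = u \/ x = v.
  rewrite e (edge_weight s0 _ uv tt) => h; apply: contrapT => /not_orP[/eqP xu /eqP xv].
  by move: h; rewrite (negbTE xu) (negbTE xv) !mulr0 addr0 ltxx.
move: ab ac bc; case: (pos _ Fa) => ->; case: (pos _ Fb) => ->; case: (pos _ Fc) => ->;
  by rewrite ?eqxx.
Qed.

Lemma face_set_component a b c d s : Q a b c d -> face_set a b c d s ->
  connected_component (~` graph_image model) s = face_set a b c d.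
Proof.
move=> q Fs; set C := connected_component _ _.
have subC : C `<=` ~` graph_image model by exact: connected_component_sub.
have Fsub : face_set a b c d `<=` ~` graph_image model.
  by move=> t Ft; apply/graph_imageC; exists a, b, c, d.
have FC : face_set a b c d `<=` C.
  apply: connected_component_max => //.
  rewrite (_ : face_set a b c d = face_point a b c d @` [set p | osq p]).
    apply: (@starshaped_connected _ _ _ (1 / 2, 1 / 2)).
    - by split; rewrite /=; lra.
    - by move=> p t [? ? ? ?] /andP[? ?]; split; rewrite /=; nra.
    - by apply: face_point_continuous => // p; exact: osq_sq.
  apply/seteqP; split=> [t /(face_setP q)[p op ->]|_ [p op <-]]; first by exists p.
  exact: face_set_point.
(* [G] is the union of the other open faces. Within the component, the given face is the complement
   of the open set [G]; being open as well, it is the whole component. *)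
pose G := \bigcup_(i in [set i : 'I_n * 'I_n * 'I_n * 'I_n |
  let: (a', b', c', d') := i in Q a' b' c' d' /\
  face_set a' b' c' d' `&` face_set a b c d = set0])
  (let: (a', b', c', d') := i in face_set a' b' c' d').
have oG : open G by apply: bigcup_open => -[[[a' b'] c'] d'] _; exact: face_set_open.
have CE : C `&` face_set a b c d = C `&` ~` G.
  apply/seteqP; split=> t [Ct Ht]; split => //.
    move=> [[[[a' b'] c'] d']] [q' e] Ft'.
    by have : (face_set a' b' c' d' `&` face_set a b c d) t by []; rewrite e.
  have /subC/graph_imageC [a' [b' [c' [d' [q' Ft']]]]] := Ct.
  apply: contrapT => NF; apply: Ht; exists (a', b', c', d') => //; split => //.
  apply/seteqP; split=> // r [r1 r2]; apply: NF.
  by rewrite (face_set_eq q q' r2 r1).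
have cC : connected C by exact: component_connected.
suff e : C `&` face_set a b c d = C.
  by apply/seteqP; split=> //; rewrite -e; exact: subIsetr.
apply: cC.
- by exists s; split => //; exact: FC.
- by exists (face_set a b c d) => //; exact: face_set_open.
- by exists (~` G) => //; exact: open_closedC.
Qed.

Lemma faceP F : face model F <->
  exists a b c d, Q a b c d /\ F = face_set a b c d.
Proof.
split=> [[s Ns ->]|[a [b [c [d [q ->]]]]]].
  have /graph_imageC [a [b [c [d [q Fs]]]]] := Ns.
  by exists a, b, c, d; split => //; exact: face_set_component.
have Fs : face_set a b c d (face_point a b c d (1 / 2, 1 / 2)).
  by apply: face_set_point => //; split; rewrite /=; lra.
exists (face_point a b c d (1 / 2, 1 / 2)).
  by apply/graph_imageC; exists a, b, c, d.
by rewrite (face_set_component q Fs).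
Qed.

(** On a patch the weights of b and c add up to x, and those of c and d to y, which inverts the
    bilinear parametrization without division. *)
Definition face_coord b c d s : R * R :=
  (weights s 0 b + weights s 0 c, weights s 0 c + weights s 0 d).

Lemma face_coord_continuous b c d : continuous (face_coord b c d).
Proof.
by apply: continuous_pair; apply: continuous_add; exact: weight_continuous.
Qed.

Lemma face_pointK a b c d p : Q a b c d -> sq p -> face_coord b c d (face_point a b c d p) = p.
Proof.
move=> q sp; have abcd := quad_uniq QQ q; rewrite /face_coord (weights_face_point s0 q sp).
rewrite (quad_point_b abcd) (quad_point_c abcd) (quad_point_d abcd).
by rewrite [RHS]surjective_pairing; congr pair; ring.
Qed.

Definition disk_face a b c d P := face_point a b c d (disk_sq P).

Definition face_disk b c d s := sq_disk (face_coord b c d s).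

Lemma disk_face_continuous a b c d : Q a b c d ->
  {within @closed_disk R, continuous (disk_face a b c d)}.
Proof.
move=> q; apply: (within_continuous_comp2 (B := [set p | sq p])).
- exact: disk_sq_continuous.
- exact: face_point_continuous.
- by move=> P; exact: disk_sq_sq.
Qed.

Lemma open_disk_closed : @open_disk R `<=` @closed_disk R.
Proof. by move=> P /ltW. Qed.

Lemma face_disk_continuous b c d : continuous (face_disk b c d).
Proof.
move=> s; apply: continuous_comp; first exact: face_coord_continuous.
exact: sq_disk_continuous.
Qed.

Lemma disk_faceK a b c d P : Q a b c d -> open_disk P ->
  face_set a b c d (disk_face a b c d P) /\ face_disk b c d (disk_face a b c d P) = P.
Proof.
move=> q PP; have cP := open_disk_closed PP; split.
  by apply: face_set_point => //; exact: disk_sq_osq.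
by rewrite /face_disk /disk_face face_pointK ?disk_sqK //; exact: disk_sq_sq.
Qed.

Lemma face_diskK a b c d s : Q a b c d -> face_set a b c d s ->
  open_disk (face_disk b c d s) /\ disk_face a b c d (face_disk b c d s) = s.
Proof.
move=> q /(face_setP q)[p op ->].
rewrite /face_disk /disk_face face_pointK ?sq_diskK //; try exact: osq_sq.
by split => //; exact: sq_disk_disk.
Qed.

Lemma face_cellular : cellular model.
Proof.
move=> F /faceP[a [b [c [d [q ->]]]]]; exists (face_disk b c d).
apply: (@homeomorphism_cancel _ _ _ _ _ (disk_face a b c d)).
- exact/continuous_subspaceT/face_disk_continuous.
- exact: continuous_subspaceW open_disk_closed (disk_face_continuous q).
- by move=> s; exact: face_diskK.
- by move=> P; exact: disk_faceK.
Qed.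

Lemma face_boundary_walk a b c d : Q a b c d ->
  boundary_walk model (face_set a b c d) [:: a; b; c; d].
Proof.
move=> q; have q2 := quad_rot QQ q; have q3 := quad_rot QQ q2; have q4 := quad_rot QQ q3.
split => //.
  case=> [[|[|[|[|//]]]]] i; rewrite /walk_vertex !(tnth_nth a) /=; apply/asboolP;
    by do 2 eexists; eassumption.
exists (disk_face a b c d); split.
- exact: disk_face_continuous.
- apply: (@homeomorphism_cancel _ _ _ _ _ (face_disk b c d)).
  + exact: continuous_subspaceW open_disk_closed (disk_face_continuous q).
  + exact/continuous_subspaceT/face_disk_continuous.
  + by move=> P; exact: disk_faceK.
  + by move=> s; exact: face_diskK.
- move=> i s; rewrite in_itv /= => ss; rewrite /disk_face circle_sq //.
  case: i => [[|[|[|[|//]]]]] i; rewrite /walk_vertex !(tnth_nth a) /=.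
  + by rewrite (edge_pointE s0 s q).
  + by rewrite (edge_pointE s0 s q2) -(face_point_rot a b c d) /= subrr.
  + by rewrite (edge_pointE s0 s q3) -(face_point_rot a) -(face_point_rot b) /= subrr subKr.
  + by rewrite (edge_pointE s0 s q4) -(face_point_rot a) -(face_point_rot b)
      -(face_point_rot c) /= subr0 subrr subKr.
Qed.

(** A face determines its walk only up to rotation and reversal, so one is chosen. *)
Definition face_walk (F : set (surface_space R Q)) : seq 'I_n :=
  xget [::] [set w | exists a b c d,
    [/\ Q a b c d, F = face_set a b c d & w = [:: a; b; c; d]]].

Lemma face_walkP F : face model F -> exists a b c d,
  [/\ Q a b c d, F = face_set a b c d & face_walk F = [:: a; b; c; d]].
Proof.
move=> /faceP[a [b [c [d [q e]]]]].
suff : [set w | exists a b c d,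
    [/\ Q a b c d, F = face_set a b c d & w = [:: a; b; c; d]]] (face_walk F) by [].
by apply: xgetPex; exists [:: a; b; c; d], a, b, c, d.
Qed.

Lemma face_boundary_walks : boundary_walks model face_walk.
Proof.
by move=> F /face_walkP[a [b [c [d [q -> ->]]]]]; exact: face_boundary_walk.
Qed.

Lemma face_quadrangular : quadrangular model face_walk.
Proof. by move=> F /face_walkP[a [b [c [d [_ _ ->]]]]]. Qed.

Lemma walk_edges4 a b c d : walk_edges [:: a; b; c; d] =
  [:: [set a; b]; [set b; c]; [set c; d]; [set d; a]]%SET.
Proof.
rewrite /walk_edges /image_mem !enum_ordSl enum_ord0 /= /walk_vertex.
by rewrite !(tnth_nth a).
Qed.

Lemma set2_eq u v u' v' : [set u; v]%SET = [set u'; v']%SET ->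
  (u = u' /\ v = v') \/ (u = v' /\ v = u').
Proof.
move=> e; have : u \in [set u'; v']%SET by rewrite -e finset.set21.
have : v \in [set u'; v']%SET by rewrite -e finset.set22.
have : u' \in [set u; v]%SET by rewrite e finset.set21.
have : v' \in [set u; v]%SET by rewrite e finset.set22.
rewrite !finset.in_set2 => /orP[]/eqP h1 /orP[]/eqP h2 /orP[]/eqP h3 /orP[]/eqP h4; subst;
  by [left | right].
Qed.

Definition edges4 a b c d : seq {set 'I_n} :=
  [:: [set a; b]; [set b; c]; [set c; d]; [set d; a]]%SET.

Lemma face_rebase a b c d x : Q a b c d -> x \in edges4 a b c d ->
  exists a' b' c' d', [/\ Q a' b' c' d', x = [set a'; b']%SET,
    face_set a b c d = face_set a' b' c' d' & {subset edges4 a b c d <= edges4 a' b' c' d'}].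
Proof.
have rot4 a1 b1 c1 d1 : face_set a1 b1 c1 d1 = face_set b1 c1 d1 a1.
  by apply/seteqP; split=> s h u; move: (h u); rewrite !inE => hu; move=> uu; apply: hu;
    case/or4P: uu => ->; rewrite ?orbT.
have sub4 a1 b1 c1 d1 : {subset edges4 a1 b1 c1 d1 <= edges4 b1 c1 d1 a1}.
  by move=> y; rewrite !inE => /or4P[] ->; rewrite ?orbT.
move=> q; have q2 := quad_rot QQ q; have q3 := quad_rot QQ q2; have q4 := quad_rot QQ q3.
rewrite [in X in X -> _]/edges4 !inE => /or4P[] /eqP ->.
- by exists a, b, c, d; split.
- by exists b, c, d, a; split.
- exists c, d, a, b; split => //; last by move=> y /sub4 /sub4.
  exact: etrans (rot4 _ _ _ _) (rot4 _ _ _ _).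
- exists d, a, b, c; split => //; last by move=> y /sub4 /sub4 /sub4.
Qed.

(** A second common edge adjacent to ab falls under [quad_corner], the opposite edge under
    [quad_corner] or [quad_cross] according to its direction; the other matchings contradict
    distinctness. *)
Lemma quad_shared_edge a b c d c' d' y : Q a b c d -> Q a b c' d' ->
  y \in edges4 a b c d -> y \in edges4 a b c' d' -> [set a; b]%SET <> y ->
  c = c' /\ d = d'.
Proof.
move=> q q'; have := quad_uniq QQ q; have := quad_uniq QQ q'.
rewrite /= !inE !negb_or => /and4P[/and3P[_ ac' ad'] /andP[bc' bd'] cd' _].
move=> /and4P[/and3P[ab ac ad] /andP[bc bd] cd _].
move=> /or4P[] /eqP -> /or4P[] /eqP // /set2_eq[][h1 h2] _; subst;
  rewrite ?eqxx in ab ac ad bc bd cd ac' ad' bc' bd' cd' => //.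
- by rewrite (quad_corner QQ q q').
- by case: (quad_cross QQ q q').
- have qd := quad_rot QQ (quad_rot QQ (quad_rot QQ q)).
  have qd' := quad_rot QQ (quad_rot QQ (quad_rot QQ q')).
  by rewrite (quad_corner QQ qd qd').
Qed.

Lemma face_shared_edges a b c d a' b' c' d' x y : Q a b c d -> Q a' b' c' d' ->
  x \in edges4 a b c d -> x \in edges4 a' b' c' d' ->
  y \in edges4 a b c d -> y \in edges4 a' b' c' d' -> x <> y ->
  face_set a b c d = face_set a' b' c' d'.
Proof.
move=> q q' xa xa' ya ya' xy.
have [a1 [b1 [c1 [d1 [q1 ex1 -> /(_ y ya) y1]]]]] := face_rebase q xa.
have [a2 [b2 [c2 [d2 [q2 ex2 -> /(_ y ya') y2]]]]] := face_rebase q' xa'.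
move: xy; rewrite ex1; move: ex2; rewrite ex1 => /set2_eq[][e1 e2] xy; subst.
  by have [-> ->] := quad_shared_edge q1 q2 y1 y2 xy.
have q3 := quad_rot QQ (quad_rot QQ (quad_rot QQ (quad_rev QQ q2))).
have y3 : y \in edges4 b2 a2 d2 c2.
  have sC u v : [set u; v]%SET = [set v; u]%SET by exact: finset.setUC.
  move: y2; rewrite !inE => /or4P[] /eqP ->; [rewrite (sC a2 b2) | rewrite (sC b2 c2) |
    rewrite (sC c2 d2) | rewrite (sC d2 a2)]; by rewrite eqxx ?orbT.
have [-> ->] := quad_shared_edge q1 q3 y1 y3 xy.
by apply/seteqP; split=> s h u; move: (h u); rewrite !inE => hu uu; apply: hu;
  case/or4P: uu => ->; rewrite ?orbT.
Qed.

Lemma face_face_simple : face_simple model face_walk.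
Proof.
split=> [F /face_walkP[a [b [c [d [q _ ->]]]]]|F F' /face_walkP[a [b [c [d [q -> ->]]]]]
    /face_walkP[a' [b' [c' [d' [q' -> ->]]]]] NF x y].
  rewrite walk_edges4; have := quad_uniq QQ q; rewrite /= !inE !negb_or.
  move=> /and4P[/and3P[ab ac ad] /andP[bc bd] cd _].
  apply/and4P; split => //; rewrite ?negb_or; [apply/and3P; split | apply/andP; split |];
    apply/eqP => /set2_eq[][h1 h2]; subst; by rewrite ?eqxx in ab ac ad bc bd cd.
rewrite !walk_edges4 => x1 x2 y1 y2; apply: contrapT => xy; apply: NF.
exact: (face_shared_edges q q' x1 x2 y1 y2).
Qed.

End Faces.

(** * Charts *)

Section Fan.
Variables (R : realType) (d : nat).
Hypothesis d4 : (4 <= d)%N.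
Implicit Types (P : R * R) (s t : R) (i k : nat).

(* The vectors (0, -1), (-1, 1), (0, 1), ..., (d - 3, 1) cut the plane into d *)
(* cyclically arranged convex sectors.                                        *)
Definition fan_vec k : R * R := if k == 0%N then (0, -1) else (k%:R - 2, 1).

(** The piecewise linear function that is 1 at the k-th vector, 0 at the other vectors and linear on
    each sector. The closed form with maxima and minima makes its continuity immediate; [m] is the
    abscissa of the last vector. *)
Definition fan_coord k P : R :=
  let m := d%:R - 3 in
  if k == 0%N then Num.max 0 (Num.max (- P.1) (P.1 / m) - P.2)
  else if k == 1%N then Num.max 0 (- P.1)
  else if k == d.-1 then Num.max 0 (Num.min (P.1 / m) (P.1 - (m - 1) * P.2))
  else Num.max 0 (P.2 - `|P.1 - (k%:R - 2) * P.2|).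

Definition sector_pt i s t : R * R :=
  (s * (fan_vec i).1 + t * (fan_vec (i.+1 %% d)).1,
   s * (fan_vec i).2 + t * (fan_vec (i.+1 %% d)).2).

Let m_ge1 : 1 <= d%:R - 3 :> R.
Proof. by have : 4%:R <= d%:R :> R by [rewrite ler_nat]; lra. Qed.

Let max0_0 (x : R) : x <= 0 -> Num.max 0 x = 0.
Proof. by move=> h; apply/max_idPl. Qed.

Let max0_id (x : R) : 0 <= x -> Num.max 0 x = x.
Proof. by move=> h; apply/max_idPr. Qed.

Let nat_lt i k : (i < k)%N -> i%:R + 1 <= k%:R :> R.
Proof. by rewrite natr1 ler_nat. Qed.

Lemma fan_coord_first s t k : (k < d)%N -> 0 <= s -> 0 <= t ->
  fan_coord k (- t, t - s) = if k == 0%N then s else if k == 1%N then t else 0.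
Proof.
have m1 := m_ge1; move=> kd s0 t0; rewrite /fan_coord /=.
have tm : - t / (d%:R - 3) <= 0 by rewrite ler_pdivrMr ?mul0r; lra.
move: (_ / _) tm => q q0; rewrite opprK.
have [_|k0] := eqVneq k 0%N; first by have -> : Num.max t q = t by [apply/max_idPl; lra]; rewrite max0_id; lra.
have [_|k1] := eqVneq k 1%N; first by rewrite max0_id; lra.
have [_|kd1] := eqVneq k d.-1; first by rewrite max0_0 // ge_min q0.
rewrite max0_0 // subr_le0.
have k2 : 2 <= k%:R :> R by rewrite ler_nat; lia.
have := ler_norm (- (- t - (k%:R - 2) * (t - s))); rewrite normrN.
have := normr_ge0 (- t - (k%:R - 2) * (t - s)).
move: `|_| => z; have [ts|ts] := lerP t s; first by lra.
by have : 0 <= (k%:R - 2) * (t - s) by [apply: mulr_ge0; lra]; lra.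
Qed.

Lemma fan_coord_last s t k : (k < d)%N -> 0 <= s -> 0 <= t ->
  fan_coord k (s * (d%:R - 3), s - t) =
  if k == d.-1 then s else if k == 0%N then t else 0.
Proof.
have m1 := m_ge1; move=> kd s0 t0; rewrite /fan_coord /=.
rewrite mulfK; last by lra.
have km : k != d.-1 -> k%:R - 2 <= d%:R - 3 - 1 :> R.
  by move=> kd1; have : k%:R + 2 <= d%:R :> R by [rewrite -natrD ler_nat; lia]; lra.
move: (d%:R - 3) m1 km => m m1 km; have sm : 0 <= s * m by apply: mulr_ge0; lra.
have [->|k0] := eqVneq k 0%N.
  rewrite ifN; last by lia.
  by have -> : Num.max (- (s * m)) s = s by [apply/max_idPr; lra]; rewrite max0_id; lra.
have [->|k1] := eqVneq k 1%N.
  rewrite ifN; last by lia.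
  by rewrite max0_0; lra.
have tm : 0 <= (m - 1) * t by apply: mulr_ge0; lra.
have [_|kd1] := eqVneq k d.-1.
  have -> : Num.min s (s * m - (m - 1) * (s - t)) = s by apply/min_idPl; lra.
  by rewrite max0_id.
rewrite max0_0 // subr_le0.
have k2 : 2 <= k%:R :> R by rewrite ler_nat; lia.
have := ler_norm (s * m - (k%:R - 2) * (s - t)).
have := normr_ge0 (s * m - (k%:R - 2) * (s - t)).
move: `|_| => z; have [st|st] := lerP s t; first by lra.
have : 0 <= (m - 1 - (k%:R - 2)) * (s - t); last by lra.
by apply: mulr_ge0; [have := km kd1|]; lra.
Qed.

Lemma fan_coord_middle i s t k : (0 < i)%N -> (i.+1 < d)%N -> (k < d)%N ->
  0 <= s -> 0 <= t ->
  fan_coord k (s * (i%:R - 2) + t * (i.+1%:R - 2), s + t) =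
  if k == i then s else if k == i.+1 then t else 0.
Proof.
have m1 := m_ge1; move=> i0 id kd s0 t0; rewrite /fan_coord /=.
have i1 : 1 <= i%:R :> R by rewrite (ler_nat _ 1).
have iS : i.+1%:R = i%:R + 1 :> R by rewrite natr1.
have im : i%:R <= d%:R - 3 + 1 :> R.
  by have : i%:R + 2 <= d%:R :> R by [rewrite -natrD ler_nat; lia]; lra.
have si : 0 <= s * (i%:R - 1) by apply: mulr_ge0; lra.
have ti : 0 <= t * (i%:R - 1) by apply: mulr_ge0; lra.
have sm : 0 <= s * (d%:R - 3 + 1 - i%:R) by apply: mulr_ge0; lra.
have tm : 0 <= t * (d%:R - 3 + 1 - i%:R) by apply: mulr_ge0; lra.
rewrite iS; have [->|k0] := eqVneq k 0%N.
  rewrite !ifN; try lia; rewrite max0_0 //.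
  rewrite subr_le0 ge_max; apply/andP; split; first by lra.
  by rewrite ler_pdivrMr; lra.
have [->|k1] := eqVneq k 1%N.
  have [ii|ii] := eqVneq 1%N i; first by rewrite -ii max0_id; lra.
  have i2 : 2 <= i%:R :> R by rewrite (ler_nat _ 2); lia.
  rewrite ifN; last by lia.
  have : 0 <= s * (i%:R - 2) by apply: mulr_ge0; lra.
  by move=> ?; rewrite max0_0; lra.
have [kd1|kd1] := eqVneq k d.-1.
  have [ki|ki] := eqVneq k i; first by lia.
  have [ki1|ki1] := eqVneq k i.+1.
    have e : i%:R = d%:R - 3 + 1 :> R.
      by have : i%:R + 2 = d%:R :> R by [rewrite -natrD; congr _%:R; lia]; lra.
    have sm1 : 0 <= s * (d%:R - 3 - 1) by apply: mulr_ge0; lra.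
    set q := (_ / _); have tq : t <= q by rewrite /q ler_pdivlMr ?e; lra.
    have -> : Num.min q (s * (i%:R - 2) + t * (i%:R + 1 - 2) -
      (d%:R - 3 - 1) * (s + t)) = t.
      have -> : s * (i%:R - 2) + t * (i%:R + 1 - 2) - (d%:R - 3 - 1) * (s + t) = t.
        by rewrite e; ring.
      exact/min_idPr.
    by rewrite max0_id.
  have i3 : i%:R <= d%:R - 3 :> R.
    by have : i%:R + 3 <= d%:R :> R by [rewrite -natrD ler_nat; lia]; lra.
  rewrite max0_0 // ge_min; apply/orP; right.
  have : 0 <= s * (d%:R - 3 - i%:R) by apply: mulr_ge0; lra.
  by have : 0 <= t * (d%:R - 3 - i%:R) by [apply: mulr_ge0; lra]; lra.
have -> : s * (i%:R - 2) + t * (i%:R + 1 - 2) - (k%:R - 2) * (s + t) =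
  s * (i%:R - k%:R) + t * (i%:R + 1 - k%:R) by ring.
have [->|ki] := eqVneq k i.
  have -> : s * (i%:R - i%:R) + t * (i%:R + 1 - i%:R) = t by ring.
  by rewrite ger0_norm // max0_id; lra.
have [->|ki1] := eqVneq k i.+1.
  rewrite iS; have -> : s * (i%:R - (i%:R + 1)) + t * (i%:R + 1 - (i%:R + 1)) = - s by ring.
  by rewrite normrN ger0_norm // max0_id; lra.
rewrite max0_0 // subr_le0.
have [lt_ki|lt_ik] : (k < i)%N \/ (i.+1 < k)%N by lia.
  apply: le_trans (ler_norm _); have := nat_lt lt_ki => h.
  have : 0 <= s * (i%:R - k%:R - 1) by apply: mulr_ge0; lra.
  by have : 0 <= t * (i%:R - k%:R - 1) by [apply: mulr_ge0; lra]; lra.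
rewrite -normrN; apply: le_trans (ler_norm _); have := nat_lt lt_ik; rewrite iS => h.
have : 0 <= s * (k%:R - i%:R - 2) by apply: mulr_ge0; lra.
by have : 0 <= t * (k%:R - i%:R - 2) by [apply: mulr_ge0; lra]; lra.
Qed.

Lemma sector_ptE i s t : (i < d)%N -> sector_pt i s t =
  if i == 0%N then (- t, t - s) else if i == d.-1 then (s * (d%:R - 3), s - t)
  else (s * (i%:R - 2) + t * (i.+1%:R - 2), s + t).
Proof.
move=> id; rewrite /sector_pt /fan_vec.
have [->|i0] := eqVneq i 0%N.
  by rewrite modn_small /=; [congr pair; ring | lia].
have [->|i1] := eqVneq i d.-1.
  rewrite prednK; last by lia.
  rewrite modnn /= -[d in RHS]prednK; last by lia.
  by rewrite -natr1; congr pair; ring.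
by rewrite modn_small /=; [congr pair; ring | lia].
Qed.

Lemma fan_coord_sector i k s t : (i < d)%N -> (k < d)%N -> 0 <= s -> 0 <= t ->
  fan_coord k (sector_pt i s t) =
  if k == i then s else if k == (i.+1 %% d)%N then t else 0.
Proof.
move=> id kd s0 t0; rewrite sector_ptE //.
have [->|i0] := eqVneq i 0%N; first by rewrite modn_small ?fan_coord_first //; exact: ltn_trans d4.
have [->|i1] := eqVneq i d.-1.
  by rewrite prednK ?modnn ?fan_coord_last //; exact: ltn_trans d4.
have id1 : (i.+1 < d)%N by lia.
by rewrite modn_small ?fan_coord_middle // lt0n.
Qed.

Lemma sector_surj P : exists i s t,
  [/\ (i < d)%N, 0 <= s, 0 <= t & P = sector_pt i s t].
Proof.
have m1 := m_ge1; case: P => x y.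
have mgt0 : 0 < d%:R - 3 :> R by lra.
have [x0|x0] := lerP x 0.
  have [xy|xy] := lerP x (- y).
    exists 0%N, (- x - y), (- x); rewrite sector_ptE ?eqxx; last by lia.
    by split; [lia | lra | lra | congr pair; ring].
  exists 1%N, (- x), (x + y); rewrite sector_ptE; last by lia.
  rewrite ifN ?ifN; try lia.
  by split; [lia | lra | lra | congr pair; ring].
have [xy|xy] := lerP ((d%:R - 3) * y) x.
  exists d.-1, (x / (d%:R - 3)), (x / (d%:R - 3) - y).
  rewrite sector_ptE ?eqxx; last by lia.
  rewrite ifN; last by lia.
  split; [lia | by apply: divr_ge0; lra | | by rewrite divfK ?gt_eqF //; congr pair; ring].
  by rewrite subr_ge0 ler_pdivlMr // mulrC.
have y0 : 0 < y by nra.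
(* The sector is found as the least i such that P does not lie to the right of the vector (i - 1,
   1), which is the one with index i + 1. *)
have ex : exists i, x <= (i%:R - 1) * y.
  exists d; apply: le_trans (ltW xy) _; rewrite ler_wpM2r //; lra.
case: (ex_minnP ex) => i xi imin.
have i2 : (1 < i)%N.
  rewrite ltnNge; apply/negP => i1; have : i%:R <= 1 :> R by rewrite (ler_nat _ _ 1).
  by move=> ?; have : 0 <= (1 - i%:R) * y by [apply: mulr_ge0; lra]; lra.
have id : (i.+1 < d)%N.
  have : (i <= d - 2)%N; last by lia.
  apply: imin; rewrite natrB; last by lia.
  by apply: le_trans (ltW xy) _; rewrite ler_wpM2r //; lra.
have xi1 : (i%:R - 2) * y < x.
  rewrite ltNge; apply/negP => xi1; have := imin i.-1.
  have -> : i.-1%:R = i%:R - 1 :> R by rewrite -subn1 natrB //; lia.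
  by have -> : i%:R - 1 - 1 = i%:R - 2 :> R by [ring] => /(_ xi1); lia.
exists i, ((i%:R - 1) * y - x), (x - (i%:R - 2) * y).
rewrite sector_ptE; last by lia.
rewrite ifN ?ifN; try lia.
by split; [lia | lra | lra | rewrite -natr1; congr pair; ring].
Qed.

Lemma fan_coord_continuous k : continuous (fan_coord k).
Proof.
have c1 : continuous (@fst R R) by move=> ?; exact: cvg_fst.
have c2 : continuous (@snd R R) by move=> ?; exact: cvg_snd.
have cc (x : R) : continuous (fun _ : R * R => x) by move=> ?; exact: cvg_cst.
have cM (f g : R * R -> R) : continuous f -> continuous g ->
    continuous (fun P => Num.max (f P) (g P)).
  by move=> cf cg x; apply: continuous_max; [exact: cf | exact: cg].
have cm (f g : R * R -> R) : continuous f -> continuous g ->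
    continuous (fun P => Num.min (f P) (g P)).
  by move=> cf cg x; apply: continuous_min; [exact: cf | exact: cg].
have co := @continuous_opp R; have ca := @continuous_add R; have cx := @continuous_mul R.
rewrite /fan_coord; case: (k == 0%N); [|case: (k == 1%N); [|case: (k == d.-1)]].
- exact: (cM _ _ (cc 0) (ca _ _ _ (cM _ _ (co _ _ c1) (cx _ _ _ c1 (cc _))) (co _ _ c2))).
- exact: (cM _ _ (cc 0) (co _ _ c1)).
- exact: (cM _ _ (cc 0) (cm _ _ (cx _ _ _ c1 (cc _))
    (ca _ _ _ c1 (co _ _ (cx _ _ _ (cc _) c2))))).
- apply: (cM _ _ (cc 0) (ca _ _ _ c2 (co _ _ _))) => P; apply: cvg_norm.
  exact: (ca _ _ _ c1 (co _ _ (cx _ _ _ (cc _) c2))).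
Qed.

End Fan.

Definition link_cycle (V : eqType) (Q : V -> V -> V -> V -> Prop) (v : V) (s : seq V) :=
  [/\ uniq s, (4 <= size s)%N,
      forall i, (i < size s)%N ->
        exists c, Q v (nth v s i) c (nth v s (i.+1 %% size s)) &
      forall a c b, Q v a c b -> exists2 i, (i < size s)%N &
        (a = nth v s i /\ b = nth v s (i.+1 %% size s)) \/
        (b = nth v s i /\ a = nth v s (i.+1 %% size s))].

Section SectorSums.
Variables (R : realType) (d : nat) (i : nat) (x y : R).
Hypotheses (d4 : (4 <= d)%N) (id : (i < d)%N).
Local Notation i' := (i.+1 %% d)%N.

Definition sector_coef k : R := if k == i then x else if k == i' then y else 0.

Lemma succ_mod k : (k < d)%N -> (k.+1 %% d = if k.+1 == d then 0 else k.+1)%N.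
Proof.
move=> kd; case: eqP => [->|kd1]; first by rewrite modnn.
by rewrite modn_small; lia.
Qed.

Lemma sum_sector (V : lmodType R) (p : nat -> V) :
  \sum_(k < d) sector_coef k *: p k = x *: p i + y *: p i'.
Proof.
have i'd : (i' < d)%N by rewrite ltn_mod; lia.
have ii' : i' != i by rewrite succ_mod //; case: (_ =P d); lia.
rewrite (bigD1 (Ordinal id)) //= (bigD1 (Ordinal i'd)) //= big1 ?addr0.
  by rewrite /sector_coef !eqxx (negbTE ii').
move=> k /andP[]; rewrite -!val_eqE /= /sector_coef => /negbTE -> /negbTE ->.
by rewrite scale0r.
Qed.

Lemma sum_sector2 (V : lmodType R) (p : nat -> V) :
  \sum_(k < d) (sector_coef k * sector_coef (k.+1 %% d)%N) *: p k = (x * y) *: p i.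
Proof.
have ii' : i' != i by rewrite succ_mod //; case: (_ =P d); lia.
rewrite (bigD1 (Ordinal id)) //= big1 ?addr0.
  by rewrite /sector_coef !eqxx (negbTE ii').
move=> k; rewrite -!val_eqE /= => ki.
suff -> : sector_coef k * sector_coef (k.+1 %% d)%N = 0 by rewrite scale0r.
rewrite /sector_coef (negbTE ki); case: eqP => [ki'|]; last by rewrite mul0r.
have -> : ((k.+1 %% d)%N == i) = false.
  by move: ki'; rewrite !succ_mod //; case: (i.+1 =P d); case: (k.+1 =P d); lia.
have -> : ((k.+1 %% d)%N == i') = false.
  by move: ki'; rewrite !succ_mod //; case: (i.+1 =P d); case: (k.+1 =P d); lia.
by rewrite mulr0.
Qed.

End SectorSums.

Section Chart.
Variables (R : realType) (n : nat) (Q : 'I_n -> 'I_n -> 'I_n -> 'I_n -> Prop).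
Hypothesis QQ : quadrangles Q.
Variable s0 : surface_space R Q.
Variables (v : 'I_n) (s : seq 'I_n).
Hypothesis sv : link_cycle Q v s.
Variable opp : nat -> 'I_n.
Local Notation d := (size s).
Local Notation nxt i := (i.+1 %% size s)%N.
Hypothesis oppP : forall i, (i < d)%N -> Q v (nth v s i) (opp i) (nth v s (nxt i)).
Implicit Types (w : 'rV[R]_n) (i j k : nat) (x y : R).

Let d4 : (4 <= d)%N. Proof. by case: sv. Qed.
Let us : uniq s. Proof. by case: sv. Qed.
Let nxt_lt i : (nxt i < d)%N. Proof. by rewrite ltn_mod; have := d4; lia. Qed.

Definition ratio w k := w 0 (nth v s k) / w 0 v.

(** A neighbour of [v] may also be opposite [v] in some faces at [v]. On such a face its ratio is
    the product of the ratios of the two neighbours of [v] there, and this contribution is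
    subtracted. Where the subtraction exceeds the ratio, the maximum with 0 restores the value 0. *)
Definition chart_coord k w : R :=
  Num.max 0 (ratio w k -
    \sum_(j < d) (opp j == nth v s k)%:R * (ratio w j * ratio w (nxt j))).

(** The parameters are chosen so that the ratios of the weights to that of [v] are x, y and, at the
    opposite vertex, xy. As x and y range over the nonnegative reals, the points fill the part of
    the patch where [v] has positive weight. *)
Definition star_point i x y : 'rV[R]_n :=
  quad_point v (nth v s i) (opp i) (nth v s (nxt i)) (x / (1 + x), y / (1 + y)).

Lemma star_sq x y : 0 <= x -> 0 <= y -> sq (x / (1 + x), y / (1 + y)).
Proof.
move=> x0 y0; split=> /=; rewrite ?divr_ge0 ?addr_ge0 ?ler01 //;
  rewrite ler_pdivrMr; lra.
Qed.

Lemma star_point_ratio i k x y : (i < d)%N -> (k < d)%N -> 0 <= x -> 0 <= y ->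
  ratio (star_point i x y) k =
  x * (nth v s k == nth v s i)%:R + x * y * (nth v s k == opp i)%:R
  + y * (nth v s k == nth v s (nxt i))%:R.
Proof.
move=> id kd x0 y0; have abcd := quad_uniq QQ (oppP id).
have kv : (nth v s k == v) = false.
  apply/negbTE; have [_ _ h _] := sv; have [c q] := h _ kd.
  by have [] := quad_neq QQ q; rewrite eq_sym.
rewrite /ratio (quad_point_a abcd) quad_point_coord kv /=.
by field; apply/and3P; split; apply: lt0r_neq0; lra.
Qed.

Lemma star_point_v i x y : (i < d)%N -> 0 <= x -> 0 <= y -> 0 < star_point i x y 0 v.
Proof.
move=> id x0 y0; rewrite (quad_point_a (quad_uniq QQ (oppP id))) /=.
by rewrite mulr_gt0 // subr_gt0 ltr_pdivrMr; lra.
Qed.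

Lemma chart_coord_star i k x y : (i < d)%N -> (k < d)%N -> 0 <= x -> 0 <= y ->
  chart_coord k (star_point i x y) = sector_coef d i x y k.
Proof.
move=> id kd x0 y0; rewrite /chart_coord /sector_coef.
set r := ratio _.
have rE j : (j < d)%N -> r j = x * (nth v s j == nth v s i)%:R
    + x * y * (nth v s j == opp i)%:R + y * (nth v s j == nth v s (nxt i))%:R.
  by move=> jd; exact: star_point_ratio.
have r0 j : (j < d)%N -> 0 <= r j.
  by move=> jd; rewrite rE // !addr_ge0 // !mulr_ge0.
have ui := quad_uniq QQ (oppP id).
have qi := quad_rot QQ (quad_rot QQ (quad_rot QQ (oppP id))).
set T := \sum_(j < d) _.
(* A face at [v] opposite to a neighbour u of [v] in face i contributes only if both its other
   neighbours of [v] lie in face i. One of them would be the opposite vertex, so the two faces would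
   have the same vertices in crossing orders. *)
have T0 u : u = nth v s i \/ u = nth v s (nxt i) -> nth v s k = u -> T = 0.
  move=> uu ku; apply: big1 => j _; rewrite ku.
  have [ju|] := eqVneq (opp j) u; last by rewrite mul0r.
  have jd := ltn_ord j; have qj := oppP jd; have uj := quad_uniq QQ qj.
  have cross a b : nth v s j = a -> nth v s (nxt j) = b ->
      (a = opp i /\ (b = nth v s i \/ b = nth v s (nxt i))) \/
      (b = opp i /\ (a = nth v s i \/ a = nth v s (nxt i))) -> False.
    move=> ea eb; rewrite ea eb ju in qj.
    have rj := quad_rev QQ qj; have ri := quad_rev QQ (oppP id); have qi' := oppP id.
    have := quad_uniq QQ qj; rewrite /= !inE !negb_or.
    case/andP=> [_ /andP[/andP[nab _] /andP[nbc _]]].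
    by case: uu => eu [[e1 [e2|e2]]|[e1 [e2|e2]]]; rewrite e1 e2 eu ?eqxx // in qj rj nab nbc;
      first [exact: (quad_cross QQ qj qi') | exact: (quad_cross QQ rj qi')
        | exact: (quad_cross QQ qj ri) | exact: (quad_cross QQ rj ri)].
  have rne l : (l < d)%N -> r l != 0 ->
      [\/ nth v s l = opp i, nth v s l = nth v s i | nth v s l = nth v s (nxt i)].
    move=> ld; rewrite rE //.
    have [->|h1] := eqVneq (nth v s l) (opp i); first by constructor 1.
    have [->|h2] := eqVneq (nth v s l) (nth v s i); first by constructor 2.
    have [->|h3] := eqVneq (nth v s l) (nth v s (nxt i)); first by constructor 3.
    by rewrite !mulr0 !addr0 eqxx.
  suff -> : r j * r (nxt j) = 0 by rewrite mulr0.
  apply/eqP; rewrite mulf_eq0; apply/negPn/negP; rewrite negb_or.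
  case/andP => /(rne _ jd) hj /(rne _ (nxt_lt j)) hn.
  have := uj; rewrite ju /= !inE !negb_or.
  case/andP=> _ /andP[/andP[nju njn] /andP[nun _]].
  by case: hj hn => ej [] en; [
    move: njn; rewrite ej en eqxx
  | apply: (cross _ _ ej en); left; split => //; left
  | apply: (cross _ _ ej en); left; split => //; right
  | apply: (cross _ _ ej en); right; split => //; left
  | move: njn; rewrite ej en eqxx
  | case: uu => eu; [move: nju; rewrite ej eu eqxx | move: nun; rewrite en eu eqxx]
  | apply: (cross _ _ ej en); right; split => //; right
  | case: uu => eu; [move: nun; rewrite en eu eqxx | move: nju; rewrite ej eu eqxx]
  | move: njn; rewrite ej en eqxx].
have := ui; rewrite /= !inE !negb_or.
case/andP=> _ /andP[/andP[n1 n2] /andP[n3 _]].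
have [ki|ki] := eqVneq k i.
  rewrite (T0 (nth v s i) _ (congr1 _ ki)) ?subr0; last by left.
  rewrite rE // ki eqxx (negbTE n1) (negbTE n2) !mulr0 !addr0 mulr1.
  exact/max_idPr.
have [kn|kn] := eqVneq k (nxt i).
  rewrite (T0 (nth v s (nxt i)) _ (congr1 _ kn)) ?subr0; last by right.
  rewrite rE // kn eqxx [nth v s (nxt i) == opp i]eq_sym (negbTE n3).
  rewrite [nth v s (nxt i) == nth v s i]eq_sym (negbTE n2) !mulr0 !add0r mulr1.
  exact/max_idPr.
apply/max_idPl; rewrite subr_le0.
have nki : (nth v s k == nth v s i) = false by rewrite nth_uniq // (negbTE ki).
have nkn : (nth v s k == nth v s (nxt i)) = false by rewrite nth_uniq // (negbTE kn).
have Tge0 (P : pred 'I_d) :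
    0 <= \sum_(j < d | P j) (opp j == nth v s k)%:R * (r j * r (nxt j)).
  by apply: sumr_ge0 => j _; apply: mulr_ge0 => //; apply: mulr_ge0; apply: r0.
rewrite (rE k) // nki nkn !mulr0 add0r addr0.
have [ko|_] := eqVneq (nth v s k) (opp i); last by rewrite mulr0 Tge0.
(* The term of face i alone already equals the ratio xy of its opposite vertex, and the other terms
   are nonnegative. *)
rewrite /T (bigD1 (Ordinal id)) //= -ko eqxx mul1r mulr1.
rewrite (rE i) // (rE (nxt i)) // !eqxx (negbTE n1) (negbTE n2).
rewrite [nth v s (nxt i) == opp i]eq_sym (negbTE n3) [nth v s (nxt i) == nth v s i]eq_sym.
by rewrite (negbTE n2) !mulr0 !addr0 !add0r !mulr1 lerDl Tge0.
Qed.

Lemma star_pointP w : surface_set Q w -> 0 < w 0 v ->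
  exists i x y, [/\ (i < d)%N, 0 <= x, 0 <= y & w = star_point i x y].
Proof.
move=> Aw wv; have [b [c [e [p [q sp ew]]]]] := surface_rebase QQ Aw (lt0r_neq0 wv).
have [i [i' [p' [id [q' sp' ew']]]]] : exists i (i' : 'I_n) (p' : R * R), (i < d)%N /\
    [/\ Q v (nth v s i) i' (nth v s (nxt i)), sq p' &
    w = quad_point v (nth v s i) i' (nth v s (nxt i)) p'].
  have [_ _ _ h] := sv; have [i id [[e1 e2]|[e1 e2]]] := h _ _ _ q.
    by exists i, c, p; split => //; split => //; rewrite -e1 -e2.
  exists i, c, (p.2, p.1); split => //; rewrite -e1 -e2.
  by split; [exact: (quad_rev QQ) | exact: sq_rev | rewrite quad_point_rev].
have e' : i' = opp i.
  apply: (quad_corner QQ (a := nth v s (nxt i)) (b := v) (c := nth v s i)).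
    exact: (quad_rot QQ (quad_rot QQ (quad_rot QQ q'))).
  exact: (quad_rot QQ (quad_rot QQ (quad_rot QQ (oppP id)))).
rewrite e' in q' ew'.
move: wv; rewrite ew' (quad_point_a (quad_uniq QQ q')) => pv.
case: sp' => p1 p2 p3 p4.
have p1' : p'.1 < 1 by nra.
have p2' : p'.2 < 1 by nra.
have k1 : 1 - p'.1 != 0 by apply: lt0r_neq0; lra.
have k2 : 1 - p'.2 != 0 by apply: lt0r_neq0; lra.
exists i, (p'.1 / (1 - p'.1)), (p'.2 / (1 - p'.2)).
split=> //; try (apply: divr_ge0; lra).
rewrite /star_point; congr quad_point; rewrite [LHS]surjective_pairing.
by congr pair; field; rewrite ?k1 ?k2 //; apply/andP; split=> //; apply: lt0r_neq0; lra.
Qed.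

Lemma inv_continuous_within (T : topologicalType) (A : set T) (f : T -> R) :
  {within A, continuous f} -> (forall t, A t -> f t != 0) ->
  {within A, continuous (fun t => (f t)^-1)}.
Proof.
move=> cf f0; apply: (within_continuous_comp2 (B := [set x : R | x != 0]) cf) => //.
apply: continuous_in_subspaceT => x; rewrite inE /= => x0.
exact: inv_continuous.
Qed.

Definition pos_at : set 'rV[R]_n := [set w | 0 < w 0 v].

Lemma chart_coord_continuous k : {within pos_at, continuous (chart_coord k)}.
Proof.
have cr l : {within pos_at, continuous (fun w => ratio w l)}.
  apply: (@continuous_mul R (subspace pos_at)).
    exact/continuous_subspaceT/coord_continuous.
  apply: inv_continuous_within; first exact/continuous_subspaceT/coord_continuous.
  by move=> w; exact: lt0r_neq0.
have cs : {within pos_at, continuous (fun w => \sum_(j < d)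
    (opp j == nth v s k)%:R * (ratio w j * ratio w (nxt j)))}.
  apply: (@continuous_sum R (subspace pos_at)) => j.
  apply: (@continuous_mul R (subspace pos_at)); first exact: cst_continuous.
  by apply: (@continuous_mul R (subspace pos_at)); exact: cr.
move=> w; apply: (@continuous_max R (subspace pos_at) (fun=> 0)
  (fun w => ratio w k - \sum_(j < d)
    (opp j == nth v s k)%:R * (ratio w j * ratio w (nxt j)))); first exact: cst_continuous.
apply: (@continuous_add R (subspace pos_at)); first exact: cr.
exact: (@continuous_opp R (subspace pos_at)) cs.
Qed.

Definition chart w : R * R :=
  (\sum_(k < d) chart_coord k w * (fan_vec R k).1,
   \sum_(k < d) chart_coord k w * (fan_vec R k).2).

Lemma chart_continuous : {within pos_at, continuous chart}.
Proof.
have cc k (a : R) : continuous (fun w : subspace pos_at => chart_coord k w * a).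
  apply: (@continuous_mul R (subspace pos_at)); first exact: chart_coord_continuous.
  exact: cst_continuous.
by apply: (@continuous_pair (subspace pos_at));
  apply: (@continuous_sum R (subspace pos_at)) => k; exact: cc.
Qed.

Lemma chart_star i x y : (i < d)%N -> 0 <= x -> 0 <= y ->
  chart (star_point i x y) = sector_pt d i x y.
Proof.
move=> id x0 y0; rewrite /chart /sector_pt.
have e (k : 'I_d) : chart_coord k (star_point i x y) = sector_coef d i x y k.
  by rewrite chart_coord_star.
by congr pair; under eq_bigr do rewrite e;
  [exact: (@sum_sector R d i x y d4 id R^o (fun k => (fan_vec R k).1)) |
   exact: (@sum_sector R d i x y d4 id R^o (fun k => (fan_vec R k).2))].
Qed.

Definition unchart_sum (P : R * R) : R :=
  1 + \sum_(k < d) fan_coord d k P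
    + \sum_(k < d) fan_coord d k P * fan_coord d (nxt k) P.

(** The inverse of the chart: weight 1 at [v], the fan coordinates at its neighbours, products of
    consecutive ones at the opposite vertices, all divided by the total. In a sector only two
    coordinates, and hence only one product, can be nonzero. *)
Definition unchart (P : R * R) : 'rV[R]_n := (unchart_sum P)^-1 *:
  (vertex_weight R v + \sum_(k < d) fan_coord d k P *: vertex_weight R (nth v s k)
   + \sum_(k < d) (fan_coord d k P * fan_coord d (nxt k) P) *: vertex_weight R (opp k)).

Lemma unchart_sector i x y : (i < d)%N -> 0 <= x -> 0 <= y ->
  unchart (sector_pt d i x y) = star_point i x y.
Proof.
move=> id x0 y0.
have e (k : 'I_d) : fan_coord d k (sector_pt d i x y) = sector_coef d i x y k.
  by rewrite fan_coord_sector.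
have e' (k : 'I_d) :
    fan_coord d (nxt k) (sector_pt d i x y) = sector_coef d i x y (nxt k).
  by rewrite fan_coord_sector.
have S3 (V : lmodType R) (p : nat -> V) :
    \sum_(k < d) fan_coord d k (sector_pt d i x y) *: p k = x *: p i + y *: p (nxt i).
  by under eq_bigr do rewrite e; exact: sum_sector.
have S4 (V : lmodType R) (p : nat -> V) :
    \sum_(k < d) (fan_coord d k (sector_pt d i x y) *
      fan_coord d (nxt k) (sector_pt d i x y)) *: p k = (x * y) *: p i.
  by under eq_bigr do rewrite e e'; exact: sum_sector2.
have S1 : \sum_(k < d) fan_coord d k (sector_pt d i x y) = x + y.
  have := S3 R^o (fun=> 1); rewrite /GRing.scale /= !mulr1 => <-.
  by apply: eq_bigr => k _; rewrite mulr1.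
have S2 : \sum_(k < d) fan_coord d k (sector_pt d i x y) *
    fan_coord d (nxt k) (sector_pt d i x y) = x * y.
  have := S4 R^o (fun=> 1); rewrite /GRing.scale /= !mulr1 => <-.
  by apply: eq_bigr => k _; rewrite mulr1.
rewrite /unchart /unchart_sum S1 S2.
rewrite (S3 _ (fun k => vertex_weight R (nth v s k))) (S4 _ (fun k => vertex_weight R (opp k))).
apply/rowP => j; rewrite quad_point_coord !mxE !eqxx /=.
by field; apply/and3P; split; apply: lt0r_neq0; nra.
Qed.

Lemma star_point_surface i x y : (i < d)%N -> 0 <= x -> 0 <= y ->
  surface_set Q (star_point i x y).
Proof.
move=> id x0 y0; exists v, (nth v s i), (opp i), (nth v s (nxt i)).
by exists (x / (1 + x), y / (1 + y)); split; [exact: oppP | exact: star_sq |].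
Qed.

Lemma fan_coord_ge0 k (P : R * R) : 0 <= fan_coord d k P.
Proof. by rewrite /fan_coord; do 3?case: ifP => _; rewrite le_max lexx. Qed.

Lemma unchart_sum_gt0 P : 0 < unchart_sum P.
Proof.
rewrite /unchart_sum -addrA ltr_wpDr // addr_ge0 // sumr_ge0 // => k _;
  by rewrite ?mulr_ge0 // fan_coord_ge0.
Qed.

Lemma unchart_continuous : continuous unchart.
Proof.
have cf k := @fan_coord_continuous R d k.
have cc (x : R) : continuous (fun _ : R * R => x) by move=> ?; exact: cvg_cst.
have csum : continuous unchart_sum.
  apply: continuous_add; first apply: continuous_add => //.
    by apply: continuous_sum => k; exact: cf.
  by apply: continuous_sum => k; apply: continuous_mul; exact: cf.
have cinv : continuous (fun P => (unchart_sum P)^-1).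
  move=> P; apply: (@cvgV R); last exact: csum.
  by rewrite gt_eqF // unchart_sum_gt0.
apply: mx_continuous => a j.
rewrite (_ : (fun t => _) = (fun P => (unchart_sum P)^-1 *
  (vertex_weight R v a j + \sum_(k < d) fan_coord d k P * vertex_weight R (nth v s k) a j
   + \sum_(k < d) (fan_coord d k P * fan_coord d (nxt k) P) * vertex_weight R (opp k) a j))).
  apply: continuous_mul => //; apply: continuous_add; first apply: continuous_add => //.
    by apply: continuous_sum => k; apply: continuous_mul => //; exact: cf.
  apply: continuous_sum => k; apply: continuous_mul => //.
  by apply: continuous_mul; exact: cf.
apply/funext => P; rewrite /unchart mxE; congr (_ * _).
rewrite !mxE !summxE; congr (_ + _ + _); apply: eq_bigr => k _; by rewrite !mxE.
Qed.

Lemma star_homeomorphic :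
  homeomorphic [set t : surface_space R Q | 0 < weights t 0 v] [set: R * R].
Proof.
exists (chart \o @weights R n Q).
apply: (@homeomorphism_cancel _ _ _ _ _ (to_surface s0 \o unchart)).
- apply: (within_continuous_comp2 (B := pos_at)) chart_continuous _.
    exact/continuous_subspaceT/weights_continuous.
  by [].
- apply: to_surface_continuous; first exact/continuous_subspaceT/unchart_continuous.
  move=> P _; have [i [x [y [id x0 y0 ->]]]] := sector_surj d4 P.
  by rewrite unchart_sector //; exact: star_point_surface.
- move=> t /= tv; split=> //; apply: weights_inj.
  have [i [x [y [id x0 y0 e]]]] := star_pointP (weights_surface t) tv.
  rewrite e chart_star // unchart_sector // to_surfaceK //.
  exact: star_point_surface.
- move=> P _; have [i [x [y [id x0 y0 ->]]]] := sector_surj d4 P.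
  rewrite /= unchart_sector // to_surfaceK ?chart_star //; last exact: star_point_surface.
  by split=> //; exact: star_point_v.
Qed.

End Chart.

Section Surface.
Variables (R : realType) (n : nat) (Q : 'I_n -> 'I_n -> 'I_n -> 'I_n -> Prop).
Hypothesis QQ : quadrangles Q.
Hypothesis link : forall v, exists s, link_cycle Q v s.

Lemma quads_locally_planar : locally_planar R (surface_space R Q).
Proof.
move=> t; have [v tv] : exists v, 0 < weights t 0 v.
  have [a [b [c [d [p [q sp ew]]]]]] := weights_surface t.
  apply: contrapT => h; have wz u : weights t 0 u = 0.
    apply/eqP; rewrite eq_le; apply/andP; split.
      by rewrite leNgt; apply/negP => ?; apply: h; exists u.
    by rewrite ew quad_point_ge0.
  have := wz a; have := wz b; have := wz c; have := wz d; rewrite ew.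
  have abcd := quad_uniq QQ q.
  rewrite (quad_point_a abcd) (quad_point_b abcd) (quad_point_c abcd) (quad_point_d abcd).
  move=> e4 e3 e2 e1; have /eqP[] := oner_neq0 R.
  rewrite (_ : 1 = (1 - p.1) * (1 - p.2) + p.1 * (1 - p.2) + p.1 * p.2 + (1 - p.1) * p.2).
    by rewrite e1 e2 e3 e4 !addr0.
  by ring.
have [s sv] := link v; exists [set r | 0 < weights r 0 v], setT; split=> //.
- apply: (@open_comp _ _ (fun r : surface_space R Q => weights r 0 v) [set x : R | 0 < x]).
    by move=> r _; exact: weight_continuous.
  exact: open_gt.
- exact: openT.
have [_ _ h _] := sv.
have [opp oppP] : exists opp : nat -> 'I_n, forall i, (i < size s)%N ->
    Q v (nth v s i) (opp i) (nth v s (i.+1 %% size s)).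
  have [opp oppP] := choice (fun i : 'I_(size s) => h i (ltn_ord i)).
  exists (fun i => if insub i is Some j then opp j else v) => i id.
  rewrite (insubT (fun i => i < size s)%N id); exact: (oppP (Ordinal id)).
exact: star_homeomorphic oppP.
Qed.

Lemma quads_surface (s0 : surface_space R Q) (hub : 'I_n) :
  (forall a, a != hub -> quad_adj Q hub a) -> surface R (surface_space R Q).
Proof.
move=> hubP; split.
- exact: surface_hausdorff.
- exact: (surface_compact s0).
- exact: (surface_connected s0 hubP).
- exact: quads_locally_planar.
Qed.

End Surface.

(** * A Moebius band *)

Definition hats (F : numFieldType) (x h0 h1 h2 h3 : F) : Prop :=
  [\/ [/\ 3 * x <= 1, h0 = 1 - 3 * x, h1 = 3 * x, h2 = 0 & h3 = 0],
      [/\ 1 <= 3 * x <= 2, h0 = 0, h1 = 2 - 3 * x, h2 = 3 * x - 1 & h3 = 0] |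
      [/\ 2 <= 3 * x, h0 = 0, h1 = 0, h2 = 3 - 3 * x & h3 = 3 * x - 2]].

(** A point of the strip is recovered from five of its weights, case by case over the thirds that x
    and x' lie in. The factors i and i' are the normalizations, known to be 1 except in the interior
    of the last third. The two thirds that do not follow each other meet only in the glued sides. *)
Lemma strip_params (F : realFieldType) (x x' u u' i i' h0 h1 h2 h3 k0 k1 k2 k3 : F) :
  hats x h0 h1 h2 h3 -> hats x' k0 k1 k2 k3 -> 0 < u < 1 -> 0 < u' < 1 -> 0 < i -> 0 < i' ->
  (3 * x <= 2 -> i = 1) -> (3 * x' <= 2 -> i' = 1) -> (x = 1 -> i = 1) -> (x' = 1 -> i' = 1) ->
  [/\ i * (h0 * (1 - u) + h2 * u + h3 * u) = i' * (k0 * (1 - u') + k2 * u' + k3 * u'),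
      i * (h0 * u + h3 * (1 - u)) = i' * (k0 * u' + k3 * (1 - u')),
      i * (h1 * (1 - u)) = i' * (k1 * (1 - u')),
      i * (h1 * u) = i' * (k1 * u') &
      i * (h2 * (1 - u)) = i' * (k2 * (1 - u'))] ->
  [\/ x = x' /\ u = u', [/\ x = 0, x' = 1 & u = 1 - u'] | [/\ x = 1, x' = 0 & u = 1 - u']].
Proof.
have z0 (a b : F) : 0 < b -> a * b = 0 -> a = 0.
  by move=> b0' /eqP; rewrite mulf_eq0 (gt_eqF b0') orbF => /eqP.
move=> X X' /andP[pu u1] /andP[pu' u1'] i0 i0' tE tE' tp1 tq1.
have nu : 0 < 1 - u by lra.
have nu' : 0 < 1 - u' by lra.
case: X => -[hp -> -> -> ->]; case: X' => -[hq -> -> -> ->];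
  rewrite ?(mul0r, mulr0, addr0, add0r); case=> E1 E2 E3 E4 E5.
- have i1 := tE ltac:(lra); have i1' := tE' ltac:(lra); rewrite i1 i1' !mul1r in E1 E2 E3 E4 E5.
  by constructor 1; split; lra.
- have i1 := tE ltac:(lra); have i1' := tE' ltac:(lra); rewrite i1 i1' !mul1r in E1 E2 E3 E4 E5.
  have hx := z0 _ _ nu' (esym E5); have hx' : 3 * x' = 1 by lra.
  rewrite hx' in E3 E4; have hx2 : 3 * x = 1 by lra.
  by rewrite hx2 in E3 E4; constructor 1; split; lra.
- have i1 := tE ltac:(lra); rewrite i1 !mul1r in E1 E2 E3 E4 E5.
  have hx := z0 _ _ nu E3.
  have /(z0 _ _ nu') hx2 := z0 _ _ i0' (etrans (mulrC _ _) (esym E5)).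
  have hx3 : x' = 1 by lra.
  constructor 2; split=> //; first by lra.
  rewrite (tq1 hx3) hx3 hx in E2; lra.
- have i1 := tE ltac:(lra); have i1' := tE' ltac:(lra); rewrite i1 i1' !mul1r in E1 E2 E3 E4 E5.
  have hx := z0 _ _ nu E5; have hx' : 3 * x = 1 by lra.
  rewrite hx' in E3 E4; have hx2 : 3 * x' = 1 by lra.
  by rewrite hx2 in E3 E4; constructor 1; split; lra.
- have i1 := tE ltac:(lra); have i1' := tE' ltac:(lra); rewrite i1 i1' !mul1r in E1 E2 E3 E4 E5.
  by constructor 1; split; lra.
- have i1 := tE ltac:(lra); rewrite i1 !mul1r in E1 E2 E3 E4 E5.
  have hx := z0 _ _ nu E3.
  have /(z0 _ _ nu') hx2 := z0 _ _ i0' (etrans (mulrC _ _) (esym E2)).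
  have hx3 : 3 * x' = 2 by lra.
  have hx4 : 3 * x = 2 by lra.
  rewrite (tE' ltac:(lra)) hx3 hx4 in E5; constructor 1; split; lra.
- have i1' := tE' ltac:(lra); rewrite i1' !mul1r in E1 E2 E3 E4 E5.
  have hx := z0 _ _ nu' (esym E3).
  have /(z0 _ _ nu) hx2 := z0 _ _ i0 (etrans (mulrC _ _) E5).
  have hx3 : x = 1 by lra.
  constructor 3; split=> //; first by lra.
  rewrite (tp1 hx3) hx3 hx in E2; lra.
- have i1' := tE' ltac:(lra); rewrite i1' !mul1r in E1 E2 E3 E4 E5.
  have hx := z0 _ _ nu' (esym E3).
  have /(z0 _ _ nu) hx2 := z0 _ _ i0 (etrans (mulrC _ _) E2).
  have hx3 : 3 * x = 2 by lra.
  have hx4 : 3 * x' = 2 by lra.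
  rewrite (tE ltac:(lra)) hx3 hx4 in E5; constructor 1; split; lra.
(* In the last third the five listed weights sum to the normalizing factor, so the two factors
   agree. *)
have ii : i = i' by lra.
rewrite -ii in E1 E5; have uu : u = u'.
  by apply: (mulfI (lt0r_neq0 i0)); lra.
rewrite -uu in E5; have := mulIf (lt0r_neq0 nu) (mulfI (lt0r_neq0 i0) E5).
by move=> h; constructor 1; split; lra.
Qed.

Section Mobius.
Variables (R : realType) (n : nat) (Q : 'I_n -> 'I_n -> 'I_n -> 'I_n -> Prop).
Hypothesis QQ : quadrangles Q.
Variable s0 : surface_space R Q.
Variables (a0 b0 a1 b1 a2 c : 'I_n).
Hypotheses (q0 : Q a0 b0 b1 a1) (q1 : Q a1 b1 a0 a2) (q2 : Q a2 a0 b0 c).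
Hypothesis nc : (c != a1) && (c != b1).
Implicit Types (x y u : R) (p q : R * R).

Definition hat (i : nat) x : R := Num.max 0 (1 - `|3 * x - i%:R|).

(** The interval [0,1] goes to [1/4, 3/4], which keeps the strip away from the vertices and turns
    the flip of y into exchanging u and 1 - u. *)
Definition strip_shift y : R := 4^-1 + y / 2.

Definition strip_edge (a b : 'I_n) u : 'rV[R]_n :=
  (1 - u) *: vertex_weight R a + u *: vertex_weight R b.

(** In a patch the products of the weights at opposite vertices are equal. In the face a2 a0 b0 c
    this prescribes the weight of [c] as the product of those of [a2] and [b0] divided by that of
    [a0], which is this expression. *)
Definition turn_weight p : R := (1 - strip_shift p.2) ^+ 2 / strip_shift p.2 * (hat 2 p.1 * hat 3 p.1).

(* A strip through three faces crossing the edges a0b0, a1b1, a2a0, b0a0.  In *)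
(* the last face it turns around a0, and the weights are normalized; the      *)
(* strip stays away from the vertices.                                        *)
Definition strip p : 'rV[R]_n := (1 + turn_weight p)^-1 *:
  (hat 0 p.1 *: strip_edge a0 b0 (strip_shift p.2) +
   hat 1 p.1 *: strip_edge a1 b1 (strip_shift p.2) +
   hat 2 p.1 *: strip_edge a2 a0 (strip_shift p.2) +
   hat 3 p.1 *: strip_edge b0 a0 (strip_shift p.2) + turn_weight p *: vertex_weight R c).

Lemma hatE x : 0 <= x <= 1 -> hats x (hat 0 x) (hat 1 x) (hat 2 x) (hat 3 x).
Proof.
move=> /andP[x0 x1].
have ps i h : 0 <= h -> (3 * x - i%:R = 1 - h) \/ (3 * x - i%:R = h - 1) -> h <= 1 ->
    hat i x = h.
  move=> c0 e c1; rewrite /hat; have -> : `|3 * x - i%:R| = 1 - h.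
    by case: e => ->; [rewrite ger0_norm | rewrite ler0_norm]; lra.
  by rewrite subKr; exact/max_idPr.
have pz i : (3 * x - i%:R >= 1) \/ (3 * x - i%:R <= - 1) -> hat i x = 0.
  move=> e; rewrite /hat; apply/max_idPl; have : 1 <= `|3 * x - i%:R|; last by lra.
  by rewrite ler_normr; case: e => h; apply/orP; [left|right]; lra.
have [x13|x13] := lerP (3 * x) 1.
  constructor 1; split=> //; first by apply: ps; lra.
  - by apply: ps; lra.
  - by apply: pz; lra.
  - by apply: pz; lra.
have [x23|x23] := lerP (3 * x) 2.
  constructor 2; split=> //; first by apply/andP; split=> //; lra.
  - by apply: pz; lra.
  - by apply: ps; lra.
  - by apply: ps; lra.
  - by apply: pz; lra.
constructor 3; split=> //; first by lra.
- by apply: pz; lra.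
- by apply: pz; lra.
- by apply: ps; lra.
- by apply: ps; lra.
Qed.

Lemma hat_continuous i : continuous (hat i).
Proof.
move=> x; apply: (@continuous_max R R (fun=> 0) (fun x => 1 - `|3 * x - i%:R|)); first exact: cvg_cst.
apply: cvgB; first exact: cvg_cst.
by apply: cvg_norm; apply: cvgB; [apply: cvgMr; exact: cvg_id | exact: cvg_cst].
Qed.

Lemma unit_squareP p : unit_square p -> 0 <= p.1 <= 1 /\ 0 <= p.2 <= 1.
Proof. by case; rewrite /= !in_itv. Qed.

Lemma strip_shift_itv p : unit_square p -> 4^-1 <= strip_shift p.2 /\ strip_shift p.2 <= 1 - 4^-1.
Proof. by move=> /unit_squareP[_ /andP[y0 y1]]; rewrite /strip_shift; split; lra. Qed.

Lemma hat_ge0 i x : 0 <= hat i x.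
Proof. by rewrite le_max lexx. Qed.

Lemma turn_weight_ge0 p : unit_square p -> 0 <= turn_weight p.
Proof.
move=> /strip_shift_itv[u0 u1].
by rewrite mulr_ge0 ?divr_ge0 ?sqr_ge0 ?mulr_ge0 ?hat_ge0 //; lra.
Qed.

Lemma strip_continuous : {within @unit_square R, continuous strip}.
Proof.
have c1 : continuous (fun p : R * R => p.1) by move=> ?; exact: cvg_fst.
have c2 : continuous (fun p : R * R => p.2) by move=> ?; exact: cvg_snd.
have cc x : continuous (fun _ : R * R => x) by move=> ?; exact: cvg_cst.
have ch i : continuous (fun p : R * R => hat i p.1).
  by move=> p; apply: (continuous_comp (c1 p)); exact: hat_continuous.
have cs : continuous (fun p : R * R => strip_shift p.2).
  by apply: continuous_add => //; apply: continuous_mul.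
have ct : {within @unit_square R, continuous turn_weight}.
  apply: (@continuous_mul R (subspace (@unit_square R))); last first.
    by apply/continuous_subspaceT/continuous_mul.
  apply: (@continuous_mul R (subspace (@unit_square R))).
    apply: continuous_subspaceT; apply: continuous_mul;
      by apply: continuous_add => //; exact: continuous_opp.
  apply: inv_continuous_within; first exact: continuous_subspaceT.
  by move=> p /strip_shift_itv[u0 _]; apply: lt0r_neq0; lra.
apply: mx_continuous => i j.
rewrite (_ : (fun t => _) = (fun p : R * R => (1 + turn_weight p)^-1 *
  ((hat 0 p.1 * ((1 - strip_shift p.2) * vertex_weight R a0 i j + strip_shift p.2 * vertex_weight R b0 i j) +
  hat 1 p.1 * ((1 - strip_shift p.2) * vertex_weight R a1 i j + strip_shift p.2 * vertex_weight R b1 i j) +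
  hat 2 p.1 * ((1 - strip_shift p.2) * vertex_weight R a2 i j + strip_shift p.2 * vertex_weight R a0 i j) +
  hat 3 p.1 * ((1 - strip_shift p.2) * vertex_weight R b0 i j + strip_shift p.2 * vertex_weight R a0 i j))
  + turn_weight p * vertex_weight R c i j))).
  have cp k (x y : R) : continuous (fun p : R * R => hat k p.1 *
      ((1 - strip_shift p.2) * x + strip_shift p.2 * y)).
    apply: continuous_mul => //; apply: continuous_add; apply: continuous_mul => //.
    by apply: continuous_add => //; apply: continuous_opp.
  apply: (@continuous_mul R (subspace (@unit_square R))).
    apply: inv_continuous_within.
      apply: (@continuous_add R (subspace (@unit_square R))) => //.
      by move=> ?; exact: cvg_cst.
    by move=> p /turn_weight_ge0 t0; apply: lt0r_neq0; lra.
  apply: (@continuous_add R (subspace (@unit_square R))).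
    by apply: continuous_subspaceT; do 3?[apply: continuous_add => //].
  apply: (@continuous_mul R (subspace (@unit_square R))) => //.
  by move=> ?; exact: cvg_cst.
by apply/funext => p; rewrite !mxE.
Qed.

Lemma turn_weightE p : unit_square p -> 3 * p.1 <= 2 -> turn_weight p = 0.
Proof.
move=> /unit_squareP[xx _] h; rewrite /turn_weight; case: (hatE xx) => -[h' _ _ h2 h3];
  rewrite h3 ?mulr0 //.
by have -> : 3 * p.1 - 2 = 0 by [lra]; rewrite !mulr0.
Qed.

Lemma strip_surface p : unit_square p -> surface_set Q (strip p).
Proof.
move=> sp; have [xx _] := unit_squareP sp; have [u0 u1] := strip_shift_itv sp.
have tE := turn_weightE sp; rewrite /strip; case/andP: (xx) => x0 x1.
case: (hatE xx) => -[h h0 h1 h2 h3].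
- rewrite h0 h1 h2 h3 tE; last by lra.
  exists a0, b0, b1, a1, (strip_shift p.2, 3 * p.1); split=> //; first by split=> //=; lra.
  by apply/rowP => j; rewrite quad_point_coord !mxE !eqxx /=; field.
- case/andP: h => h h'; rewrite h0 h1 h2 h3 tE //.
  exists a1, b1, a0, a2, (strip_shift p.2, 3 * p.1 - 1); split=> //; first by split=> //=; lra.
  by apply/rowP => j; rewrite quad_point_coord !mxE !eqxx /=; field.
rewrite /turn_weight h0 h1 h2 h3; move: (strip_shift p.2) u0 u1 => u u0 u1.
have [s sE] : exists s, 3 * p.1 - 2 = s by eexists.
have -> : 3 - 3 * p.1 = 1 - s by lra.
rewrite sE; have [s_ge0 s_le1] : 0 <= s /\ s <= 1 by split; lra.
have us0 : 0 <= (1 - u) * s by apply: mulr_ge0; lra.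
have us1 : 0 <= (1 - u) * (1 - s) by apply: mulr_ge0; lra.
have uss : 0 <= (1 - u) * (1 - s) * ((1 - u) * s) by exact: mulr_ge0.
(* Since x / (1 - x) is the quotient of the weights of [a0] and [a2], and y / (1 - y) that of [b0]
   and [a0], the patch parameters are read off from these ratios. *)
exists a2, a0, b0, c, (u / (u + (1 - u) * (1 - s)), (1 - u) * s / (u + (1 - u) * s)).
split=> //.
  by split=> /=; rewrite ?divr_ge0 ?ler_pdivrMr //; lra.
apply/rowP => j; rewrite quad_point_coord !mxE !eqxx /=.
by field; apply/and4P; split; apply: lt0r_neq0; lra.
Qed.

(** The assumption [nc] makes [c] different from all five vertices, so its weight does not enter
    these coordinates. *)
Lemma strip_coords p :
  [/\ strip p 0 a0 = (1 + turn_weight p)^-1 * (hat 0 p.1 * (1 - strip_shift p.2) +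
         hat 2 p.1 * strip_shift p.2 + hat 3 p.1 * strip_shift p.2),
      strip p 0 b0 = (1 + turn_weight p)^-1 * (hat 0 p.1 * strip_shift p.2 +
         hat 3 p.1 * (1 - strip_shift p.2)),
      strip p 0 a1 = (1 + turn_weight p)^-1 * (hat 1 p.1 * (1 - strip_shift p.2)),
      strip p 0 b1 = (1 + turn_weight p)^-1 * (hat 1 p.1 * strip_shift p.2) &
      strip p 0 a2 = (1 + turn_weight p)^-1 * (hat 2 p.1 * (1 - strip_shift p.2))].
Proof.
have := quad_uniq QQ q0; have := quad_uniq QQ q1; have := quad_uniq QQ q2.
case/andP: nc => m1 m2; rewrite /= !inE !negb_or -!andbA.
case/and5P => n1 n2 n3 n4 /and3P[n5 n6 _]; case/and5P => n7 n8 n9 n10 /and3P[n11 n12 _].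
case/and5P => n13 n14 n15 n16 /and3P[n17 n18 _].
have N : forall a b : 'I_n, a != b -> ((a == b) = false) * ((b == a) = false).
  by move=> a b ab; rewrite (negbTE ab) eq_sym (negbTE ab).
split; rewrite !mxE !eqxx /= ?(N _ _ n1) ?(N _ _ n2) ?(N _ _ n3) ?(N _ _ n4) ?(N _ _ n5)
  ?(N _ _ n6) ?(N _ _ n7) ?(N _ _ n8) ?(N _ _ n9) ?(N _ _ n10) ?(N _ _ n11) ?(N _ _ n12)
  ?(N _ _ n13) ?(N _ _ n14) ?(N _ _ n15) ?(N _ _ n16) ?(N _ _ n17) ?(N _ _ n18)
  ?(N _ _ m1) ?(N _ _ m2) /=; ring.
Qed.

Lemma strip_glued p q : unit_square p -> unit_square q ->
  strip p = strip q <-> mobius_glued p q.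
Proof.
move=> sp sq; have [xp yp] := unit_squareP sp; have [xq yq] := unit_squareP sq; split; last first.
  have z01 : 0 <= (0 : R) <= 1 by rewrite lexx ler01.
  have z11 : 0 <= (1 : R) <= 1 by rewrite lexx ler01.
  have e0 : [/\ hat 0 0 = 1, hat 1 0 = 0, hat 2 0 = 0 & hat 3 0 = 0].
    by case: (hatE z01) => -[]; rewrite ?mulr0 //; try lra; move=> ? -> -> -> ->; split=> //; lra.
  have e1' : [/\ hat 0 1 = 0, hat 1 1 = 0, hat 2 1 = 0 & hat 3 1 = 1].
    by case: (hatE z11) => -[]; rewrite ?mulr1 //; try lra; move=> ? -> -> -> ->; split=> //; lra.
  case: e0 => h00 h10 h20 h30; case: e1' => h01 h11 h21 h31.
  by case=> [->//|[ep eq e']|[ep eq e']]; rewrite /strip /turn_weight ep eq e'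
    h00 h10 h20 h30 h01 h11 h21 h31 !(mul0r, mulr0, addr0);
    apply/rowP => j; rewrite !mxE /strip_shift; field.
move=> epq; have [A0 B0 A1 B1 A2] := strip_coords p; have := strip_coords q.
rewrite -epq A0 B0 A1 B1 A2 {A0 B0 A1 B1 A2 epq}.
have := turn_weightE sp; have := turn_weightE sq.
have := turn_weight_ge0 sp; have := turn_weight_ge0 sq.
have tp1 : p.1 = 1 -> turn_weight p = 0.
  move=> h; rewrite /turn_weight; have : hat 2 p.1 = 0.
    by case: (hatE xp) => -[? _ _ -> _]; lra.
  by move=> ->; rewrite mul0r mulr0.
have tq1 : q.1 = 1 -> turn_weight q = 0.
  move=> h; rewrite /turn_weight; have : hat 2 q.1 = 0.
    by case: (hatE xq) => -[? _ _ -> _]; lra.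
  by move=> ->; rewrite mul0r mulr0.
have [u0 u1] := strip_shift_itv sp; have [v0 v1] := strip_shift_itv sq.
move: (turn_weight p) (turn_weight q) tp1 tq1 => t t' tp1 tq1 t0' t0 tE' tE E.
have [i i0 iE] : exists2 i, 0 < i & i = (1 + t)^-1 by exists (1 + t)^-1; rewrite ?invr_gt0 //; lra.
have [i' i0' iE'] : exists2 i, 0 < i & i = (1 + t')^-1.
  by exists (1 + t')^-1; rewrite ?invr_gt0 //; lra.
rewrite -iE -iE' in E.
have u01 : 0 < strip_shift p.2 < 1 by apply/andP; split; lra.
have v01 : 0 < strip_shift q.2 < 1 by apply/andP; split; lra.
have := strip_params (hatE xp) (hatE xq) u01 v01 i0 i0' _ _ _ _ E.
case=> [/tE h|/tE' h|/tp1 h|/tq1 h|[e1]|[e1 e1']|[e1 e1']]; rewrite ?iE ?iE' ?h ?addr0 ?invr1 //.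
- by rewrite /strip_shift => e2; constructor 1; rewrite [p]surjective_pairing e1
    (_ : p.2 = q.2) -?surjective_pairing //; lra.
- by rewrite /strip_shift => e2; constructor 2; split=> //; lra.
- by rewrite /strip_shift => e2; constructor 3; split=> //; lra.
Qed.

Lemma twisted_strip_nonorientable : nonorientable R (surface_space R Q).
Proof.
exists (to_surface s0 \o strip); split.
  apply: to_surface_continuous; first exact: strip_continuous.
  exact: strip_surface.
move=> p q pu qu; rewrite -(strip_glued pu qu) /=; split=> [e'|->//].
by rewrite -(to_surfaceK s0 (strip_surface pu)) e' to_surfaceK //; exact: strip_surface.
Qed.

End Mobius.

End Topology.

(** * Quadrangulations on ordinals *)

Lemma walk_nth (T : eqType) (x0 a : T) s u w : walk a s u w <->
  exists2 i, i < size s & upair (nth x0 (a :: s) i) (nth x0 s i) u w.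
Proof.
elim: s a => [|b s IH] a /=; first by split=> // -[].
split=> [/orP[h|/IH[i ilt h]]|[[|i] ilt h]]; [by exists 0 | by exists i.+1 | by rewrite h |].
by apply/orP; right; apply/IH; exists i.
Qed.

Lemma cyc_nth (T : eqType) (x0 : T) s u w : cyc s u w <->
  exists2 i, i < size s & upair (nth x0 s i) (nth x0 s (i.+1 %% size s)) u w.
Proof.
case: s => [|a s]; first by split=> // -[].
rewrite cyc_consE (walk_nth x0) size_rcons.
have e i : i < (size s).+1 -> nth x0 (a :: rcons s a) i = nth x0 (a :: s) i /\
    nth x0 (rcons s a) i = nth x0 (a :: s) (i.+1 %% (size s).+1).
  move=> il; rewrite -rcons_cons !nth_rcons /= il; split=> //.
  rewrite ltnS leq_eqVlt in il; case/orP: il => [/eqP ->|il]; first by rewrite ltnn eqxx modnn.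
  by rewrite il modn_small.
by split=> -[i il h]; exists i => //; have [e1 e2] := e i il; [rewrite e1 e2 in h | rewrite e1 e2].
Qed.

Section Ordinals.
Variables (n : nat) (Q : quad_rel).
Hypothesis QQ : quads n Q.

Definition ord_rel (a b c d : 'I_n) : Prop := Q a b c d.

Lemma ord_quadrangles : quadrangles ord_rel.
Proof.
have qq := quads_quad QQ; split.
- by move=> a b c d; exact: (quad_rot qq).
- by move=> a b c d; exact: (quad_rev qq).
- by move=> a b c d /(quad_neq qq).
- by move=> a b c d d' q q'; apply: val_inj; exact: (quad_corner qq q q').
- by move=> a b c d; exact: (quad_cross qq).
Qed.

Lemma quads_lt4 a b c d : Q a b c d -> [/\ a < n, b < n, c < n & d < n].
Proof.
have lt := quads_lt QQ; have r := quad_rot (quads_quad QQ); move=> q; split.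
- exact: lt q.
- exact: (lt _ _ _ _ (r _ _ _ _ q)).
- exact: (lt _ _ _ _ (r _ _ _ _ (r _ _ _ _ q))).
- exact: (lt _ _ _ _ (r _ _ _ _ (r _ _ _ _ (r _ _ _ _ q)))).
Qed.

Lemma ord_link (v : 'I_n) : exists s, link_cycle ord_rel v s.
Proof.
have [s l] := quads_link QQ (ltn_ord v); have [us s4 h] := l.
exists [seq insubd v u | u <- s].
have sv : [seq val u | u <- [seq insubd v u | u <- s]] = s.
  rewrite -map_comp -[RHS]map_id; apply/eq_in_map => u us' /=.
  by rewrite insubdK //; exact: (link_lt QQ l us').
have nthE i : i < size s -> val (nth v [seq insubd v u | u <- s] i) = nth (val v) s i.
  by move=> il; rewrite -[in RHS]sv (nth_map v) // size_map.
have mlt i : i < size s -> i.+1 %% size s < size s by move=> il; rewrite ltn_mod; lia.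
split.
- by apply: (@map_uniq _ _ val); rewrite sv.
- by rewrite size_map.
- move=> i; rewrite size_map => il.
  have : cyc s (nth (val v) s i) (nth (val v) s (i.+1 %% size s)).
    by apply/(cyc_nth (val v)); exists i => //; rewrite /upair !eqxx.
  move=> /h[c q]; have [_ _ cn _] := quads_lt4 q; exists (Ordinal cn).
  by rewrite /ord_rel !nthE // mlt.
move=> a c b q; have /(cyc_nth (val v))[i il ab] : cyc s a b by apply/h; exists c.
exists i; rewrite size_map //; rewrite -!nthE ?mlt // in ab.
by case/upairP: ab => -[/val_inj -> /val_inj ->]; [left | right].
Qed.

Lemma ord_adj (a b : 'I_n) : quad_adj ord_rel a b <-> adj Q a b.
Proof.
split=> [/asboolP[c [d q]]|[c [d q]]]; first by exists c, d.
have [_ _ cn dn] := quads_lt4 q; apply/asboolP.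
by exists (Ordinal cn), (Ordinal dn).
Qed.

Lemma ord_edges M : 0 < n -> misses n Q M -> uniq M -> all (fun p => p.1 < p.2 < n) M ->
  #|edge_set (quad_adj ord_rel)| = 'C(n, 2) - size M.
Proof.
move=> n0 mM uM /allP Mn.
pose x0 : 'I_n := Ordinal n0.
pose pr (p : nat * nat) : {set 'I_n} := [set insubd x0 p.1; insubd x0 p.2]%SET.
have valE i : i < n -> val (insubd x0 i) = i by move=> il; rewrite insubdK.
have prM p : p \in M -> pr p = [set insubd x0 p.1; insubd x0 p.2]%SET /\
    val (insubd x0 p.1) = p.1 /\ val (insubd x0 p.2) = p.2.
  by move=> /Mn /andP[p12 pn]; rewrite !valE // (ltn_trans p12 pn).
have prI : {in M &, injective pr}.
  move=> p q pM qM; have [_ [p1 p2]] := prM _ pM; have [_ [q1 q2]] := prM _ qM.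
  have /andP[p12 _] := Mn _ pM; have /andP[q12 _] := Mn _ qM.
  case: p q {pM qM} p1 p2 q1 q2 p12 q12 => [p1 p2] [q1 q2] /= <- <- <- <- /= p12 q12.
  rewrite /pr /= !valKd => /set2_eq[[-> ->] //|[e1 e2]].
  by move: p12 q12; rewrite e1 e2 => h1 h2; have := ltn_trans h1 h2; rewrite ltnn.
(* The edges are the two-element sets outside the image of [M], and [pr] is injective on [M] because
   its pairs are increasing. *)
have eE : edge_set (quad_adj ord_rel) =
    ([set A : {set 'I_n} | #|A| == 2] :\: [set A in [seq pr p | p <- M]])%SET.
  apply/setP => A; rewrite !inE; apply/imsetP/andP.
    case=> -[a b]; rewrite inE /= => /ord_adj/mM[_ _ ab nM] ->; split; last by rewrite cards2 ab.
    apply/mapP => -[p pM]; have [-> [p1 p2]] := prM _ pM.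
    case/set2_eq => -[e1 e2]; move/negP: nM; apply; rewrite /sym_mem e1 e2 p1 p2.
      by rewrite -surjective_pairing pM.
    by rewrite -surjective_pairing pM orbT.
  case=> nA /cards2P[a [b [ab Aab]]]; rewrite Aab in nA *; exists (a, b) => //; rewrite inE /=.
  apply/ord_adj/mM; split; rewrite ?ltn_ord //.
  apply/negP => /orP[] m.
    by case/negP: nA; apply/mapP; exists (val a, val b) => //; rewrite /pr /= !valKd.
  case/negP: nA; apply/mapP; exists (val b, val a) => //.
  by rewrite /pr /= !valKd finset.setUC.
rewrite eE cardsD (finset.setIidPr _).
  rewrite card_draws card_ord; congr (_ - _).
  by rewrite finset.cardsE -(size_map pr); apply/card_uniqP; rewrite map_inj_in_uniq.
apply/fintype.subsetP => A; rewrite finset.inE => /mapP[p pM ->]; have [-> [p1 p2]] := prM _ pM.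
have /andP[p12 _] := Mn _ pM; rewrite inE cards2 -val_eqE p1 p2.
by rewrite (ltn_eqF p12).
Qed.

End Ordinals.

Lemma realizable_quadrangulation (R : realType) n t : realizable n t ->
  exists (e : rel 'I_n) (S : topologicalType) (M : embedding R e S)
         (bw : set S -> seq 'I_n),
    [/\ quadrangulation t M bw,
        nonorientable R S,
        face_simple M bw &
        exists v : 'I_n, forall u : 'I_n, u != v -> e v u].
Proof.
case=> Q [M [v [QQ mM [uM wM] sM [[vn hub] [a0 [b0 [a1 [b1 [a2 [c [q0 q1 q2 nc]]]]]]]]]]].
have qq := ord_quadrangles QQ.
have [a0n b0n b1n a1n] := quads_lt4 QQ q0; have [_ _ _ a2n] := quads_lt4 QQ q1.
have [_ _ _ cn] := quads_lt4 QQ q2.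
pose o0 := Ordinal a0n; pose p0 := Ordinal b0n; pose o1 := Ordinal a1n.
pose p1 := Ordinal b1n; pose o2 := Ordinal a2n; pose oc := Ordinal cn.
have w0 : surface_set (ord_rel Q) (quad_point o0 p0 p1 o1 (0%R : R, 0%R : R)).
  exists o0, p0, p1, o1, (0, 0)%R; split=> //.
have s0 : surface_space R (ord_rel Q) := SigSub (mem_set w0).
have hubP (u : 'I_n) : u != Ordinal vn -> quad_adj (ord_rel Q) (Ordinal vn) u.
  by move=> uv; apply/(ord_adj QQ); exact: hub.
have link := ord_link QQ.
have covered (a : 'I_n) : exists b, quad_adj (ord_rel Q) a b.
  have [s [_ s4 h _]] := link a; have [|b q] := h 0; first exact: ltn_trans s4.
  by exists (nth a s 0); apply/asboolP; exists b; eexists; exact: q.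
exists (quad_adj (ord_rel Q)), (surface_space R (ord_rel Q)), (model qq s0 covered),
  (@face_walk R n (ord_rel Q)); split.
- split.
  + exact: (quads_surface qq link s0 hubP).
  + split; first by split; [exact: quad_adj_sym | exact: quad_adj_irr].
    by rewrite (ord_edges QQ _ mM) ?sM //; exact: (leq_ltn_trans _ vn).
  + exact: face_cellular.
  + exact: face_boundary_walks.
  + exact: face_quadrangular.
- exact: (@twisted_strip_nonorientable R n _ qq s0 o0 p0 o1 p1 o2 oc).
- exact: face_face_simple.
- by exists (Ordinal vn).
Qed.

Theorem theorem3p2 (R : realType) (n t : nat) :
  (6 <= n)%N -> (t <= n - 4)%N -> (t = (n * (n - 5)) %/ 2 %[mod 2])%N ->
  exists (e : rel 'I_n) (S : topologicalType) (M : embedding R e S)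
         (bw : set S -> seq 'I_n),
    [/\ quadrangulation t M bw,
        nonorientable R S,
        face_simple M bw &
        exists v : 'I_n, forall u : 'I_n, u != v -> e v u].
Proof.
by move=> n6 tn tp; apply: realizable_quadrangulation; exact: realizable_all.
Qed.
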